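(* Every nonzero real 2-solvable Frobenius Lie algebra of dimension $\le 6$ is isomorphic to one of $\mathfrak{aff}(\mathbb R)$, $\mathfrak D_0^2$, $\mathfrak{aff}(\mathbb C)$, $\mathfrak D_0^3$, $\mathcal G_{3,1}$, or to one of the direct sums $\mathfrak{aff}(\mathbb R)\oplus\mathfrak{aff}(\mathbb R)$, $\mathfrak D_0^2\oplus\mathfrak{aff}(\mathbb R)$, $\mathfrak{aff}(\mathbb C)\oplus\mathfrak{aff}(\mathbb R)$, $\mathfrak{aff}(\mathbb R)\oplus\mathfrak{aff}(\mathbb R)\oplus\mathfrak{aff}(\mathbb R)$. In dimension $8$ there are, up to isomorphism, exactly $14$ real 2-solvable Frobenius Lie algebras. Nine of them are of the form $\mathcal G_M=\mathbb R[M]\ltimes\mathbb R^4$ for some nonderogatory $M\in\mathfrak{gl}(4,\mathbb R)$, namely $\mathfrak D_{0,1}^4$, $\mathfrak D_0^4$, $\mathfrak D_0^3\oplus\mathfrak{aff}(\mathbb R)$, $\mathfrak D_0^2\oplus\mathfrak D_0^2$, $\mathfrak D_0^2\oplus\mathfrak{aff}(\mathbb C)$, $\mathfrak D_0^2\oplus\mathfrak{aff}(\mathbb R)\oplus\mathfrak{aff}(\mathbb R)$, $\mathfrak{aff}(\mathbb C)\oplus\mathfrak{aff}(\mathbb C)$, $\mathfrak{aff}(\mathbb C)\oplus\mathfrak{aff}(\mathbb R)\oplus\mathfrak{aff}(\mathbb R)$, $\mathfrak{aff}(\mathbb R)\oplus\mathfrak{aff}(\mathbb R)\oplus\mathfrak{aff}(\mathbb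 R)\oplus\mathfrak{aff}(\mathbb R)$; and five of them are not given by a nonderogatory $M\in\mathfrak{gl}(4,\mathbb R)$, namely $\mathcal G_{4,1}$, $\mathfrak h_{4,2}$, $\mathfrak h_{4,3}$, $\mathcal G_{4,4}'$, $\mathcal G_{3,1}\oplus\mathfrak{aff}(\mathbb R)$.
   Context: A Lie algebra $\mathcal G$ is Frobenius if there is $\alpha\in\mathcal G^*$ such that $\partial\alpha(u,v):=-\alpha([u,v])$ is a nondegenerate bilinear form on $\mathcal G$; it is 2-solvable if $[\mathcal G,\mathcal G]$ is Abelian. A matrix is nonderogatory if its characteristic and minimal polynomials coincide (up to sign); $\mathbb R[M]$ is the algebra of real polynomials in $M$. For an Abelian Lie subalgebra $\mathfrak B\subset\mathfrak{gl}(n,\mathbb R)$, $\mathfrak B\ltimes\mathbb R^n$ is $\mathfrak B\oplus\mathbb R^n$ with bracket $[a,b]=0$, $[x,y]=0$, $[a,x]=ax$ for $a,b\in\mathfrak B$, $x,y\in\mathbb R^n$. $E_{i,j}$ is the elementary $n\times n$ matrix with $1$ in entry $(i,j)$; $\mathbb I_n$ is the $n\times n$ identity. $\mathfrak{aff}(\mathbb R)$: basis $(e_1,e_2)$, $[e_1,e_2]=e_2$. $\mathfrak{aff}(\mathbb C)$: real Lie algebra with basis $(e_1,\dots,e_4)$ and nonzero brackets $[e_1,e_3]=e_3$, $[e_1,e_4]=e_4$, $[e_2,e_3]=e_4$, $[e_2,e_4]=-e_3$. $\mathfrak D_0^n:=\mathbb R[M_0]\ltimes\mathbb R^n$ with $M_0=\sum_{i=1}^{n-1}E_{i,i+1}\in\mathfrak{gl}(n,\mathbb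 R)$. $\mathfrak D_{0,1}^4:=\mathbb R[M_{0,1}]\ltimes\mathbb R^4$ with $M_{0,1}=E_{2,1}-E_{1,2}+E_{4,3}-E_{3,4}+E_{1,3}+E_{2,4}$. $\mathcal G_{n,1}:=\mathrm{span}(\mathbb I_n,E_{1,2},\dots,E_{1,n})\ltimes\mathbb R^n$. $\mathfrak h_{4,2}:=\mathrm{span}(\mathbb I_4,\,E_{1,2}+E_{2,4},\,E_{1,3},\,E_{1,4})\ltimes\mathbb R^4$. $\mathfrak h_{4,3}:=\mathrm{span}(\mathbb I_4,\,E_{1,2}+E_{2,4},\,E_{1,3}+E_{3,4},\,E_{1,4})\ltimes\mathbb R^4$. $\mathcal G_{4,4}':=\mathrm{span}(\mathbb I_4,\,E_{1,2}+E_{3,4},\,E_{1,3}+E_{2,4},\,E_{1,4})\ltimes\mathbb R^4$. *)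

(* Defs.v *)
From HB Require Import structures.
From mathcomp Require Import all_boot all_order all_algebra all_field.
From mathcomp Require Import ring zify.
From mathcomp Require Import reals.

Set Implicit Arguments.
Unset Strict Implicit.
Unset Printing Implicit Defensive.

Import GRing.Theory.
Local Open Scope ring_scope.

Declare Scope lie_scope.
Delimit Scope lie_scope with lie.

HB.mixin Record Vector_isLieAlgebra (R : nzRingType) L of Vector R L := {
  lie : L -> L -> L;
  lie_linearl : forall v, linear (lie^~ v);
  lie_linearr : forall u, linear (lie u);
  lievv : forall u, lie u u = 0;
  lie_jacobi : forall u v w,
    lie u (lie v w) + lie v (lie w u) + lie w (lie u v) = 0
}.

#[short(type="lieAlgType")]
HB.structure Definition LieAlgebra (R : nzRingType) :=
  { L of Vector R L & Vector_isLieAlgebra R L }.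

HB.instance Definition _ (R : nzRingType) (L : lieAlgType R) :=
  bilinear_isBilinear.Build R L L L *:%R *:%R (@lie R L)
    (@lie_linearl R L, @lie_linearr R L).

Section LieTheory.
Variables (R : fieldType) (L : lieAlgType R).
Implicit Types (u v w : L) (U V W : {vspace L}).

Lemma lieC u v : lie u v = - lie v u.
Proof.
apply/eqP; rewrite -addr_eq0; apply/eqP.
by have := lievv (u + v); rewrite linearDr !linearDl /= !lievv add0r addr0 addrC.
Qed.

Definition lie_prodv U V : {vspace L} :=
  <<allpairs (@lie R L) (vbasis U) (vbasis V)>>%VS.

Lemma memv_lie U V : {in U & V, forall u v, lie u v \in lie_prodv U V}.
Proof.
move=> u v /coord_vbasis-> /coord_vbasis->.
rewrite linear_sumlz /=; apply: memv_suml => i _.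
rewrite linear_sumr /=; apply: memv_suml => j _.
rewrite linearZlr /= !memvZ // memv_span //.
by apply/allpairsP; exists ((vbasis U)`_i, (vbasis V)`_j);
  rewrite !mem_nth ?size_tuple.
Qed.

Lemma lie_prodvP U V W :
  reflect {in U & V, forall u v, lie u v \in W} (lie_prodv U V <= W)%VS.
Proof.
apply: (iffP idP) => [/subvP sW u v uU vV | UVW]; first exact/sW/memv_lie.
by apply/span_subvP=> _ /allpairsP[[u v] [/= uU vV ->]]; rewrite UVW ?vbasis_mem.
Qed.

Definition lie_abelian U : Prop := {in U &, forall u v, lie u v = 0}.

Definition two_solvable : Prop := lie_abelian (lie_prodv fullv fullv).

Definition dform (alpha : {scalar L}) u v : R := - alpha (lie u v).

Section DForm.
Variable alpha : {scalar L}.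

Fact dform_bilinear : bilinear_for *%R (idfun \; *%R) (dform alpha).
Proof.
by split=> [u' a u v | u a v w] /=; rewrite /dform ?linearPl ?linearPr /=
  raddfD /= linearZ /= opprD mulrN.
Qed.
HB.instance Definition _ :=
  bilinear_isBilinear.Build R L L R *%R (idfun \; *%R) (dform alpha)
    dform_bilinear.

Fact dform_skew u v :
  dform alpha u v = (-1) ^+ true * idfun (dform alpha v u).
Proof. by rewrite /dform /= expr1 mulN1r opprK lieC raddfN opprK. Qed.
HB.instance Definition _ :=
  isHermitianSesquilinear.Build R L true idfun (dform alpha) dform_skew.
End DForm.

Definition frobenius : Prop :=
  exists alpha : {scalar L}, nondegenerate (dform alpha).

End LieTheory.

Arguments two_solvable {R} L.
Arguments frobenius {R} L.

Definition lie_isom (R : fieldType) (L1 L2 : lieAlgType R) : Prop :=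
  exists2 f : {linear L1 -> L2},
    bijective f & {morph f : u v / lie u v >-> lie u v}.

Section DirectSum.
Variables (R : fieldType) (L1 L2 : lieAlgType R).
Implicit Types u v w : L1 * L2.

Let lie2 u v : L1 * L2 := (lie u.1 v.1, lie u.2 v.2).

Fact lie2_linearl v : linear (lie2^~ v).
Proof. by move=> a x y; rewrite /lie2 !linearPl. Qed.
Fact lie2_linearr u : linear (lie2 u).
Proof. by move=> a x y; rewrite /lie2 !linearPr. Qed.
Fact lie2vv u : lie2 u u = 0.
Proof. by rewrite /lie2 !lievv. Qed.
Fact lie2_jacobi u v w :
  lie2 u (lie2 v w) + lie2 v (lie2 w u) + lie2 w (lie2 u v) = 0.
Proof. by congr pair; apply: lie_jacobi. Qed.

HB.instance Definition _ := Vector_isLieAlgebra.Build R (L1 * L2)%type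
  lie2_linearl lie2_linearr lie2vv lie2_jacobi.

Definition lie_dsum : lieAlgType R := (L1 * L2)%type.
End DirectSum.

Notation "L1 \oplus L2" := (lie_dsum L1 L2)
  (at level 50, left associativity) : lie_scope.

Section SemiDirect.
Variable R : fieldType.

(* Commuting matrices have zero commutator, so closure under the bracket is
   automatic. *)
Record abelianSubalg n := AbelianSubalg {
  abelian_vspace :> {vspace 'M[R]_n};
  abelian_comm : {in abelian_vspace &, forall a b, comm_mx a b}
}.

Variables (n : nat) (B : abelianSubalg n).

(* A separate constant, so that this bracket is not confused with the
   componentwise one on product types. *)
Definition semidirect_type := (subvs_of B * 'cV[R]_n)%type.
HB.instance Definition _ := Vector.on semidirect_type.
Implicit Types u v w : semidirect_type.

Let liesd u v : semidirect_type :=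
  (0, vsval u.1 *m v.2 - vsval v.1 *m u.2).

Fact liesd_linearl v : linear (liesd^~ v).
Proof.
move=> a x y; congr pair => /=; first by rewrite scaler0 addr0.
by rewrite mulmxDl mulmxDr -scalemxAl -scalemxAr scalerBr opprD addrACA.
Qed.
Fact liesd_linearr u : linear (liesd u).
Proof.
move=> a x y; congr pair => /=; first by rewrite scaler0 addr0.
by rewrite mulmxDl mulmxDr -scalemxAl -scalemxAr scalerBr opprD addrACA.
Qed.
Fact liesdvv u : liesd u u = 0.
Proof. by rewrite /liesd subrr. Qed.
Fact liesd_jacobi u v w :
  liesd u (liesd v w) + liesd v (liesd w u) + liesd w (liesd u v) = 0.
Proof.
congr pair => /=; first by rewrite !addr0.
rewrite !mul0mx !subr0 !mulmxBr !mulmxA.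
rewrite (abelian_comm (subvsP v.1) (subvsP u.1)).
rewrite (abelian_comm (subvsP w.1) (subvsP u.1)).
rewrite (abelian_comm (subvsP w.1) (subvsP v.1)).
by rewrite [X in X + _]addrC !addrA !subrK subrr.
Qed.

HB.instance Definition _ := Vector_isLieAlgebra.Build R semidirect_type
  liesd_linearl liesd_linearr liesdvv liesd_jacobi.

Definition semidirect : lieAlgType R := semidirect_type.
End SemiDirect.

Section PolyAlgebra.
Variables (R : fieldType) (n : nat) (M : 'M[R]_n.+1).

Lemma memv_agenv_horner A :
  reflect (exists p, A = horner_mx M p) (A \in <<1; M>>%VS).
Proof.
pose h (v : 'rV[R]_n.+1) := horner_mx M (rVpoly v).
have h_lin : linear h by move=> a u v; rewrite /h linearP /= linearP.
pose hL := GRing.isLinear.Build _ _ _ _ h h_lin.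
pose hl : {linear _ -> _} := HB.pack h hL.
have hP p : horner_mx M p \in limg (linfun hl).
  apply/memv_imgP; exists (poly_rV (p %% char_poly M)); first exact: memvf.
  rewrite lfunE /= /h poly_rV_K; last first.
    rewrite -ltnS -(size_char_poly M) ltn_modp.
    exact/monic_neq0/char_poly_monic.
  by rewrite {1}(divp_eq p (char_poly M)) rmorphD rmorphM /=
     Cayley_Hamilton mulr0 add0r.
apply: (iffP idP) => [|[p ->]].
  suff /subvP sW : (<<1; M>> <= limg (linfun hl))%VS.
    by move=> /sW /memv_imgP[v _ ->]; exists (rVpoly v); rewrite lfunE.
  apply: agenv_sub_modl; first by have := hP 1; rewrite rmorph1 -memvE.
  apply/prodvP=> u w /memv_addP[_ /vlineP[a ->] [_ /vlineP[b ->] ->]].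
  case/memv_imgP=> v _ ->; rewrite lfunE /= /h.
  have -> : a%:A + b *: M = horner_mx M (a%:P + b *: 'X).
    by rewrite rmorphD /= horner_mx_C linearZ /= horner_mx_X scalemx1.
  by rewrite -rmorphM; apply: hP.
elim/poly_ind: p => [|p c IHp]; first by rewrite rmorph0 mem0v.
rewrite rmorphD rmorphM /= horner_mx_X horner_mx_C -scalemx1.
have sub1M := sub_agenv (1 + <[M]>)%VS.
apply: memvD.
  rewrite -[agenv _]agenvM memv_mul //.
  exact: subvP sub1M _ (subvP (addvSr _ _) _ (memv_line M)).
by apply: memvZ; apply: (subvP (sub1_agenv _)); apply: memv_line.
Qed.

Fact polyalg_comm : {in <<1; M>>%VS &, forall a b, comm_mx a b}.
Proof.
move=> _ _ /memv_agenv_horner[p ->] /memv_agenv_horner[q ->].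
by apply/comm_mx_sym; rewrite /comm_mx -[LHS]rmorphM -[RHS]rmorphM mulrC.
Qed.

Definition polyalg : abelianSubalg R n.+1 := AbelianSubalg polyalg_comm.

Definition nonderogatory : Prop := char_poly M = mxminpoly M.

End PolyAlgebra.

Section SpanAbelian.
Variables (R : fieldType) (n : nat).

Fact span_comm (s : seq 'M[R]_n) :
  {in s &, forall a b, comm_mx a b} -> {in <<s>>%VS &, forall a b, comm_mx a b}.
Proof.
move=> sC; rewrite -[s]in_tupleE => a b /coord_span-> /coord_span->.
rewrite /comm_mx mulmx_suml mulmx_sumr; apply: eq_bigr => i _.
rewrite mulmx_suml mulmx_sumr; apply: eq_bigr => j _.
rewrite -!scalemxAl -!scalemxAr scalerA mulrC -scalerA.
by congr (_ *: (_ *: _)); apply: sC; rewrite mem_nth.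
Qed.

Definition span_abelian s sC : abelianSubalg R n := AbelianSubalg (@span_comm s sC).
End SpanAbelian.

Section AffineAlgebras.
Variable R : fieldType.

Definition plucker n (x y : 'rV[R]_n) (i j : 'I_n) : R :=
  x 0 i * y 0 j - x 0 j * y 0 i.

Fact pluckerPl n (a : R) (x x' y : 'rV_n) i j :
  plucker (a *: x + x') y i j = a * plucker x y i j + plucker x' y i j.
Proof. by rewrite /plucker !mxE; ring. Qed.
Fact pluckerPr n (a : R) (x y y' : 'rV_n) i j :
  plucker x (a *: y + y') i j = a * plucker x y i j + plucker x y' i j.
Proof. by rewrite /plucker !mxE; ring. Qed.
Fact pluckervv n (x : 'rV_n) i j : plucker x x i j = 0.
Proof. by rewrite /plucker; ring. Qed.

(* Ordinals start at 0: in both affine algebras below, the k-th basis vector e_k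
   (k >= 1) is the unit row vector with index k - 1. *)
Definition aff_real_type := 'rV[R]_2.
HB.instance Definition _ := Vector.on aff_real_type.

Let lieAR (x y : aff_real_type) : aff_real_type :=
  plucker x y 0 1 *: delta_mx 0 1.

Fact lieAR_linearl y : linear (lieAR^~ y).
Proof. by move=> a x x'; rewrite /lieAR pluckerPl scalerDl scalerA. Qed.
Fact lieAR_linearr x : linear (lieAR x).
Proof. by move=> a y y'; rewrite /lieAR pluckerPr scalerDl scalerA. Qed.
Fact lieARvv x : lieAR x x = 0.
Proof. by rewrite /lieAR pluckervv scale0r. Qed.
Fact lieAR_jacobi x y z :
  lieAR x (lieAR y z) + lieAR y (lieAR z x) + lieAR z (lieAR x y) = 0.
Proof.
by apply/rowP=> k; rewrite /lieAR /plucker !mxE /=; ring.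
Qed.

HB.instance Definition _ := Vector_isLieAlgebra.Build R aff_real_type
  lieAR_linearl lieAR_linearr lieARvv lieAR_jacobi.
Definition aff_real : lieAlgType R := aff_real_type.

Definition aff_complex_type := 'rV[R]_4.
HB.instance Definition _ := Vector.on aff_complex_type.

Let lieAC (x y : aff_complex_type) : aff_complex_type :=
  (plucker x y 0 2 - plucker x y 1 3) *: delta_mx 0 2 +
  (plucker x y 0 3 + plucker x y 1 2) *: delta_mx 0 3.

Fact lieAC_linearl y : linear (lieAC^~ y).
Proof.
move=> a x x'; rewrite /lieAC !pluckerPl; apply/rowP=> k; rewrite !mxE; ring.
Qed.
Fact lieAC_linearr x : linear (lieAC x).
Proof.
move=> a y y'; rewrite /lieAC !pluckerPr; apply/rowP=> k; rewrite !mxE; ring.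
Qed.
Fact lieACvv x : lieAC x x = 0.
Proof. by rewrite /lieAC !pluckervv subrr addr0 !scale0r addr0. Qed.
Fact lieAC_jacobi x y z :
  lieAC x (lieAC y z) + lieAC y (lieAC z x) + lieAC z (lieAC x y) = 0.
Proof.
by apply/rowP=> k; rewrite /lieAC /plucker !mxE /=; ring.
Qed.

HB.instance Definition _ := Vector_isLieAlgebra.Build R aff_complex_type
  lieAC_linearl lieAC_linearr lieACvv lieAC_jacobi.
Definition aff_complex : lieAlgType R := aff_complex_type.

Fact aff_real_lieE : lie (delta_mx 0 0 : aff_real) (delta_mx 0 1) = delta_mx 0 1.
Proof.
by apply/rowP=> k; rewrite /= !mxE /plucker !mxE /=; ring.
Qed.

Fact aff_complex_lieE (e : 'I_4 -> aff_complex) (eE : e =1 delta_mx 0) :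
  [/\ lie (e 0) (e 2) = e 2, lie (e 0) (e 3) = e 3,
      lie (e 1) (e 2) = e 3 & lie (e 1) (e 3) = - e 2] /\
  lie (e 0) (e 1) = 0 /\ lie (e 2) (e 3) = 0.
Proof.
by do !split; apply/rowP=> k; rewrite !eE /= !mxE /plucker !mxE /=; ring.
Qed.

End AffineAlgebras.

Section MatrixAlgebras.
Variable R : fieldType.

(* Elementary matrix with rows and columns numbered from 1. *)
Definition Emx n (i j : nat) : 'M[R]_n.+1 := delta_mx (inord i.-1) (inord j.-1).
Arguments Emx {n} (i j)%_N.

Lemma mul_Emx n (i j k l : nat) : (0 < j <= n.+1)%N -> (0 < k <= n.+1)%N ->
  Emx i j *m Emx k l = if j == k then Emx i l else 0 :> 'M_n.+1.
Proof.
case: j => // j; case: k => // k jn kn; rewrite /Emx mul_delta_mx_cond /=.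
by rewrite -val_eqE /= !inordK // eqSS; case: eqP.
Qed.

Local Ltac comm_gens :=
  move=> a b; rewrite !inE => /or4P[] /eqP-> /or4P[] /eqP->;
  rewrite /comm_mx ?(mulmx1, mul1mx, mulmxDl, mulmxDr) //;
  rewrite !mul_Emx //= ?(addr0, add0r).

Definition polysd n (M : 'M[R]_n.+1) : lieAlgType R := semidirect (polyalg M).

(* The matrix size n must be positive to form R[M], so it is written n.-1.+1,
   which is n for n > 0 (and n = 0 is never used). *)
Definition M0 n : 'M[R]_n.-1.+1 := \sum_(1 <= i < n) Emx i i.+1.
Definition D0 n : lieAlgType R := polysd (M0 n).

Definition M01 : 'M[R]_4 :=
  Emx 2 1 - Emx 1 2 + Emx 4 3 - Emx 3 4 + Emx 1 3 + Emx 2 4.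
Definition D01 : lieAlgType R := polysd M01.

Definition Gn1_gens n : seq 'M[R]_n.-1.+1 :=
  1%:M :: [seq Emx 1 j | j <- iota 2 n.-1].
Fact Gn1_gens_comm n : {in Gn1_gens n &, forall a b, comm_mx a b}.
Proof.
case: n => [|n] /=; first by move=> a b; rewrite !inE => /eqP-> /eqP->.
move=> a b; rewrite !inE => /predU1P[->|/mapP[i]]; first by rewrite /comm_mx mulmx1 mul1mx.
rewrite mem_iota => /andP[i2 iN] -> /predU1P[->|/mapP[j]].
  by rewrite /comm_mx mulmx1 mul1mx.
rewrite mem_iota => /andP[j2 jN] ->; rewrite /comm_mx !mul_Emx //=; try lia.
by case: i j i2 j2 {iN jN} => [|[]] // i [|[]].
Qed.
Definition Gn1 n : lieAlgType R := semidirect (span_abelian (@Gn1_gens_comm n)).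

Definition h42_gens : seq 'M[R]_4 :=
  [:: 1%:M; Emx 1 2 + Emx 2 4; Emx 1 3; Emx 1 4].
Fact h42_gens_comm : {in h42_gens &, forall a b, comm_mx a b}.
Proof. comm_gens. Qed.
Definition h42 : lieAlgType R := semidirect (span_abelian h42_gens_comm).

Definition h43_gens : seq 'M[R]_4 :=
  [:: 1%:M; Emx 1 2 + Emx 2 4; Emx 1 3 + Emx 3 4; Emx 1 4].
Fact h43_gens_comm : {in h43_gens &, forall a b, comm_mx a b}.
Proof. by comm_gens. Qed.
Definition h43 : lieAlgType R := semidirect (span_abelian h43_gens_comm).

Definition G44'_gens : seq 'M[R]_4 :=
  [:: 1%:M; Emx 1 2 + Emx 3 4; Emx 1 3 + Emx 2 4; Emx 1 4].
Fact G44'_gens_comm : {in G44'_gens &, forall a b, comm_mx a b}.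
Proof. by comm_gens. Qed.
Definition G44' : lieAlgType R := semidirect (span_abelian G44'_gens_comm).

End MatrixAlgebras.

Arguments aff_real R : clear implicits.
Arguments aff_complex R : clear implicits.
Arguments D0 R n%_N : clear implicits.
Arguments D01 R : clear implicits.
Arguments Gn1 R n%_N : clear implicits.
Arguments h42 R : clear implicits.
Arguments h43 R : clear implicits.
Arguments G44' R : clear implicits.

(* Main.v *)
(** A 2-solvable Frobenius Lie algebra L is A |x A^* for a commutative algebra A,
    unique up to isomorphism, so the classification is that of the commutative
    real algebras of dimension at most 4.

    Let alpha be a functional whose form alpha [u, v] is nondegenerate, and let e
    represent alpha, that is alpha [e, v] = alpha v.  Since ad e commutes with
    the action of L on H = [L, L], e acts on H as the identity; hence
    L = K + H with K = ker (ad e) Abelian, and alpha [k, h] is a perfect pairing of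
    K and H.  A commuting family of operators with a cyclic covector is closed
    under composition, so K becomes a commutative algebra A acting faithfully on
    H = A^*.  Conversely A^* is the derived algebra of A |x A^*, which recovers A.

    An idempotent splits A into a product.  If A is connected, every element is
    nilpotent or invertible, so its residue field is the field of reals or, after
    a Newton iteration producing a root of -1, the field of complex numbers.
    In the second case A is C or C[X]/(X^2).  In the first A is R[X]/(X^n), or its
    nilradical has square zero, or A = R + <x, y> + <z> with multiplication given
    by a binary quadratic form of rank at least 1; up to scaling there are three.

    For the converse, the residue fields, idempotents and squares of nilpotents
    separate the algebras; an algebra R[M] is generated by one element. *)

Require Import Defs.
From HB Require Import structures.
From mathcomp Require Import all_boot all_order all_algebra all_field.
From mathcomp Require Import reals.
From mathcomp Require Import boolp complex ring lra zify.

Set Implicit Arguments.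
Unset Strict Implicit.
Unset Printing Implicit Defensive.

Import Order.TTheory GRing.Theory Num.Theory VectorInternalTheory.
Local Open Scope ring_scope.
Local Open Scope lie_scope.

(** The pairing alpha [k, h] identifies H with the dual of K, and the identification is K-linear
    because the operators commute; hence the dual module appears, and A itself need not be a
    Frobenius algebra. In the other direction (a, f) |-> f 1 yields a nondegenerate form for every
    A, so no commutative algebra is lost.

    A matrix algebra B is recognised through a row vector c such that the rows c b, with b in B,
    exhaust all rows: x |-> c x is then a suitable functional. For B = R[M] the same row forces the
    minimal polynomial of M to have full degree.

    Algebras are compared by presentation, either R[X]/(p) or a basis with its multiplication table.
    A product of quotients R[X]/(p) is again one when the moduli are coprime, so generators are
    shifted or scaled until the moduli share no root.

    The main obstacle is the local case of dimension 4 with a nilpotent x such that x^2 is nonzero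
    and all nilpotents have cube 0: a further nilpotent must be corrected until every product of
    nilpotents falls on the line of x^2. The binary form then matters only up to a scalar, so the
    two definite signs coincide, and rank one, definite and hyperbolic forms remain. *)

Definition mk_linear (R : fieldType) (U V : lmodType R) (f : U -> V) (fL : linear f) :
  {linear U -> V} := HB.pack_for {linear U -> V} f (GRing.isLinear.Build R U V *:%R f fL).

Definition mk_scalar (R : fieldType) (U : lmodType R) (f : U -> R) (fL : scalar f) :
  {scalar U} := HB.pack_for {scalar U} f (GRing.isLinear.Build R U R *%R f fL).

(** * Linear bijections, dimensions and dual spaces *)

Section LinearAlgebra.
Variable R : fieldType.

Lemma inj_linear_bij (V W : vectType R) (f : {linear V -> W}) :
  (forall v, f v = 0 -> v = 0) -> (\dim {:W} <= \dim {:V})%N -> bijective f.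
Proof.
move=> f0 leWV.
have kf : (lker (linfun f) == 0)%VS.
  rewrite -subv0; apply/subvP=> v; rewrite memv_ker lfunE memv0 => /eqP/f0->.
  exact: eqxx.
have imf : limg (linfun f) = fullv.
  apply/eqP; rewrite eqEdim subvf limg_dim_eq //.
  by rewrite (eqP kf) capv0.
exists ((linfun f)^-1)%VF => v.
  by rewrite -[f v](lfunE f) lker0_lfunK.
by rewrite -[LHS](lfunE f) limg_lfunVK // imf memvf.
Qed.

Lemma bij_linear_dim (V W : vectType R) (f : {linear V -> W}) :
  bijective f -> \dim {:V} = \dim {:W}.
Proof.
case=> g fK gK.
have fI (U X : vectType R) (h : {linear U -> X}) (k : X -> U) :
    cancel h k -> (\dim {:U} <= \dim {:X})%N.
  move=> hK; rewrite -(@limg_dim_eq _ _ _ (linfun h)) ?dimvS ?subvf //.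
  apply/eqP; rewrite capfv -subv0; apply/subvP=> v; rewrite memv_ker lfunE memv0.
  by move=> /eqP hv0; rewrite -(hK v) hv0 -(linear0 h) hK.
have g_lin : linear g by move=> a x y; apply: (can_inj fK); rewrite linearP /= !gK.
by apply/eqP; rewrite eqn_leq (fI _ _ f g fK) (fI _ _ (mk_linear g_lin) f gK).
Qed.

Lemma bij_linear_inv (V W : vectType R) (f : {linear V -> W}) :
  bijective f -> exists2 g : {linear W -> V}, cancel f g & cancel g f.
Proof.
case=> g fK gK.
have g_lin : linear g by move=> a x y; apply: (can_inj fK); rewrite linearP /= !gK.
by exists (mk_linear g_lin).
Qed.

Lemma dim_pair (V W : vectType R) :
  \dim {: (V * W)%type} = (\dim {:V} + \dim {:W})%N.
Proof. by rewrite !dimvf. Qed.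

Lemma dim_dual (V : vectType R) : \dim {: 'Hom(V, R^o)} = \dim {:V}.
Proof. by rewrite !dimvf /= /dim /= muln1. Qed.

Lemma dual_sep (V : vectType R) (v : V) :
  (forall f : 'Hom(V, R^o), f v = 0) -> v = 0.
Proof.
move=> fv0; apply: (can_inj v2rK); rewrite linear0; apply/rowP=> i; rewrite mxE.
have c_lin : linear (fun u : V => v2r u 0 i : R^o).
  by move=> a x y; rewrite linearP !mxE.
by have := fv0 (linfun (mk_linear c_lin)); rewrite lfunE.
Qed.

End LinearAlgebra.

(** * Invariance under isomorphism, and direct sums of Lie algebras *)

Section LieGeneralities.
Variable R : fieldType.
Implicit Types L : lieAlgType R.

Lemma nondegenerateP L (alpha : {scalar L}) :
  nondegenerate (dform alpha) <-> (forall u, (forall v, alpha (lie u v) = 0) -> u = 0).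
Proof.
split=> [/eqP nd u u0 | nd].
  apply/eqP; rewrite -memv0 -nd; apply/mem_orthovP => v _.
  by rewrite /= /dform u0 oppr0.
rewrite /nondegenerate -subv0; apply/subvP=> u /mem_orthovP uP; rewrite memv0.
apply/eqP/nd => v; apply/eqP; rewrite -oppr_eq0; apply/eqP.
by have := uP v (memvf v).
Qed.

Lemma lie_isom_sym L1 L2 : lie_isom L1 L2 -> lie_isom L2 L1.
Proof.
case=> f /bij_linear_inv[g fK gK] fM; exists g; first by exists f.
by move=> u v; apply: (can_inj fK); rewrite fM !gK.
Qed.

Lemma lie_isom_trans L1 L2 L3 :
  lie_isom L1 L2 -> lie_isom L2 L3 -> lie_isom L1 L3.
Proof.
case=> f fbij fM [g gbij gM]; exists (g \o f); first exact: bij_comp.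
by move=> u v /=; rewrite fM gM.
Qed.

Lemma lie_isom_dim L1 L2 : lie_isom L1 L2 -> \dim {:L1} = \dim {:L2}.
Proof. by case=> f fbij _; apply: bij_linear_dim fbij. Qed.

(** Brackets only span the derived algebra, so the vanishing is extended one argument at a time: the
    kernel of an adjoint map that contains all brackets contains their span. *)
Lemma two_solvableP L :
  two_solvable L <-> (forall u v w x : L, lie (lie u v) (lie w x) = 0).
Proof.
split=> [sL u v w x|sL]; first by apply: sL; rewrite memv_lie ?memvf.
have gen (W : {vspace L}) : (forall u v : L, lie u v \in W) ->
    (lie_prodv fullv fullv <= W)%VS.
  by move=> h; apply/lie_prodvP => u v _ _; apply: h.
move=> a b aL bL.
have cent (u v y : L) : y \in lie_prodv fullv fullv -> lie (lie u v) y = 0.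
  pose W := lker (linfun (mk_linear (lie_linearr (lie u v)))).
  suff /gen/subvP sW : forall w x : L, lie w x \in W.
    by move=> /sW; rewrite memv_ker lfunE => /eqP.
  by move=> w x; rewrite memv_ker lfunE; apply/eqP/sL.
pose W := lker (linfun (mk_linear (lie_linearr b))).
suff /gen/subvP sW : forall w x : L, lie w x \in W.
  by move/sW: aL; rewrite memv_ker lfunE /= => /eqP ba0; rewrite lieC ba0 oppr0.
by move=> w x; rewrite memv_ker lfunE /= lieC (cent w x b bL) oppr0.
Qed.

Lemma lie_isom_two_solvable L1 L2 :
  lie_isom L1 L2 -> two_solvable L1 -> two_solvable L2.
Proof.
case=> f [g fK gK] fM /two_solvableP s1; apply/two_solvableP=> u v w x.
by rewrite -[u]gK -[v]gK -[w]gK -[x]gK -!fM s1 linear0.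
Qed.

Lemma lie_isom_frobenius L1 L2 : lie_isom L1 L2 -> frobenius L1 -> frobenius L2.
Proof.
case=> f /bij_linear_inv[g fK gK] fM [al /nondegenerateP nd].
exists (al \o g); apply/nondegenerateP => u u0.
rewrite -[u]gK (nd (g u)) ?linear0 // => v.
by have := u0 (f v); rewrite /= -{1}[u]gK -fM fK.
Qed.

Lemma dsum_isom L1 L1' L2 L2' :
  lie_isom L1 L1' -> lie_isom L2 L2' -> lie_isom (L1 \oplus L2) (L1' \oplus L2').
Proof.
case=> f [f' fK f'K] fM [g [g' gK g'K] gM].
pose h (u : L1 * L2) : (L1' * L2')%type := (f u.1, g u.2).
have h_lin : linear h by move=> a x y; rewrite /h !linearP.
exists (mk_linear h_lin) => /=.
  by exists (fun v => (f' v.1, g' v.2)) => -[x y]; rewrite /h /= ?fK ?f'K ?gK ?g'K.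
by move=> u v; rewrite /h /= fM gM.
Qed.

Lemma dsumC L1 L2 : lie_isom (L1 \oplus L2) (L2 \oplus L1).
Proof.
pose h (u : L1 * L2) : (L2 * L1)%type := (u.2, u.1).
have h_lin : linear h by [].
exists (mk_linear h_lin) => //=.
by exists (fun v => (v.2, v.1)) => -[x y].
Qed.

Lemma dsumA L1 L2 L3 :
  lie_isom (L1 \oplus (L2 \oplus L3)) (L1 \oplus L2 \oplus L3).
Proof.
pose h (u : L1 * (L2 * L3)) : (L1 * L2 * L3)%type := ((u.1, u.2.1), u.2.2).
have h_lin : linear h by [].
exists (mk_linear h_lin) => //=.
by exists (fun v => (v.1.1, (v.1.2, v.2))) => -[x y]; [case: y | case: x].
Qed.

End LieGeneralities.

(** * The coadjoint extension of a commutative algebra *)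

(* A record rather than a structure: Hierarchy Builder refuses a commutative
   variant of [falgType] once [fieldExtType] is declared. *)
Record cfalg (R : fieldType) :=
  CFalg { cf_falg : falgType R; cf_mulC : commutative (@GRing.mul cf_falg) }.
Definition cf_sort (R : fieldType) (A : cfalg R) : Type := cf_falg A.
Coercion cf_sort : cfalg >-> Sortclass.
HB.instance Definition _ (R : fieldType) (A : cfalg R) := Falgebra.on (cf_sort A).
HB.instance Definition _ (R : fieldType) (A : cfalg R) :=
  GRing.PzRing_hasCommutativeMul.Build (cf_sort A) (@cf_mulC R A).
HB.instance Definition _ (R : fieldType) (A B : falgType R) :=
  GRing.UnitAlgebra.on (A * B)%type.

Definition prod_alg (R : fieldType) (A B : cfalg R) : cfalg R :=
  @CFalg R (A * B)%type (@mulrC (A * B)%type).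

Section Coadjoint.
Variables (R : fieldType) (A : cfalg R).

Definition dual := 'Hom(A, R^o).
HB.instance Definition _ := Vector.on dual.

Definition dual_act (a : A) (f : dual) : dual := (f \o amull a)%VF.

Lemma dual_actE a f b : dual_act a f b = f (a * b).
Proof. by rewrite /dual_act comp_lfunE lfunE. Qed.

Lemma dualDE (f g : dual) b : (f + g) b = f b + g b.
Proof. exact: add_lfunE. Qed.
Lemma dualZE (c : R) (f : dual) b : (c *: f) b = c * f b.
Proof. exact: scale_lfunE. Qed.
Lemma dualNE (f : dual) b : (- f) b = - f b.
Proof. exact: opp_lfunE. Qed.
Lemma dual_eval0 b : (0 : dual) b = 0.
Proof. exact: zero_lfunE. Qed.

Definition dual_evalE := (dualDE, dualZE, dualNE, dual_eval0, dual_actE).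

Lemma dual_actl (f : dual) : linear (dual_act^~ f).
Proof.
suff H (c : R) a b : dual_act (c *: a + b) f = c *: dual_act a f + dual_act b f by exact: H.
apply/lfunP=> x; rewrite !dual_evalE.
by rewrite mulrDl -scalerAl linearP.
Qed.

Lemma dual_actr (a : A) : linear (dual_act a).
Proof.
suff H (c : R) f g : dual_act a (c *: f + g) = c *: dual_act a f + dual_act a g by exact: H.
by apply/lfunP=> x; rewrite !dual_evalE.
Qed.

Lemma dual_act0l (f : dual) : dual_act 0 f = 0.
Proof. by apply/lfunP=> x; rewrite !dual_evalE mul0r linear0. Qed.

Lemma dual_actBr (a : A) (f g : dual) :
  dual_act a (f - g) = dual_act a f - dual_act a g.
Proof. by apply/lfunP=> x; rewrite !dual_evalE. Qed.

Lemma dual_actA (a b : A) (f : dual) : dual_act a (dual_act b f) = dual_act (a * b) f.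
Proof. by apply/lfunP=> x; rewrite !dual_actE mulrA (mulrC b). Qed.

Definition coadj_type := (A * dual)%type.
HB.instance Definition _ := Vector.on coadj_type.

Let lieT (u v : coadj_type) : coadj_type :=
  (0, dual_act u.1 v.2 - dual_act v.1 u.2).

Fact coadj_ext (x y : coadj_type) : x.1 = y.1 -> x.2 = y.2 -> x = y.
Proof. by case: x y => [a f] [b g] /= -> ->. Qed.
Fact coadj_add (x y : coadj_type) : (x + y = (x.1 + y.1, x.2 + y.2) :> coadj_type).
Proof. by []. Qed.
Fact coadj_opp (x : coadj_type) : (- x = (- x.1, - x.2) :> coadj_type).
Proof. by []. Qed.

Fact lieT_linearl v : linear (lieT^~ v).
Proof.
suff lin (a : R) x y : lieT (a *: x + y) v = a *: lieT x v + lieT y v by exact: lin.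
apply: coadj_ext.
  by change (0 = a *: 0 + 0 :> A); rewrite scaler0 addr0.
change (dual_act (a *: x.1 + y.1) v.2 - dual_act v.1 (a *: x.2 + y.2) =
  a *: (dual_act x.1 v.2 - dual_act v.1 x.2) + (dual_act y.1 v.2 - dual_act v.1 y.2)).
rewrite dual_actl dual_actr.
 by rewrite scalerBr opprD addrACA.
Qed.
Fact lieTvv u : lieT u u = 0.
Proof. by rewrite /lieT subrr. Qed.
Fact lieT_skew u v : lieT u v = - lieT v u.
Proof. by rewrite /lieT; rewrite coadj_opp /= opprB oppr0. Qed.
Fact lieT_linearr u : linear (lieT u).
Proof.
by move=> a x y; rewrite !(lieT_skew u) lieT_linearl opprD scalerN.
Qed.
Fact lieT_jacobi u v w :
  lieT u (lieT v w) + lieT v (lieT w u) + lieT w (lieT u v) = 0.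
Proof.
rewrite !coadj_add /= !addr0; congr (_, _).
rewrite !dual_act0l !subr0 !dual_actBr !dual_actA.
rewrite (mulrC v.1 u.1) (mulrC w.1 u.1) (mulrC w.1 v.1).
by rewrite [X in X + _]addrC !addrA !subrK subrr.
Qed.

HB.instance Definition _ := Vector_isLieAlgebra.Build R coadj_type
  lieT_linearl lieT_linearr lieTvv lieT_jacobi.

Definition coadj : lieAlgType R := coadj_type.

Lemma coadj_lieE (u v : coadj) :
  lie u v = (0, dual_act u.1 v.2 - dual_act v.1 u.2) :> coadj_type.
Proof. by []. Qed.

Lemma dim_coadj : \dim {:coadj} = (\dim {:A}).*2.
Proof. by rewrite dim_pair dim_dual addnn. Qed.

Lemma coadj_two_solvable : two_solvable coadj.
Proof.
apply/two_solvableP=> u v w x; rewrite !coadj_lieE /= !dual_act0l subr0.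
by [].
Qed.

(** The functional (a, f) |-> f 1 sends the bracket of (a, f) and (b, g) to g a - f b, the canonical
    symplectic form on the sum of A and its dual. *)
Lemma coadj_frobenius : frobenius coadj.
Proof.
pose al (u : coadj) : R := u.2 1.
have al_lin : scalar al by move=> a x y; rewrite /al /= !dual_evalE.
exists (mk_scalar al_lin).
apply/nondegenerateP => -[a f] /= u0.
have u0' (b : A) (g : dual) : g a - f b = 0.
  by have := u0 (b, g); rewrite coadj_lieE /= /al /= !dual_evalE !mulr1.
congr pair.
  apply: dual_sep => g; have := u0' 0 g.
  by rewrite linear0 subr0.
apply/lfunP=> b; have := u0' b 0; rewrite !dual_evalE sub0r => /eqP.
by rewrite oppr_eq0 => /eqP.
Qed.

End Coadjoint.

(** * Commutative algebras from faithful actions *)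

(** Closure only asserts that composites exist in the family; faithfulness makes them unique, so
    composition can serve as the product on V. Positive dimension gives 1 <> 0. Both K acting on H
    and a corner acting on itself are instances. *)
Record faithful_action (R : fieldType) (V W : vectType R) := FaithfulAction {
  act :> V -> W -> W;
  act_linl : forall w, linear (act^~ w);
  act_linr : forall v, linear (act v);
  act_comm : forall u v w, act u (act v w) = act v (act u w);
  act_faithful : forall v, (forall w, act v w = 0) -> v = 0;
  act_closed : forall u v, exists x, forall w, act x w = act u (act v w);
  act_unit : exists e, forall w, act e w = w;
  act_dim : (0 < \dim {:V})%N
}.

Section ActionAlgebra.
Variables (R : fieldType) (V W : vectType R) (d : faithful_action V W).

Definition act_carrier : Type := V.
HB.instance Definition _ := Vector.on act_carrier.
Implicit Types u v x : act_carrier.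

Let mul u v : act_carrier := sval (cid (act_closed d u v)).
Let one : act_carrier := sval (cid (act_unit d)).

Fact act_mulE u v w : d (mul u v) w = d u (d v w).
Proof. by rewrite /mul; case: cid => x /= ->. Qed.
Fact act_oneE w : d one w = w.
Proof. by rewrite /one; case: cid => x /= ->. Qed.
Fact act_lE (a : R) u v w : d (a *: u + v) w = a *: d u w + d v w.
Proof. exact: act_linl. Qed.
Fact act_inj u v : (forall w, d u w = d v w) -> u = v.
Proof.
move=> uv; apply/eqP; rewrite eq_sym -subr_eq0 -scaleN1r addrC; apply/eqP.
by apply: (act_faithful (f := d)) => w; rewrite act_lE uv scaleN1r addNr.
Qed.

Fact act_mulA : associative mul.
Proof. by move=> u v x; apply: act_inj => w; rewrite !act_mulE. Qed.
Fact act_mulC : commutative mul.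
Proof. by move=> u v; apply: act_inj => w; rewrite !act_mulE act_comm. Qed.
Fact act_mul1 : left_id one mul.
Proof. by move=> u; apply: act_inj => w; rewrite act_mulE act_oneE. Qed.
Fact act_mulDl : left_distributive mul +%R.
Proof.
move=> u v x; apply: act_inj => w.
by rewrite -[u in LHS]scale1r -[mul u x]scale1r act_mulE !act_lE !act_mulE.
Qed.
Fact act_0 w : d 0 w = 0.
Proof.
by apply: (addrI (d 0 w)); rewrite addr0 -{1}[d 0 w]scale1r -act_lE scaler0 addr0.
Qed.
Fact act_one_neq0 : one != 0.
Proof.
apply/eqP=> one0; have := act_dim d; rewrite lt0n dimv_eq0 => /eqP; apply.
apply/eqP; rewrite -subv0; apply/subvP=> v _; rewrite memv0; apply/eqP.
by apply: (act_faithful (f := d)) => w; rewrite -[LHS]act_oneE one0 act_0.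
Qed.

HB.instance Definition _ := GRing.Zmodule_isComNzRing.Build act_carrier
  act_mulA act_mulC act_mul1 act_mulDl act_one_neq0.

Fact act_scalerAl (a : R) u v : a *: (u * v) = a *: u * v.
Proof.
apply: act_inj => w; rewrite -[a *: (u * v)]addr0 -[a *: u]addr0.
by rewrite act_lE /GRing.mul /= !act_mulE act_lE !act_0.
Qed.
HB.instance Definition _ := GRing.Lmodule_isLalgebra.Build R act_carrier act_scalerAl.
HB.instance Definition _ := GRing.Lalgebra_isComAlgebra.Build R act_carrier.
HB.instance Definition _ := Algebra_isFalgebra.Build R act_carrier.

Definition act_alg : cfalg R := @CFalg R act_carrier (@mulrC act_carrier).

Lemma act_algM (a b : act_alg) w : d (a * b) w = d a (d b w).
Proof. exact: act_mulE. Qed.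

Lemma act_alg1 w : d (1 : act_alg) w = w.
Proof. exact: act_oneE. Qed.

End ActionAlgebra.

Lemma inj_linear_dim (R : fieldType) (V W : vectType R) (f : {linear V -> W}) :
  (forall v, f v = 0 -> v = 0) -> (\dim {:V} <= \dim {:W})%N.
Proof.
move=> f0; rewrite -(@limg_dim_eq _ _ _ (linfun f)) ?dimvS ?subvf //.
apply/eqP; rewrite capfv -subv0; apply/subvP=> v; rewrite memv_ker lfunE memv0.
by move=> /eqP/f0->.
Qed.

(** * Commuting operators with a cyclic covector *)

Section Covector.
Variables (R : fieldType) (V W : vectType R) (act : V -> W -> W).
Hypotheses (linl : forall w, linear (act^~ w)) (linr : forall v, linear (act v)).
Hypothesis comm : forall u v w, act u (act v w) = act v (act u w).
Hypothesis faithful : forall v, (forall w, act v w = 0) -> v = 0.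
Variable lam : {scalar W}.
Hypothesis nd : forall w, (forall v, lam (act v w) = 0) -> w = 0.

Fact covectorB v w w' : lam (act v (w - w')) = lam (act v w) - lam (act v w').
Proof. by rewrite -scaleN1r addrC linr linearP /= mulN1r addrC. Qed.

Let coef (v : V) (w : W) : R^o := lam (act v w).
Fact coef_linl w : linear (coef^~ w).
Proof. by move=> a x y; rewrite /coef linl linearP. Qed.
Fact coef_linr v : linear (coef v).
Proof. by move=> a x y; rewrite /coef linr linearP. Qed.

Let toV w : 'Hom(V, R^o) := linfun (mk_linear (coef_linl w)).
Let toW v : 'Hom(W, R^o) := linfun (mk_linear (coef_linr v)).
Fact toVE w v : toV w v = lam (act v w).
Proof. by rewrite lfunE. Qed.
Fact toWE v w : toW v w = lam (act v w).
Proof. by rewrite lfunE. Qed.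

Fact toV_lin : linear toV.
Proof.
move=> a x y; apply/lfunP=> v.
by rewrite add_lfunE scale_lfunE !toVE linr linearP.
Qed.
Fact toW_lin : linear toW.
Proof.
move=> a x y; apply/lfunP=> w.
by rewrite add_lfunE scale_lfunE !toWE linl linearP.
Qed.

Fact toV_inj w : toV w = 0 -> w = 0.
Proof. by move=> t0; apply: nd => v; rewrite -toVE t0 zero_lfunE. Qed.

(** Commutativity carries nondegeneracy over to this side: lam (u (v w)) = lam (v (u w)) = 0 for all
    u forces v w = 0 by [nd]. *)
Fact toW_inj v : toW v = 0 -> v = 0.
Proof.
move=> t0; apply: faithful => w; apply: nd => u.
by rewrite comm -toWE t0 zero_lfunE.
Qed.

Fact covector_dim : \dim {:V} = \dim {:W}.
Proof.
apply/eqP; rewrite eqn_leq -{1}(dim_dual W) -{2}(dim_dual V).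
by rewrite (@inj_linear_dim _ _ _ (mk_linear toW_lin) toW_inj)
  (@inj_linear_dim _ _ _ (mk_linear toV_lin) toV_inj).
Qed.

Fact covector_rep (f : 'Hom(W, R^o)) : exists v, forall w, lam (act v w) = f w.
Proof.
have [|g _ gK] := @bij_linear_inv _ _ _ (mk_linear toW_lin).
  by apply: inj_linear_bij; [exact: toW_inj | rewrite dim_dual covector_dim].
by exists (g f) => w; rewrite -toWE -[in RHS](gK f).
Qed.

(** The perfect pairing gives x representing w |-> lam (u (v w)). Testing against any v', which
    commutes with all the operators, upgrades this equality of functionals to one of operators. *)
Fact covector_closed u v : exists x, forall w, act x w = act u (act v w).
Proof.
have f_lin : linear (fun w => lam (act u (act v w)) : R^o).
  by move=> a x y; rewrite !linr linearP.
have [x xP] := covector_rep (linfun (mk_linear f_lin)).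
exists x => w; apply/eqP; rewrite -subr_eq0; apply/eqP/nd => v'.
by rewrite covectorB (comm v' x) xP lfunE /= (comm v' u) (comm v' v) subrr.
Qed.

Fact covector_unit : exists e, forall w, act e w = w.
Proof.
have f_lin : linear (fun w => lam w : R^o) by move=> a x y; rewrite linearP.
have [e eP] := covector_rep (linfun (mk_linear f_lin)).
exists e => w; apply/eqP; rewrite -subr_eq0; apply/eqP/nd => v'.
by rewrite covectorB (comm v' e) eP lfunE /= subrr.
Qed.

Hypothesis dimV : (0 < \dim {:V})%N.
Definition covector_action : faithful_action V W :=
  FaithfulAction linl linr comm faithful covector_closed covector_unit dimV.

Variable L : lieAlgType R.
Variable F : {linear (V * W)%type -> L}.
Hypotheses (Fbij : bijective F) (FM : forall v w v' w',
  lie (F (v, w)) (F (v', w')) = F (0, act v w' - act v' w)).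

(** The map w |-> (b |-> lam (b w)) identifies W with the dual of A, and turns the action into the
    transpose of multiplication because the operators commute. [F] presents L as V + W with the
    semidirect bracket. *)
Lemma covector_coadj : lie_isom L (coadj (act_alg covector_action)).
Proof.
pose A := act_alg covector_action.
have c_lin w : linear (fun v : A => lam (act v w) : R^o).
  by move=> a x y; rewrite linl linearP.
pose G (u : V * W) : coadj A := ((u.1 : A), linfun (mk_linear (c_lin u.2)) : dual A).
have GE u (b : A) : (G u).2 b = lam (act b u.2) by rewrite lfunE.
have G_lin : linear G.
  suff H (a : R) x y : G (a *: x + y) = a *: G x + G y by exact: H.
  apply: coadj_ext; first by [].
  apply/lfunP=> b; rewrite GE /= linr linearP.
  rewrite -[RHS]/((a *: (G x).2 + (G y).2) b).
  by rewrite dualDE dualZE !GE.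
have Gbij : bijective (mk_linear G_lin).
  apply: inj_linear_bij => [[v w] Gu0|]; last first.
    by rewrite dim_coadj dim_pair -covector_dim addnn.
  have w0 : w = 0.
    apply: nd => v'; rewrite -(GE (v, w)) (_ : (G (v, w)).2 = 0) ?dual_eval0 //.
    exact: (congr1 snd Gu0).
  by rewrite w0 (_ : v = 0) //; apply: (congr1 fst Gu0).
have [F' F'K FK] := bij_linear_inv Fbij.
exists (mk_linear G_lin \o F'); first by apply: bij_comp => //; exists F.
move=> x y; rewrite -[x]FK -[y]FK; case: (F' x) (F' y) => [v w] [v' w'].
rewrite FM /= !F'K; apply: coadj_ext; first by [].
apply/lfunP=> b; rewrite GE coadj_lieE [(_, _).2]/=.
have A1 : (G (v, w)).1 = v by []. have A2 : (G (v', w')).1 = v' by [].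
rewrite dualDE dualNE !dual_actE !GE A1 A2 [in LHS]/=.
rewrite covectorB.
have M (a c : A) z : act (a * c) z = act a (act c z) by exact: (@act_algM R V W
    covector_action a c z).
by rewrite !M (comm v b) (comm v' b).
Qed.

End Covector.

(** * Isomorphisms of coadjoint extensions *)

Definition alg_isom (R : fieldType) (A B : cfalg R) : Prop :=
  exists2 f : {linear A -> B}, bijective f & {morph f : x y / x * y}.

Section AlgIsom.
Variable R : fieldType.
Implicit Types A B : cfalg R.

Lemma alg_isom_sym A B : alg_isom A B -> alg_isom B A.
Proof.
case=> f /bij_linear_inv[g fK gK] fM; exists g; first by exists f.
by move=> u v; apply: (can_inj fK); rewrite fM !gK.
Qed.

Lemma alg_isom1 A B (f : {linear A -> B}) :
  bijective f -> {morph f : x y / x * y} -> f 1 = 1.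
Proof. by case=> g fK gK fM; rewrite -[LHS]mulr1 -[X in _ * X]gK -fM mul1r gK. Qed.

Lemma coadj_isom A B : alg_isom A B -> lie_isom (coadj A) (coadj B).
Proof.
case=> r rbij rM; have [s rK sK] := bij_linear_inv rbij.
pose G (u : coadj A) : coadj B := (r u.1, (u.2 \o linfun s)%VF).
have GE u b : (G u).2 b = u.2 (s b) by rewrite comp_lfunE lfunE.
have G_lin : linear G.
  suff H (a : R) x y : G (a *: x + y) = a *: G x + G y by exact: H.
  apply: coadj_ext; first exact: linearP.
  apply/lfunP=> b; rewrite GE -[LHS]/((a *: x.2 + y.2 : dual A) (s b)).
  by rewrite -[RHS]/((a *: (G x).2 + (G y).2) b) !dual_evalE !GE.
exists (mk_linear G_lin).
  apply: inj_linear_bij => [[a f] Gu0|].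
    congr pair; first by rewrite -[a]rK (_ : r a = 0) ?linear0 //; apply: (congr1 fst Gu0).
    apply/lfunP=> b; rewrite -[b]rK -(GE (a, f)).
    by rewrite (_ : (G (a, f)).2 = 0) ?dual_eval0 ?zero_lfunE //; apply: (congr1 snd Gu0).
  by rewrite !dim_coadj leq_double (bij_linear_dim rbij).
move=> [a f] [b g]; apply: coadj_ext; first exact: linear0.
apply/lfunP=> c; rewrite -[LHS]/((G (lie _ _)).2 c) GE.
rewrite -[RHS]/((dual_act (r a) (G (b, g)).2 - dual_act (r b) (G (a, f)).2) c).
rewrite coadj_lieE /= !dual_evalE !comp_lfunE !lfunE /=.
by rewrite -[c in RHS]sK -!rM !rK.
Qed.

(** Restriction along the two inclusions splits a functional on the product into its parts on the
    factors. *)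
Lemma coadj_prod A B :
  lie_isom (coadj A \oplus coadj B) (coadj (prod_alg A B)).
Proof.
have inl_lin : linear (fun a : A => (a, 0) : prod_alg A B).
  suff H (c : R) (x y : A) : (c *: x + y, 0) = c *: ((x, 0) : prod_alg A B) + (y, 0) by exact: H.
  by congr pair; rewrite -[RHS]/(c *: (0 : B) + 0) scaler0 addr0.
have inr_lin : linear (fun b : B => (0, b) : prod_alg A B).
  suff H (c : R) (x y : B) : (0, c *: x + y) = c *: ((0, x) : prod_alg A B) + (0, y) by exact: H.
  by congr pair; rewrite -[RHS]/(c *: (0 : A) + 0) scaler0 addr0.
pose il := linfun (mk_linear inl_lin); pose ir := linfun (mk_linear inr_lin).
have ilE a : il a = (a, 0) by rewrite lfunE.
have irE b : ir b = (0, b) by rewrite lfunE.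
pose G (u : coadj (prod_alg A B)) : coadj A \oplus coadj B :=
  ((u.1.1, (u.2 \o il)%VF), (u.1.2, (u.2 \o ir)%VF)).
have G1E u a : (G u).1.2 a = u.2 (a, 0) by rewrite comp_lfunE ilE.
have G2E u b : (G u).2.2 b = u.2 (0, b) by rewrite comp_lfunE irE.
have G_lin : linear G.
  suff H (a : R) x y : G (a *: x + y) = a *: G x + G y by exact: H.
  have dE (c : prod_alg A B) : (a *: x + y).2 c = a * x.2 c + y.2 c.
    by rewrite -[LHS]/((a *: x.2 + y.2 : dual _) c) !dual_evalE.
  congr pair; apply: coadj_ext => //; apply/lfunP=> b.
    by rewrite G1E dE -[RHS]/((a *: (G x).1.2 + (G y).1.2) b) !dual_evalE !G1E.
  by rewrite G2E dE -[RHS]/((a *: (G x).2.2 + (G y).2.2) b) !dual_evalE !G2E.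
apply: lie_isom_sym; exists (mk_linear G_lin).
  apply: inj_linear_bij => [[[a b] f] Gu0|]; last first.
    by rewrite dim_pair !dim_coadj dim_pair doubleD.
  have f1 : (G (a, b, f)).1 = 0 by apply: (congr1 fst Gu0).
  have f2 : (G (a, b, f)).2 = 0 by apply: (congr1 snd Gu0).
  congr pair; first by congr pair; [exact: (congr1 fst f1) | exact: (congr1 fst f2)].
  apply/lfunP=> -[x y]; rewrite zero_lfunE.
  have -> : (x, y) = (x, 0) + (0, y) :> prod_alg A B.
    by congr pair; rewrite -[RHS]/(_ + _) ?addr0 ?add0r.
  rewrite linearD /= -(G1E (a, b, f)) -(G2E (a, b, f)) (congr1 snd f1) (congr1 snd f2).
  by rewrite !zero_lfunE addr0.
move=> [[a b] f] [[a' b'] f']; congr pair; apply: coadj_ext => //.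
  apply/lfunP=> c; rewrite -[LHS]/((G (lie _ _)).1.2 c) G1E -[RHS]/((dual_act a (G (a', b',
      f')).1.2 - dual_act a' (G (a, b, f)).1.2) c) coadj_lieE /= !dual_evalE !comp_lfunE !ilE.
  by rewrite -![(_, _) * (_, _)]/((_ * _, _ * _)) !mulr0.
apply/lfunP=> c; rewrite -[LHS]/((G (lie _ _)).2.2 c) G2E -[RHS]/((dual_act b (G (a', b',
    f')).2.2 - dual_act b' (G (a, b, f)).2.2) c) coadj_lieE /= !dual_evalE !comp_lfunE !irE.
by rewrite -![(_, _) * (_, _)]/((_ * _, _ * _)) !mulr0.
Qed.

(* The subspace [0 x A^*] is the derived algebra, so an isomorphism maps it to
   its counterpart; it then intertwines the faithful actions of A and B on it. *)
Lemma coadj_inj A B : lie_isom (coadj A) (coadj B) -> alg_isom A B.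
Proof.
case=> phi phibij phiM.
have [psi phiK psiK] := bij_linear_inv phibij.
have psiM : {morph psi : u v / lie u v}.
  by move=> u v; apply: (can_inj phiK); rewrite phiM !psiK.
have der (C D : cfalg R) (h : {linear coadj C -> coadj D}) (hM : {morph h : u v / lie u v}) f :
    (h (0, f)).1 = 0.
  have -> : (0, f) = lie ((1, 0) : coadj C) ((0, f) : coadj C).
    apply: coadj_ext => //=; apply/lfunP=> c.
    by rewrite !dual_evalE mul1r subr0.
  by rewrite hM.
have r_lin : linear (fun a : A => (phi (a, 0)).1).
  suff H (c : R) x y : (phi (c *: x + y, 0)).1 = c *: (phi (x, 0)).1 + (phi (y, 0)).1 by exact: H.
  rewrite -[RHS]/((c *: phi (x, 0) + phi (y, 0)).1) -linearP; congr (phi _).1.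
  by apply: coadj_ext => //; apply/lfunP=> b; rewrite -[RHS]/((c *: (0 : dual A) + 0) b)
      !dual_evalE addr0 mulr0.
pose r := mk_linear r_lin.
have act_r a f : (phi (0, dual_act a f)).2 = dual_act (r a) (phi (0, f)).2.
  have -> : (0, dual_act a f) = lie ((a, 0) : coadj A) ((0, f) : coadj A).
    by apply: coadj_ext => //=; apply/lfunP=> c; rewrite !dual_evalE subr0.
  rewrite phiM coadj_lieE /= (der _ _ phi phiM).
  by apply/lfunP=> c; rewrite !dual_evalE mul0r linear0 subr0.
have full g : exists f, g = (phi (0, f)).2.
  exists (psi (0, g)).2.
  have -> : (0, (psi (0, g)).2) = psi (0, g) by apply: coadj_ext; rewrite ?(der _ _ psi psiM).
  by rewrite psiK.
have act_inj (a b : B) : (forall f, dual_act a f = dual_act b f) -> a = b.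
  move=> ab; apply/eqP; rewrite -subr_eq0; apply/eqP/dual_sep => f.
  have /(congr1 (fun h : dual B => h 1)) := ab f.
  by rewrite !dual_evalE !mulr1 linearB /= => ->; rewrite subrr.
exists r; last first.
  move=> a b; apply: act_inj => g; have [f ->] := full g.
  by rewrite -dual_actA -!act_r dual_actA.
apply: inj_linear_bij => [a ra0|]; last first.
  by have := bij_linear_dim phibij; rewrite !dim_coadj => /double_inj->.
apply: dual_sep => f.
suff af0 : dual_act a f = 0 by rewrite -[a]mulr1 -dual_actE af0 dual_eval0.
have : phi (0, dual_act a f) = 0.
  apply: coadj_ext; first exact: der.
  by rewrite act_r ra0 dual_act0l.
by move/(congr1 psi); rewrite phiK linear0 => /(congr1 snd).
Qed.

End AlgIsom.

(** * Structure of 2-solvable Frobenius Lie algebras *)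

Section Structure.
Variables (R : fieldType) (L : lieAlgType R).
Hypotheses (sL : two_solvable L) (fL : frobenius L) (L_gt0 : (0 < \dim {:L})%N).

Let H : {vspace L} := lie_prodv fullv fullv.

Fact lie_in_der u v : lie u v \in H.
Proof. by rewrite memv_lie ?memvf. Qed.

(** The third Jacobi term [h, [u, v]] vanishes because H is Abelian. *)
Fact lie_der_comm u v h : h \in H -> lie u (lie v h) = lie v (lie u h).
Proof.
move=> hH; have := lie_jacobi u v h.
rewrite (sL hH (lie_in_der u v)) addr0 (lieC h u) => /eqP.
by rewrite addr_eq0 => /eqP->; rewrite linearNr opprK.
Qed.

Theorem frobenius_coadj : exists A : cfalg R, lie_isom L (coadj A).
Proof.
case: fL => al /nondegenerateP nd.
have lieD (x y z : L) : lie x (y + z) = lie x y + lie x z by rewrite linearDr.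
have lieDl (x y z : L) : lie (x + y) z = lie x z + lie y z by rewrite linearDl.
have lieNr (x y : L) : lie x (- y) = - lie x y by rewrite linearNr.
have [e eP] : exists e, forall v, al (lie e v) = al v.
  have c_lin u : linear (fun v : L => al (lie u v) : R^o).
    by move=> a x y; rewrite lie_linearr linearP.
  pose T u : 'Hom(L, R^o) := linfun (mk_linear (c_lin u)).
  have TE u v : T u v = al (lie u v) by rewrite lfunE.
  have T_lin : linear T.
    by move=> a x y; apply/lfunP=> v; rewrite add_lfunE scale_lfunE !TE lie_linearl linearP.
  have [|S _ SK] := @bij_linear_inv _ _ _ (mk_linear T_lin).
    apply: inj_linear_bij => [u Tu0|]; last by rewrite dim_dual.
    by apply: nd => v; rewrite -TE [T u]Tu0 zero_lfunE.
  have al_lin : linear (fun v : L => al v : R^o) by move=> a x y; rewrite linearP.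
  exists (S (linfun (mk_linear al_lin))) => v.
  by rewrite -TE [T _]SK lfunE.
(* For every v, alpha [v, [e, h]] = alpha [e, [v, h]] = alpha [v, h], so [e, h] - h lies in the
   radical of the form. *)
have eH h : h \in H -> lie e h = h.
  move=> hH; apply/eqP; rewrite -subr_eq0; apply/eqP/nd => v.
  rewrite lieC lieD lieNr lie_der_comm // linearN /= linearB /=.
  by rewrite eP subrr oppr0.
pose K : {vspace L} := lker (linfun (mk_linear (lie_linearr e))).
have KP k : (k \in K) = (lie e k == 0) by rewrite memv_ker lfunE.
have KH v : v - lie e v \in K.
  by rewrite KP lieD lieNr (eH _ (lie_in_der e v)) subrr.
(* The bracket lies in H, so ad e fixes it; by the Jacobi identity ad e also kills it. *)
have KK k k' : k \in K -> k' \in K -> lie k k' = 0.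
  rewrite !KP => /eqP k0 /eqP k'0; rewrite -(eH _ (lie_in_der k k')).
  have := lie_jacobi e k k'.
  by rewrite (lieC k' e) k'0 oppr0 linear0r k0 linear0r !addr0.
have HK0 h : h \in H -> h \in K -> h = 0 by move=> hH; rewrite KP eH // => /eqP.
have eK : e \in K by rewrite KP lievv.
have splitH v : exists k h, [/\ k \in K, h \in H & v = k + h].
  by exists (v - lie e v), (lie e v); rewrite KH lie_in_der subrK.
pose act (k : subvs_of K) (h : subvs_of H) : subvs_of H :=
  vsproj H (lie (vsval k) (vsval h)).
have actE k h : vsval (act k h) = lie (vsval k) (vsval h).
  by rewrite /act vsprojK ?lie_in_der.
have linl h : linear (act^~ h).
  by move=> a x y; apply: subvs_inj; rewrite linearP /= !actE linearP /= lie_linearl.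
have linr k : linear (act k).
  by move=> a x y; apply: subvs_inj; rewrite linearP /= !actE linearP /= lie_linearr.
have comm u v w : act u (act v w) = act v (act u w).
  by apply: subvs_inj; rewrite !actE lie_der_comm // subvsP.
(* An element of K that kills H also commutes with K, hence is central in L = K + H, and the form is
   nondegenerate. *)
have faithful k : (forall h, act k h = 0) -> k = 0.
  move=> k0; apply: subvs_inj; rewrite linear0; apply: nd => v.
  have [k' [h [k'K hH ->]]] := splitH v.
  rewrite lieD (KK _ _ (subvsP k) k'K) add0r.
  have := congr1 vsval (k0 (vsproj H h)).
  by rewrite actE vsprojK // => ->; rewrite !linear0.
have lam_lin : scalar (fun h : subvs_of H => al (vsval h)).
  by move=> a x y; rewrite !linearP.
have ndH h : (forall k, mk_scalar lam_lin (act k h) = 0) -> h = 0.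
  move=> h0; apply: subvs_inj; rewrite linear0; apply: nd => v.
  have [k [h' [kK h'H ->]]] := splitH v.
  rewrite lieC lieDl (sL h'H (subvsP h)) addr0 linearN.
  by have /= := h0 (vsproj K k); rewrite actE vsprojK // => ->; rewrite oppr0.
have dimK : (0 < \dim {:subvs_of K})%N.
  rewrite lt0n dimv_eq0; apply/eqP=> K0.
  have e0 : e = 0.
    have := memvf (vsproj K e); rewrite K0 memv0 => /eqP/(congr1 vsval).
    by rewrite vsprojK // linear0.
  move: L_gt0; rewrite lt0n dimv_eq0 => /eqP; apply.
  apply/eqP; rewrite -subv0; apply/subvP=> u _; rewrite memv0; apply/eqP/nd => v.
  by rewrite -eP e0 linear0l linear0.
pose F (u : subvs_of K * subvs_of H) : L := vsval u.1 + vsval u.2.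
have F_lin : linear F.
  by move=> a x y; rewrite /F !linearP /= scalerDr addrACA.
exists (act_alg (covector_action linl linr comm faithful ndH dimK)).
apply: (@covector_coadj _ _ _ _ _ _ _ _ _ _ _ _ (mk_linear F_lin)).
  exists (fun v => (vsproj K (v - lie e v), vsproj H (lie e v))) => [[k h]|v].
    have ek0 : lie e (vsval k) = 0 by apply/eqP; rewrite -KP subvsP.
    by rewrite /= /F /= lieD ek0 (eH _ (subvsP h)) add0r addrK !vsvalK.
  by rewrite /= /F /= !vsprojK ?lie_in_der // subrK.
move=> k h k' h'; rewrite /= /F /= !lieD !lieDl.
rewrite (KK _ _ (subvsP k) (subvsP k')) (sL (subvsP h) (subvsP h')) add0r addr0.
by rewrite add0r !actE (lieC (vsval h)) addrC.
Qed.

End Structure.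

(** * Algebras generated by one element *)

Definition peval (R : fieldType) (A : cfalg R) (m : A) : {poly R} -> A := horner_alg m.
HB.instance Definition _ (R : fieldType) (A : cfalg R) (m : A) :=
  GRing.RMorphism.on (peval m).

Section Monogenic.
Variable R : fieldType.
Implicit Types (A B : cfalg R) (p q : {poly R}).

Lemma pevalX A (m : A) : peval m 'X = m.
Proof. exact: horner_algX. Qed.
Lemma pevalC A (m : A) c : peval m c%:P = c%:A.
Proof. exact: horner_algC. Qed.
Lemma pevalZ A (m : A) c p : peval m (c *: p) = c *: peval m p.
Proof. by rewrite -mul_polyC rmorphM /= pevalC mulr_algl. Qed.

Definition generates A (m : A) := forall a : A, exists q, a = peval m q.

(** An internal form of A = R[X]/(p): since p has degree dim A and m generates A, p generates the
    kernel of evaluation at m. *)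
Definition monogenic A p := exists m : A,
  [/\ p \is monic, size p = (\dim {:A}).+1, peval m p = 0 & generates m].

Lemma surj_linear_bij (V W : vectType R) (f : {linear V -> W}) :
  (forall w, exists v, w = f v) -> \dim {:V} = \dim {:W} -> bijective f.
Proof.
move=> fS dVW; apply: inj_linear_bij => [v fv0|]; last by rewrite dVW.
have imf : limg (linfun f) = fullv.
  apply/eqP; rewrite eqEsubv subvf; apply/subvP=> w _; have [u ->] := fS w.
  by rewrite -[f u](lfunE f) memv_img ?memvf.
have := limg_ker_dim (linfun f) fullv; rewrite imf dVW capfv -[RHS]add0n.
move=> /addIn/eqP; rewrite dimv_eq0 => /eqP k0; apply/eqP.
by rewrite -memv0 -k0 memv_ker lfunE fv0.
Qed.

(** Remainders modulo p form a space of dimension dim A that evaluates onto A, so a remainder with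
    value 0 is 0. *)
Lemma monogenic_dvd A p (m : A) q :
  p \is monic -> size p = (\dim {:A}).+1 -> peval m p = 0 -> generates m ->
  peval m q = 0 -> p %| q.
Proof.
move=> pM sp p0 gm q0; set n := \dim {:A} in sp.
pose h (v : 'rV[R]_n) := peval m (rVpoly v).
have h_lin : linear h.
  suff H (a : R) x y : h (a *: x + y) = a *: h x + h y by exact: H.
  by rewrite /h linearP rmorphD /= pevalZ.
have modE r : peval m r = peval m (r %% p).
  by rewrite {1}(divp_eq r p) rmorphD rmorphM /= p0 mulr0 add0r.
have modS r : (size (r %% p)%R <= n)%N.
  by rewrite -ltnS -sp ltn_modp monic_neq0.
have /bij_inj hI : bijective (mk_linear h_lin).
  apply: surj_linear_bij => [w|]; last by rewrite dimvf /= /dim /= mul1n.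
  have [r ->] := gm w; exists (poly_rV (r %% p)).
  by rewrite modE /= /h poly_rV_K.
have: poly_rV (q %% p) = 0 :> 'rV[R]_n.
  by apply: hI; rewrite /= /h poly_rV_K // -modE q0 linear0 rmorph0.
by move/(congr1 rVpoly); rewrite poly_rV_K // linear0 => /eqP.
Qed.

(** Both evaluations have the multiples of p as kernel, so sending m to n is well defined and the
    choice of the preimage [Q] does not affect the map. *)
Lemma monogenic_isom A B p : monogenic A p -> monogenic B p -> alg_isom A B.
Proof.
case=> m [pM sA p0 gm] [n [_ sB n0 gn]].
have tr q : peval m q = 0 -> peval n q = 0.
  move=> /(monogenic_dvd pM sA p0 gm)/dvdpP[r ->].
  by rewrite rmorphM /= n0 mulr0.
pose Q a := sval (cid (gm a)).
have QE a : peval m (Q a) = a by rewrite /Q; case: cid => q /= ->.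
have f_lin : linear (fun a => peval n (Q a)).
  move=> c x y; apply/eqP; rewrite -subr_eq0 -pevalZ -rmorphD -rmorphB.
  by apply/eqP/tr; rewrite rmorphB /= rmorphD /= pevalZ /= !QE subrr.
exists (mk_linear f_lin).
  apply: inj_linear_bij => [a /= Qa0|]; last first.
    by move: sA; rewrite sB => -[->].
  have /dvdpP[r rE] := monogenic_dvd pM sB n0 gn Qa0.
  by rewrite -[a]QE rE rmorphM /= p0 mulr0.
move=> x y /=; apply/eqP; rewrite -subr_eq0 -rmorphM -rmorphB /=.
by apply/eqP/tr; rewrite rmorphB rmorphM /= !QE subrr.
Qed.

(** Chinese remainder theorem: the pair (m, n) is the generator, and a relation u p + v q = 1
    produces a polynomial with prescribed values in both factors. *)
Lemma monogenic_prod A B p q :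
  monogenic A p -> monogenic B q -> coprimep p q -> monogenic (prod_alg A B) (p * q).
Proof.
case=> m [pM sA p0 gm] [n [qM sB q0 gn]] pq.
have hE r : peval ((m, n) : prod_alg A B) r = (peval m r, peval n r).
  elim/poly_ind: r => [|r c IH]; first by rewrite !rmorph0.
  by rewrite !rmorphD !rmorphM /= IH !pevalX !pevalC.
exists (m, n); split; first by rewrite monicMl.
- rewrite size_monicM ?monic_neq0 // sA sB dim_pair.
  by rewrite addSn addnS.
- by rewrite hE !rmorphM /= p0 q0 mul0r mulr0.
move=> [a b]; have [ra ->] := gm a; have [rb ->] := gn b.
have [[u v] /= uv] := Bezout_eq1_coprimepP _ _ pq.
exists (ra * (v * q) + rb * (u * p)); rewrite hE; congr pair.
  rewrite (_ : ra * _ + _ = ra + (rb - ra) * u * p); last first.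
    by rewrite -[X in _ = X + _]mulr1 -uv; ring.
  by rewrite rmorphD rmorphM /= p0 mulr0 addr0.
rewrite (_ : ra * _ + _ = rb + (ra - rb) * v * q); last first.
  by rewrite -[X in _ = X + _]mulr1 -uv; ring.
by rewrite rmorphD rmorphM /= q0 mulr0 addr0.
Qed.

Lemma monogenic_dim A p : monogenic A p -> \dim {:A} = (size p).-1.
Proof. by case=> m [_ ->]. Qed.

Section Semidirect.
Variables (n : nat) (B : abelianSubalg R n.+1) (c : 'rV[R]_n.+1).
Hypothesis cB : forall r : 'rV[R]_n.+1, exists2 b, b \in (B : {vspace _}) & c *m b = r.

(** The covector is w |-> c w, nondegenerate because the rows c b are all the rows. The embedding
    [g] is returned so that identities in A can be checked on matrices. *)
Lemma semidirect_coadj : exists A : cfalg R, exists g : {linear A -> 'M[R]_n.+1},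
  [/\ lie_isom (semidirect B) (coadj A), \dim {:A} = n.+1, injective g &
   [/\ forall a, g a \in (B : {vspace _}), forall b, b \in (B : {vspace _}) -> exists a, g a = b,
    {morph g : x y / x * y >-> x *m y} & g 1 = 1%:M]].
Proof.
pose act (b : subvs_of B) (x : 'cV[R]_n.+1) := vsval b *m x.
have linl x : linear (act^~ x).
  by move=> a b b'; rewrite /act linearP /= mulmxDl -scalemxAl.
have linr b : linear (act b).
  by move=> a x x'; rewrite /act mulmxDr -scalemxAr.
have comm u v w : act u (act v w) = act v (act u w).
  by rewrite /act !mulmxA (abelian_comm (subvsP u) (subvsP v)).
have faithful b : (forall w, act b w = 0) -> b = 0.
  move=> b0; apply: subvs_inj; rewrite linear0; apply/matrixP => i j.
  have /matrixP/(_ i 0) := b0 (delta_mx j 0).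
  by rewrite /act -colE !mxE.
have lam_lin : scalar (fun w : 'cV[R]_n.+1 => (c *m w) 0 0).
  by move=> a x y; rewrite mulmxDr -scalemxAr !mxE.
have nd w : (forall b, mk_scalar lam_lin (act b w) = 0) -> w = 0.
  move=> w0; apply/matrixP=> i j; rewrite (ord1 j).
  have [b bB cb] := cB (delta_mx 0 i).
  by have := w0 (vsproj B b); rewrite /= /act vsprojK // mulmxA cb -rowE !mxE.
have dimV : \dim {:subvs_of B} = n.+1.
  rewrite (covector_dim linl linr comm faithful nd).
  by rewrite dimvf /dim /= muln1.
have dimV0 : (0 < \dim {:subvs_of B})%N by rewrite dimV.
pose d := covector_action linl linr comm faithful nd dimV0.
pose A := act_alg d.
have g_lin : linear (fun a : A => vsval (a : subvs_of B) : 'M[R]_n.+1).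
  by move=> a x y; rewrite -linearP.
have gE (a : A) x : mk_linear g_lin a *m x = d a x by [].
have mxI (M N : 'M[R]_n.+1) : (forall x : 'cV_n.+1, M *m x = N *m x) -> M = N.
  move=> MN; apply/matrixP=> i j; have /matrixP/(_ i 0) := MN (delta_mx j 0).
  by rewrite -!colE !mxE.
exists A, (mk_linear g_lin); split.
- have F_lin : linear (fun u : subvs_of B * 'cV[R]_n.+1 => u : semidirect B) by [].
  apply: (@covector_coadj _ _ _ _ _ _ _ _ _ _ _ _ (mk_linear F_lin)); first by exists id.
  by [].
- exact: dimV.
- by move=> x y /= /subvs_inj.
- split; first by move=> a; apply: subvsP.
  + by move=> b bB; exists (vsproj B b); rewrite /= vsprojK.
  + by move=> x y; apply: mxI => w; rewrite gE (act_algM x y) -mulmxA !gE.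
  + apply: mxI => w; rewrite gE mul1mx.
    exact: (act_alg1 d).
Qed.

End Semidirect.

End Monogenic.

(** * Cyclic matrices and companion matrices *)

Section CyclicModels.
Variable R : fieldType.
Implicit Types (A B : cfalg R) (p q : {poly R}).

Lemma peval_morph A n (g : {linear A -> 'M[R]_n.+1}) (m : A) p :
  {morph g : x y / x * y >-> x *m y} -> g 1 = 1%:M ->
  g (peval m p) = horner_mx (g m) p.
Proof.
move=> gM g1; elim/poly_ind: p => [|p c IH]; first by rewrite !rmorph0 linear0.
rewrite !rmorphD !rmorphM /= pevalX pevalC horner_mx_X horner_mx_C linearD /= gM IH.
by rewrite linearZ /= g1 scalemx1.
Qed.

Lemma horner_mxZXn n (M : 'M[R]_n.+1) (a : R) i :
  horner_mx M (a *: 'X^i) = a *: M ^+ i.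
Proof.
rewrite -mul_polyC rmorphM /= horner_mx_C rmorphXn /= horner_mx_X.
exact: mul_scalar_mx.
Qed.

Section CyclicCovector.
Variables (n : nat) (M : 'M[R]_n.+1) (c : 'rV[R]_n.+1) (p : {poly R}).
Hypothesis cM : forall r : 'rV[R]_n.+1, exists q, c *m horner_mx M q = r.
Hypotheses (pM : p \is monic) (sp : size p = n.+2) (p0 : c *m horner_mx M p = 0).

(** A polynomial in M that kills c commutes with R[M], hence kills every row of the form c q(M). *)
Lemma horner_mx_cyclic0 : horner_mx M p = 0.
Proof.
apply/row_matrixP=> i; rewrite rowE row0; have [q <-] := cM (delta_mx 0 i).
rewrite -mulmxA -[_ *m horner_mx M p]rmorphM mulrC rmorphM /=.
by rewrite -[horner_mx M p * _]/(_ *m _) mulmxA p0 mul0mx.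
Qed.

Lemma polysd_model : exists2 A, lie_isom (polysd M) (coadj A) & monogenic A p.
Proof.
have [|A [g [iso dA gI [gB gS gM g1]]]] := @semidirect_coadj _ _ (polyalg M) c.
  move=> r; have [q <-] := cM r; exists (horner_mx M q) => //.
  by apply/memv_agenv_horner; exists q.
exists A => //; have [m mE] : exists m, g m = M.
  by apply: gS; apply/memv_agenv_horner; exists 'X; rewrite horner_mx_X.
exists m; split=> //; first by rewrite dA.
  by apply: gI; rewrite linear0 peval_morph // mE horner_mx_cyclic0.
move=> a; have /memv_agenv_horner[q qE] := gB a; exists q; apply: gI.
by rewrite peval_morph // mE.
Qed.

End CyclicCovector.

(** The algebra R[M] has the dimension n+1, which is the degree of the characteristic polynomial; so
    that polynomial generates the annihilator of M and divides the minimal one. *)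
Lemma cyclic_nonderogatory n (M : 'M[R]_n.+1) (c : 'rV[R]_n.+1) :
  (forall r : 'rV[R]_n.+1, exists q, c *m horner_mx M q = r) -> nonderogatory M.
Proof.
move=> cM; have [|A [g [_ dA gI [gB gS gM g1]]]] := @semidirect_coadj _ _ (polyalg M) c.
  move=> r; have [q <-] := cM r; exists (horner_mx M q) => //.
  by apply/memv_agenv_horner; exists q.
have [m mE] : exists m, g m = M.
  by apply: gS; apply/memv_agenv_horner; exists 'X; rewrite horner_mx_X.
have ev q : g (peval m q) = horner_mx M q by rewrite peval_morph // mE.
apply/eqP; rewrite -eqp_monic ?char_poly_monic ?mxminpoly_monic //.
rewrite /eqp mxminpoly_dvd_char andbT.
apply: (@monogenic_dvd _ A _ m) => //.
- exact: char_poly_monic.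
- by rewrite size_char_poly dA.
- by apply: gI; rewrite ev linear0 Cayley_Hamilton.
- move=> a; have /memv_agenv_horner[q qE] := gB a.
  by exists q; apply: gI; rewrite ev.
- by apply: gI; rewrite ev linear0 mx_root_minpoly.
Qed.

Section Chain.
Variables (n : nat) (M : 'M[R]_n.+1) (p : {poly R}).
Hypothesis shift : forall i : 'I_n.+1, (i < n)%N ->
  delta_mx 0 i *m M = delta_mx 0 (inord i.+1) :> 'rV_n.+1.
Hypothesis last : delta_mx 0 ord_max *m M =
  - \sum_(j < n.+1) p`_j *: delta_mx 0 j :> 'rV_n.+1.
Hypotheses (pM : p \is monic) (sp : size p = n.+2).

Lemma chain_exp i : (i <= n)%N -> delta_mx 0 0 *m M ^+ i = delta_mx 0 (inord i) :> 'rV_n.+1.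
Proof.
elim: i => [|i IH] lein; first by rewrite expr0 mulmx1; congr delta_mx; apply/val_inj;
    rewrite /= inordK.
rewrite exprSr -[M ^+ i * M]/(_ *m _) mulmxA IH ?(ltnW lein) //.
have iE : (inord i : 'I_n.+1) = i :> nat by rewrite inordK // ltnS ltnW.
by rewrite shift iE.
Qed.

Lemma chain_cyclic (r : 'rV[R]_n.+1) : exists q, delta_mx 0 0 *m horner_mx M q = r.
Proof.
exists (\poly_(i < n.+1) r 0 (inord i)).
rewrite poly_def rmorph_sum mulmx_sumr [RHS]row_sum_delta; apply: eq_bigr => i _.
rewrite /= horner_mxZXn -scalemxAr (chain_exp (leq_ord i)).
by rewrite inord_val.
Qed.

(** On the first unit row the leading term of p yields the last unit row times M, which by [last] is
    minus the sum of the lower terms. *)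
Lemma chain_root : delta_mx 0 0 *m horner_mx M p = 0 :> 'rV_n.+1.
Proof.
have -> : p = \poly_(i < n.+2) p`_i by rewrite -sp coefK.
rewrite poly_def rmorph_sum mulmx_sumr big_ord_recr /=.
rewrite /= horner_mxZXn exprSr -scalemxAr -[M ^+ n * M]/(_ *m _) mulmxA chain_exp //.
have -> : inord n = ord_max :> 'I_n.+1 by apply/val_inj; rewrite /= inordK.
have -> : p`_n.+1 = 1 by rewrite -(monicP pM) lead_coefE sp.
rewrite scale1r last -[X in X - _](_ : \sum_(j < n.+1) p`_j *: delta_mx 0 j = _) ?subrr //.
apply: eq_bigr => i _; rewrite /= horner_mxZXn -scalemxAr (chain_exp (leq_ord i)).
by rewrite inord_val.
Qed.

Lemma chain_model : exists2 A, lie_isom (polysd M) (coadj A) & monogenic A p.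
Proof. exact: polysd_model chain_cyclic pM sp chain_root. Qed.

End Chain.

Lemma monogenic_companion A p n : monogenic A p -> size p = n.+2 ->
  exists2 M : 'M[R]_n.+1, nonderogatory M & lie_isom (coadj A) (polysd M).
Proof.
move=> Ap sp; have pM : p \is monic by case: Ap => m [].
(* The companion matrix for the action on rows: a shift whose last row carries minus the lower
   coefficients of p. *)
pose M : 'M[R]_n.+1 := \matrix_(i, j) if i == ord_max then - p`_j else (i.+1 == j)%:R.
have M1 (i : 'I_n.+1) : (i < n)%N ->
    delta_mx 0 i *m M = delta_mx 0 (inord i.+1) :> 'rV_n.+1.
  move=> lt_in; rewrite -rowE; apply/rowP=> j; rewrite !mxE -!val_eqE /= inordK ?ltnS //.
  by rewrite (ltn_eqF lt_in) eq_sym.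
have M2 : delta_mx 0 ord_max *m M = - \sum_(j < n.+1) p`_j *: delta_mx 0 j :> 'rV_n.+1.
  rewrite -rowE; apply/rowP=> j; rewrite !mxE eqxx summxE (bigD1 j) //=.
  rewrite !mxE !eqxx mulr1 big1 ?addr0 // => k kj.
  by rewrite !mxE eqxx /= eq_sym (negPf kj) mulr0.
have [B isoB Bp] := chain_model M1 M2 pM sp.
exists M; first exact: cyclic_nonderogatory (chain_cyclic M1).
apply: lie_isom_trans (lie_isom_sym isoB).
exact/coadj_isom/(monogenic_isom Ap Bp).
Qed.

Lemma D0_model n : exists2 A, lie_isom (D0 R n.+1) (coadj A) & monogenic A 'X^(n.+1).
Proof.
have ME (i j : 'I_n.+1) : M0 R n.+1 i j = (i.+1 == j)%:R.
  rewrite /M0 big_add1 big_mkord summxE /=.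
  case: (ltnP i n) => [lt_in|ge_in].
    rewrite (bigD1 (Ordinal lt_in)) //= big1 ?addr0 => [|k ki].
      by rewrite /Emx mxE /= -!val_eqE /= !inordK ?ltnS ?eqxx /= 1?eq_sym // ltnW.
    rewrite /Emx mxE /= -!val_eqE /= !inordK ?ltnS //; last exact: ltnW.
    by move: ki; rewrite -val_eqE /= eq_sym => /negPf->.
  rewrite big1 => [|k _].
    by rewrite gtn_eqF // ltnS (leq_trans _ ge_in) // -ltnS.
  rewrite /Emx mxE /= -!val_eqE /= !inordK ?ltnS //; last exact: ltnW.
  by rewrite gtn_eqF // (leq_trans (ltn_ord k)).
have M1 (i : 'I_n.+1) : (i < n)%N ->
    delta_mx 0 i *m M0 R n.+1 = delta_mx 0 (inord i.+1) :> 'rV_n.+1.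
  move=> lt_in; rewrite -rowE; apply/rowP=> j; rewrite mxE ME !mxE -!val_eqE /= inordK ?ltnS //.
  by rewrite eq_sym.
have M2 : delta_mx 0 ord_max *m M0 R n.+1 =
    - \sum_(j < n.+1) ('X^(n.+1) : {poly R})`_j *: delta_mx 0 j :> 'rV_n.+1.
  rewrite big1 ?oppr0 => [|j _]; last by rewrite coefXn ltn_eqF ?scale0r.
  rewrite -rowE; apply/rowP=> j; rewrite mxE ME mxE /=.
  by rewrite gtn_eqF.
exact: chain_model M1 M2 (monicXn _ _) (size_polyXn _ _).
Qed.

End CyclicModels.

(** * Algebras of the Lie algebras in the list *)

Section AffineModels.
Variable R : fieldType.

Lemma dim1_scalar (A : cfalg R) : \dim {:A} = 1%N -> forall a : A, exists c, a = c%:A.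
Proof.
move=> dA a; suff : a \in <[1 : A]>%VS by move/vlineP=> [c ->]; exists c.
suff /eqP-> : (<[1 : A]> == fullv)%VS by apply: memvf.
by rewrite eqEdim subvf dA dim_vline oner_eq0.
Qed.

Lemma dim1_monogenic (A : cfalg R) : \dim {:A} = 1%N -> monogenic A 'X.
Proof.
move=> dA; exists 0; split; rewrite ?monicX ?size_polyX ?dA ?pevalX //.
by move=> a; have [c ->] := dim1_scalar dA a; exists c%:P; rewrite pevalC.
Qed.

(** Here A is R acting on itself; e_1 spans A and e_2 its dual. *)
Lemma aff_real_model :
  exists2 A : cfalg R, lie_isom (aff_real R) (coadj A) & monogenic A 'X.
Proof.
pose act (v w : R^o) : R^o := v * w.
have linl w : linear (act^~ w) by move=> a x y; rewrite /act mulrDl -scalerAl.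
have linr v : linear (act v) by move=> a x y; rewrite /act mulrDr -scalerAr.
have comm u v w : act u (act v w) = act v (act u w) by rewrite /act mulrCA.
have faithful v : (forall w, act v w = 0) -> v = 0.
  by move=> /(_ 1); rewrite /act mulr1.
have lam_lin : scalar (fun w : R^o => w : R) by [].
have nd w : (forall v, mk_scalar lam_lin (act v w) = 0) -> w = 0.
  by move=> /(_ 1) /=; rewrite /act mul1r.
have dimV : \dim {:R^o} = 1%N by rewrite dimvf.
have dimV0 : (0 < \dim {:R^o})%N by rewrite dimV.
exists (act_alg (covector_action linl linr comm faithful nd dimV0)); last first.
  exact: dim1_monogenic.
pose F (u : R^o * R^o) : aff_real R := \row_(i < 2) if i == 0 then u.1 else u.2.
have F_lin : linear F.
  suff H (a : R) x y : F (a *: x + y) = a *: F x + F y by exact: H.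
  by apply/rowP=> i; rewrite !mxE; case: eqP.
apply: (@covector_coadj _ _ _ _ _ _ _ _ _ _ _ _ (mk_linear F_lin)).
  apply: inj_linear_bij => [[v w] /= /rowP F0|]; last first.
    by rewrite dim_pair dimV dimvf /dim /= mul1n.
  by have := F0 0; have := F0 1; rewrite !mxE /= => -> ->.
move=> v w v' w'; apply/rowP=> i; rewrite /= /plucker !mxE /=.
case: i => [[|[|//]]] /= _; rewrite /act ?mulr0 ?mulr1 //.
by rewrite /plucker !mxE /= (mulrC w).
Qed.

(** Here A is C in real coordinates and the covector is the real part: e_1, e_2 are 1, i in A, while
    e_3, e_4 are 1, i in the module C, identified with the dual by (v, w) |-> Re (v w). *)
Lemma aff_complex_model : 
  exists2 A : cfalg R, lie_isom (aff_complex R) (coadj A) & monogenic A ('X^2 + 1).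
Proof.
pose V := (R^o * R^o)%type.
pose act (v w : V) : V := (v.1 * w.1 - v.2 * w.2, v.1 * w.2 + v.2 * w.1).
have linl w : linear (act^~ w).
  suff H (a : R) x y : act (a *: x + y) w = a *: act x w + act y w by exact: H.
  move: x y w => [x1 x2] [y1 y2] [w1 w2]; congr pair.
    change ((a * x1 + y1) * w1 - (a * x2 + y2) * w2 =
      a * (x1 * w1 - x2 * w2) + (y1 * w1 - y2 * w2)); ring.
  change ((a * x1 + y1) * w2 + (a * x2 + y2) * w1 =
    a * (x1 * w2 + x2 * w1) + (y1 * w2 + y2 * w1)); ring.
have actC v w : act v w = act w v by congr pair; ring.
have linr v : linear (act v).
  by move=> a x y; rewrite !(actC v) linl.
have comm u v w : act u (act v w) = act v (act u w) by congr pair => /=; ring.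
have faithful v : (forall w, act v w = 0) -> v = 0.
  by move=> /(_ (1, 0)); rewrite /act /= !mulr1 !mulr0 subr0 add0r; case: v.
have lam_lin : scalar (fun w : V => w.1 : R) by [].
have nd w : (forall v, mk_scalar lam_lin (act v w) = 0) -> w = 0.
  move=> w0; have := w0 (1, 0); have := w0 (0, 1).
  rewrite /= /act /= !mul0r !mul1r subr0 sub0r => /eqP; rewrite oppr_eq0 => /eqP.
  by case: w {w0} => x y /= -> ->.
have dimV : \dim {:V} = 2%N by rewrite dim_pair !dimvf.
have dimV0 : (0 < \dim {:V})%N by rewrite dimV.
pose d := covector_action linl linr comm faithful nd dimV0.
exists (act_alg d).
  pose F (u : V * V) : aff_complex R := \row_(i < 4)
    [:: u.1.1; u.1.2; u.2.1; u.2.2]`_i.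
  have F_lin : linear F.
    suff H (a : R) x y : F (a *: x + y) = a *: F x + F y by exact: H.
    by apply/rowP=> -[[|[|[|[|//]]]] i]; rewrite !mxE.
  apply: (@covector_coadj _ _ _ _ _ _ _ _ _ _ _ _ (mk_linear F_lin)).
    apply: inj_linear_bij => [[[v v'] [w w']] /= /rowP F0|]; last first.
      by rewrite dim_pair dimV dimvf /dim /= mul1n.
    have := F0 0; have := F0 1; have := F0 2; have := F0 3; rewrite !mxE /=.
    by move=> -> -> -> ->.
  move=> v w v' w'; apply/rowP=> i; rewrite /= /plucker !mxE /=.
  case: i => [[|[|[|[|//]]]]] /= _; rewrite /act /plucker !mxE /=; ring.
have one : (1 : act_alg d) = ((1, 0) : V).
  apply: (@act_inj R V V d) => w; apply: (etrans (act_alg1 d w)); rewrite /= /act /= !mul1r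
      !mul0r subr0 addr0.
  by case: w.
exists ((0, 1) : V); split.
- by rewrite monicE lead_coefDl ?lead_coefXn // size_polyXn size_poly1.
- by rewrite size_polyDl size_polyXn ?size_poly1 // dimV.
- rewrite rmorphD rmorphXn /= pevalX rmorph1 expr2 one.
  apply: (@act_inj R V V d) => w; rewrite -[X in X + _]scale1r act_lE scale1r.
  rewrite [X in X + _](@act_algM R V V d) act_0.
  move: w => [w1 w2]; congr pair => /=; rewrite ?mul0r ?mul1r ?sub0r ?add0r.
    by rewrite subr0 addNr.
  by rewrite addr0 addNr.
move=> a; exists (a.1%:P + a.2 *: 'X).
rewrite rmorphD /= pevalC pevalZ pevalX one.
case: a => x y; congr pair.
  by change (x = x * 1 + y * 0 :> R); ring.
by change (y = x * 0 + y * 1 :> R); ring.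
Qed.

End AffineModels.

(** * The Lie algebras given by matrices *)

Section MatrixModels.
Variable R : numFieldType.
Implicit Types A B : cfalg R.
Local Notation e n k := (delta_mx 0 (inord k) : 'rV[R]_n.+1).

Lemma row_Emx n k i j : (k <= n)%N -> (0 < i <= n.+1)%N ->
  e n k *m Emx R n i j = if k.+1 == i then e n j.-1 else 0.
Proof.
move=> kn; case: i => // i /andP[_ lin]; rewrite mul_delta_mx_cond -val_eqE /= !inordK //.
by rewrite eqSS; case: eqP.
Qed.

Lemma cyclic_from_basis n (M : 'M[R]_n.+1) (c : 'rV[R]_n.+1) :
  (forall k, (k <= n)%N -> exists q, c *m horner_mx M q = e n k) ->
  forall r : 'rV[R]_n.+1, exists q, c *m horner_mx M q = r.
Proof.
move=> ex r; have exi (i : 'I_n.+1) : exists q, c *m horner_mx M q = delta_mx 0 i.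
  by have [q qE] := ex i (leq_ord i); exists q; rewrite qE inord_val.
exists (\sum_i (r 0 i)%:P * sval (cid (exi i))).
rewrite rmorph_sum mulmx_sumr [RHS]row_sum_delta; apply: eq_bigr => i _ /=.
rewrite rmorphM /= horner_mx_C -[_%:M * _]/(_ *m _) mul_scalar_mx -scalemxAr.
by case: cid => q /= ->.
Qed.

(** With zero-based unit rows, e_0 (M^2 + 1) = -2 e_3, which gives e_3; then e_2 = e_3 M and e_1 =
    e_2 - e_0 M, so e_0 is cyclic. As e_3 (M^2 + 1) = 0, the square of M^2 + 1 kills e_0. *)
Lemma D01_model : exists2 A, lie_isom (D01 R) (coadj A) & monogenic A (('X^2 + 1) ^+ 2).
Proof.
pose M := M01 R.
have M0 : e 3 0 *m M = e 3 2 - e 3 1.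
  by rewrite /M /M01 !mulmxDr !mulmxN !row_Emx //= oppr0 !(addr0, add0r) addrC.
have M1 : e 3 1 *m M = e 3 0 + e 3 3.
  by rewrite /M /M01 !mulmxDr !mulmxN !row_Emx //= ?oppr0 !(addr0, add0r).
have M2 : e 3 2 *m M = - e 3 3.
  by rewrite /M /M01 !mulmxDr !mulmxN !row_Emx //= ?oppr0 !(addr0, add0r).
have M3 : e 3 3 *m M = e 3 2.
  by rewrite /M /M01 !mulmxDr !mulmxN !row_Emx //= ?oppr0 !(addr0, add0r).
have sX (v w : 'rV_4) q : v *m horner_mx M q = w -> v *m horner_mx M (q * 'X) = w *m M.
  by move=> <-; rewrite rmorphM /= horner_mx_X -[_ * M]/(_ *m _) mulmxA.
have sQ (v : 'rV_4) : v *m horner_mx M ('X^2 + 1) = v *m M *m M + v.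
  by rewrite rmorphD rmorph1 rmorphXn /= horner_mx_X mulmxDr mulmx1 expr2 mulmxA.
have Q0 : e 3 0 *m horner_mx M ('X^2 + 1) = - (e 3 3 *+ 2).
  by rewrite sQ M0 mulmxBl M1 M2; apply/rowP=> j; rewrite !mxE; ring.
have n2 : (2 : R) != 0 by rewrite pnatr_eq0.
have Q3 : e 3 0 *m horner_mx M (- (2^-1)%:P * ('X^2 + 1)) = e 3 3.
  rewrite mulNr rmorphN rmorphM /= horner_mx_C mulmxN -[_%:M * _]/(_ *m _).
  rewrite mul_scalar_mx -scalemxAr Q0 scalerN opprK -scaler_nat scalerA.
  by rewrite mulVf // scale1r.
apply: (@polysd_model _ _ _ (e 3 0)).
- apply: cyclic_from_basis => -[|[|[|[|//]]]] _.
  + by exists 1; rewrite rmorph1 mulmx1.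
  + exists (- (2^-1)%:P * ('X^2 + 1) * 'X - 'X).
    by rewrite rmorphB mulmxBr (sX _ _ _ Q3) M3 /= horner_mx_X M0 opprB addrCA subrr addr0.
  + by exists (- (2^-1)%:P * ('X^2 + 1) * 'X); rewrite (sX _ _ _ Q3) M3.
  + by exists (- (2^-1)%:P * ('X^2 + 1)).
- by rewrite monic_exp // monicE lead_coefDl ?lead_coefXn // size_polyXn size_poly1.
- have mX : 'X^2 + 1 \is @monic R.
    by rewrite monicE lead_coefDl ?lead_coefXn // size_polyXn size_poly1.
  by rewrite expr2 size_monicM ?monic_neq0 // size_polyDl size_polyXn ?size_poly1.
rewrite expr2 rmorphM /= -[_ * horner_mx M _]/(_ *m _) mulmxA Q0 mulNmx -scaler_nat -scalemxAl.
by rewrite sQ M3 M2 addNr scaler0 oppr0.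
Qed.

(** The span of x, y, z multiplies through the symmetric form with matrix (al, be; be, ga) on x and
    y, with values on the line of z. Dimension 4 makes the spanning family 1, x, y, z a basis. *)
Definition quad_alg A (al be ga : R) := \dim {:A} = 4%N /\
  exists x y z : A,
  (forall a, exists k : R * R * R * R, a = k.1.1.1%:A + k.1.1.2 *: x + k.1.2 *: y + k.2 *: z) /\
  [/\ x * x = al *: z, x * y = be *: z & y * y = ga *: z] /\
  [/\ x * z = 0, y * z = 0 & z * z = 0].

Definition triv3_alg A := \dim {:A} = 3%N /\
  exists x y : A,
  (forall a, exists k : R * R * R, a = k.1.1%:A + k.1.2 *: x + k.2 *: y) /\
  [/\ x * x = 0, x * y = 0 & y * y = 0].

(** The first unit row sends 1, X, Y, Z to the four unit rows, so it is a cyclic covector. *)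
Lemma quad_model (X Y Z : 'M[R]_4) (sC : {in [:: 1%:M; X; Y; Z] &, forall a b, comm_mx a b})
    (al be ga : R) :
  [/\ e 3 0 *m X = e 3 1, e 3 0 *m Y = e 3 2 & e 3 0 *m Z = e 3 3] ->
  [/\ X *m X = al *: Z, X *m Y = be *: Z & Y *m Y = ga *: Z] ->
  [/\ X *m Z = 0, Y *m Z = 0 & Z *m Z = 0] ->
  exists2 A, lie_isom (semidirect (span_abelian sC)) (coadj A) & quad_alg A al be ga.
Proof.
move=> [eX eY eZ] [XX XY YY] [XZ YZ ZZ].
have mem (M : 'M[R]_4) : M \in [:: 1%:M; X; Y; Z] -> M \in (span_abelian sC : {vspace _}).
  exact: memv_span.
have [|A [g [iso dA gI [gB gS gM g1]]]] := @semidirect_coadj _ _ (span_abelian sC) (e 3 0).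
  move=> r; exists (r 0 (inord 0) *: 1%:M + r 0 (inord 1) *: X + r 0 (inord 2) *: Y + r 0
      (inord 3) *: Z).
    by rewrite !memvD // memvZ // mem // !inE eqxx ?orbT.
  rewrite !mulmxDr -!scalemxAr mulmx1 eX eY eZ.
  rewrite [RHS]row_sum_delta !big_ord_recl big_ord0 addr0 -!addrA.
  by congr (_ + (_ + (_ + _))); congr (r 0 _ *: delta_mx 0 _); apply/val_inj; rewrite /= inordK.
exists A => //; split=> //.
have [x xE] : exists x, g x = X by apply: gS; rewrite mem // !inE eqxx ?orbT.
have [y yE] : exists x, g x = Y by apply: gS; rewrite mem // !inE eqxx ?orbT.
have [z zE] : exists x, g x = Z by apply: gS; rewrite mem // !inE eqxx ?orbT.
exists x, y, z; split; last first.
  by split; split; apply: gI; rewrite gM ?linearZ ?linear0 /= ?xE ?yE ?zE.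
move=> a; have := gB a; rewrite /= !span_cons span_nil addv0.
case/memv_addP=> _ /vlineP[k1 ->] [w1 + aE].
case/memv_addP=> _ /vlineP[k2 ->] [w2 + w1E].
case/memv_addP=> _ /vlineP[k3 ->] [_ /vlineP[k4 ->] w2E].
exists (k1, k2, k3, k4); apply: gI; rewrite aE w1E w2E !linearD /= !linearZ /= g1 xE yE zE.
by rewrite !addrA.
Qed.

(** E_{1,2} + E_{2,4} squares to E_{1,4} and E_{1,3} contributes nothing: the form is X^2. The next
    three models have the forms X^2 + Y^2, 2 X Y and 0. *)
Lemma h42_model : exists2 A, lie_isom (h42 R) (coadj A) & quad_alg A 1 0 0.
Proof.
apply: quad_model; split; rewrite ?(mulmxDr, mulmxDl) ?row_Emx ?mul_Emx //= ?addr0 ?add0r //;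
  by rewrite ?scale1r ?scale0r.
Qed.

Lemma h43_model : exists2 A, lie_isom (h43 R) (coadj A) & quad_alg A 1 0 1.
Proof.
apply: quad_model; split; rewrite ?(mulmxDr, mulmxDl) ?row_Emx ?mul_Emx //= ?addr0 ?add0r //;
  by rewrite ?scale1r ?scale0r.
Qed.

Lemma G44'_model : exists2 A, lie_isom (G44' R) (coadj A) & quad_alg A 0 1 0.
Proof.
apply: quad_model; split; rewrite ?(mulmxDr, mulmxDl) ?row_Emx ?mul_Emx //= ?addr0 ?add0r //;
  by rewrite ?scale1r ?scale0r.
Qed.

Lemma G41_model : exists2 A, lie_isom (Gn1 R 4) (coadj A) & quad_alg A 0 0 0.
Proof.
apply: (@quad_model (Emx R 3 1 2) (Emx R 3 1 3) (Emx R 3 1 4)); split;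
  rewrite ?row_Emx ?mul_Emx //= ?addr0 ?add0r //;
  by rewrite ?scale1r ?scale0r.
Qed.

Lemma G31_model : exists2 A, lie_isom (Gn1 R 3) (coadj A) & triv3_alg A.
Proof.
pose B := span_abelian (@Gn1_gens_comm R 3).
have mem (M : 'M[R]_3) : M \in [:: 1%:M; Emx R 2 1 2; Emx R 2 1 3] -> M \in (B : {vspace _}).
  exact: memv_span.
have [|A [g [iso dA gI [gB gS gM g1]]]] := @semidirect_coadj _ _ B (e 2 0).
  move=> r; exists (r 0 (inord 0) *: 1%:M + r 0 (inord 1) *: Emx R 2 1 2 + r 0 (inord 2) *:
      Emx R 2 1 3).
    by rewrite !memvD // memvZ // mem // !inE eqxx ?orbT.
  rewrite !mulmxDr -!scalemxAr mulmx1 !row_Emx //=.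
  rewrite [RHS]row_sum_delta !big_ord_recl big_ord0 addr0 -!addrA.
  by congr (_ + (_ + _)); congr (r 0 _ *: delta_mx 0 _); apply/val_inj; rewrite /= inordK.
exists A => //; split=> //.
have [x xE] : exists x, g x = Emx R 2 1 2 by apply: gS; rewrite mem // !inE eqxx ?orbT.
have [y yE] : exists x, g x = Emx R 2 1 3 by apply: gS; rewrite mem // !inE eqxx ?orbT.
exists x, y; split; last first.
  by split; apply: gI; rewrite gM linear0 ?xE ?yE mul_Emx.
move=> a; have := gB a; rewrite /= /Gn1_gens /= !span_cons span_nil addv0.
case/memv_addP=> _ /vlineP[k1 ->] [w1 + aE].
case/memv_addP=> _ /vlineP[k2 ->] [_ /vlineP[k3 ->] w1E].
exists (k1, k2, k3); apply: gI; rewrite aE w1E !linearD /= !linearZ /= g1 xE yE.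
by rewrite !addrA.
Qed.

End MatrixModels.

(** * Nilpotents, idempotents and residue fields *)

Section Nilpotent.
Variable R : fieldType.
Implicit Types (A B : cfalg R) (p q : {poly R}).

Definition nilpotent A (x : A) := exists k, x ^+ k = 0.
Definition connected A := forall e : A, e * e = e -> e = 0 \/ e = 1.

Lemma scal_inj A (c : R) : c%:A = 0 :> A -> c = 0.
Proof. by move/eqP; rewrite scaler_eq0 oner_eq0 orbF => /eqP. Qed.

Lemma nilpotentD A (x y : A) : nilpotent x -> nilpotent y -> nilpotent (x + y).
Proof.
case=> j xj [k yk]; exists (j + k)%N; rewrite exprDn big1 // => i _.
case: (leqP k i) => [leki|ltik].
  by rewrite -(subnK leki) exprD yk !mulr0 mul0rn.
rewrite -(addnBA _ (ltnW ltik)) exprD xj !mul0r mul0rn //.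
Qed.

Lemma nilpotentMl A (x y : A) : nilpotent x -> nilpotent (y * x).
Proof. by case=> k xk; exists k; rewrite exprMn xk mulr0. Qed.

Lemma nilpotentZ A (x : A) (c : R) : nilpotent x -> nilpotent (c *: x).
Proof. by rewrite -mulr_algl; apply: nilpotentMl. Qed.

Lemma nilpotentN A (x : A) : nilpotent x -> nilpotent (- x).
Proof. by rewrite -mulN1r; apply: nilpotentMl. Qed.

Lemma nilpotentB A (x y : A) : nilpotent x -> nilpotent y -> nilpotent (x - y).
Proof. by move=> xn yn; apply: nilpotentD => //; apply: nilpotentN. Qed.

Lemma nilpotent_scal A (c : R) : nilpotent (c%:A : A) -> c = 0.
Proof.
case=> k; rewrite -[c%:A]/(in_alg A c) -rmorphXn /= => /scal_inj/eqP.
by rewrite expf_eq0 => /andP[_ /eqP].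
Qed.

Lemma annihilator A (x : A) : exists2 p, p != 0 & peval x p = 0.
Proof.
apply: contrapT => np; set n := (\dim {:A}).+1.
pose h (v : 'rV[R]_n) := peval x (rVpoly v).
have h_lin : linear h.
  suff H (a : R) u v : h (a *: u + v) = a *: h u + h v by exact: H.
  by rewrite /h linearP rmorphD /= pevalZ.
have: (\dim {:'rV[R]_n} <= \dim {:A})%N.
  apply: (@inj_linear_dim _ _ _ (mk_linear h_lin)) => v hv0.
  apply: contrapT => v0; apply: np; exists (rVpoly v) => //.
  by apply: contra_not_neq v0 => v0; rewrite -[v]rVpolyK v0 linear0.
by rewrite dimvf /dim /= mul1n ltnn.
Qed.

(** Stripping powers of X off an annihilating polynomial leaves a nonzero constant term, whence x^k
    = x^(k+1) y for some k and y. Then x^k y^k is idempotent: if it is 0 then x^k = 0, and if it is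
    1 then x is invertible. *)
Lemma fitting A (x : A) : connected A -> nilpotent x \/ exists y, x * y = 1.
Proof.
move=> cA; have [k [y xk]] : exists k y, x ^+ k = x ^+ k.+1 * y.
  have [p p0 px] := annihilator x.
  suff gen j : x ^+ j * peval x p = 0 -> exists k y, x ^+ k = x ^+ k.+1 * y.
    by apply: (gen 0%N); rewrite px mulr0.
  elim/poly_ind: p p0 {px} j => [|p c IH] pc0 j; first by rewrite eqxx in pc0.
  rewrite rmorphD rmorphM /= pevalX pevalC; have [c0|c_neq0] := eqVneq c 0.
    move: pc0; rewrite c0 addr0 mulf_eq0 polyX_eq0 orbF => p0.
    rewrite scale0r addr0 (mulrC (peval x p)) mulrA -exprSr; exact: IH.
  move=> E; exists j, (- c^-1 *: peval x p).
  rewrite -mulr_algl [RHS]mulrCA exprSr -mulrA.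
  have -> : x ^+ j * (x * peval x p) = - (x ^+ j * c%:A).
    by apply/eqP; rewrite -addr_eq0 -mulrDr (mulrC x) E.
  rewrite mulrN (mulrCA _ (x ^+ j)) -[c%:A]/(in_alg A c) -[(- _)%:A]/(in_alg A _).
  by rewrite -rmorphM mulNr mulVf // rmorphN1 mulrN1 opprK.
have xkm m : x ^+ k = x ^+ (k + m) * y ^+ m.
  elim: m => [|m IH]; first by rewrite addn0 mulr1.
  by rewrite {1}IH exprD xk addnS !exprS exprD; ring.
have ee : (x ^+ k * y ^+ k) * (x ^+ k * y ^+ k) = x ^+ k * y ^+ k.
  by rewrite mulrACA -exprD mulrA -xkm.
have [e0|e1] := cA _ ee; [left; exists k | right].
  by rewrite (xkm k) exprD -mulrA e0 mulr0.
(* For k = 0 the idempotent is trivially 1, and the inverse comes from [xk] itself. *)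
case: k xk e1 {xkm ee} => [|k] xk e1; first by exists y; rewrite -[x]expr1 -xk.
by exists (x ^+ k * y ^+ k.+1); rewrite mulrA -exprS.
Qed.

End Nilpotent.

(** * Real polynomial factors and residue fields *)

Section RealFactors.
Variable R : rcfType.
Implicit Types (A : cfalg R) (p q : {poly R}).

Lemma size_quad (a b : R) : size (('X - a%:P) ^+ 2 + (b ^+ 2)%:P) = 3%N.
Proof.
by rewrite size_polyDl size_exp_XsubC // (leq_ltn_trans (size_polyC_leq1 _)).
Qed.

(** The polynomial has a root a + b i over R[i]. If b is nonzero, the remainder modulo the quadratic
    is real of degree at most 1 and vanishes at a nonreal point, so it is 0. *)
Lemma real_factor p : (1 < size p)%N ->
  exists2 r, r %| p & (exists a : R, r = 'X - a%:P) \/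
    (exists a b : R, b != 0 /\ r = ('X - a%:P) ^+ 2 + (b ^+ 2)%:P).
Proof.
move=> sp; have [[a b] /rootP pz] : exists z, root (map_poly (real_complex R) p) z.
  by apply/closed_rootP; rewrite size_map_poly gtn_eqF.
pose z : R[i]%C := (a +i* b)%C.
have zE : z = a%:C%C + 'i%C * b%:C%C by rewrite [LHS]complexE.
have [b0|b_neq0] := eqVneq b 0.
  exists ('X - a%:P); last by left; exists a.
  rewrite dvdp_XsubCl; apply/rootP; apply: (@complexI R).
  by rewrite -horner_map /= -[RHS]pz b0.
pose r : {poly R} := ('X - a%:P) ^+ 2 + (b ^+ 2)%:P.
have sr : size r = 3%N by apply: size_quad.
exists r; last by right; exists a, b.
have rz : (map_poly (real_complex R) r).[z] = 0.
  rewrite /r rmorphD rmorphXn rmorphB /= map_polyX !map_polyC /= !hornerE /= zE.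
  rewrite !rmorphXn /=; have := sqr_i R; set i := 'i%C => i2.
  rewrite (_ : (_ + _ - _) ^+ 2 + _ = (i ^+ 2 + 1) * b%:C%C ^+ 2); last by ring.
  by rewrite i2 addNr mul0r.
set s := p %% r; have ss : (size s < 3)%N by rewrite -sr ltn_modp -size_poly_gt0 sr.
have sE : s = (s`_0)%:P + s`_1 *: 'X.
  apply/polyP=> -[|[|j]]; rewrite coefD coefC coefZ coefX ?mulr0 ?addr0 ?mulr1 ?add0r //=.
  by apply: nth_default; apply: (@leq_trans 2).
have sz : (map_poly (real_complex R) s).[z] = 0.
  move: pz; rewrite -/z {1}(divp_eq p r) rmorphD rmorphM /= hornerD hornerM rz mulr0 add0r.
  by [].
move: sz; rewrite sE rmorphD /= map_polyC map_polyZ map_polyX /= !hornerE.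
rewrite /z; simpc => -[E1 E2].
have s1 : s`_1 = 0 by move/eqP: E2; rewrite mulf_eq0 (negPf b_neq0) orbF => /eqP.
move: E1; rewrite s1 mul0r addr0 => s0.
by rewrite /dvdp -/s sE s1 s0 scale0r addr0.
Qed.

(** Real factors r are stripped off an annihilating polynomial. By [fitting], r(m) is nilpotent and
    the claim holds, or it is invertible and the cofactor still annihilates m; a nonzero constant
    never does. *)
Lemma residue A (m : A) : connected A ->
  (exists a : R, nilpotent (m - a%:A)) \/
  (exists a b : R, b != 0 /\ nilpotent ((m - a%:A) ^+ 2 + (b ^+ 2)%:A)).
Proof.
move=> cA; have [p p0 pm] := annihilator m.
have [n] := ubnP (size p); elim: n p p0 pm => // n IH p p0 pm sp.
have [sp1|] := leqP (size p) 1.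
  move: pm p0; rewrite (size1_polyC sp1) pevalC => /scal_inj->.
  by rewrite eqxx.
move=> /real_factor[r /dvdpP[q pE] rE].
have [qr0 sq] : q != 0 /\ (size q < size p)%N.
  have /andP[q0 r0] : (q != 0) && (r != 0) by rewrite -negb_or -mulf_eq0 -pE.
  split=> //; rewrite pE size_mul //.
  have : (1 < size r)%N.
    case: rE => [[a ->]|[a [b [_ ->]]]]; first by rewrite size_XsubC.
    by rewrite size_quad.
  by move: (size_poly_gt0 q); rewrite q0; case: (size r) (size q) => [|[|k]] // [|l] // _ _;
      rewrite !addSn !addnS /= ltnS leq_addr.
case: (fitting (peval m r) cA) => [rn|[y ry]]; last first.
  apply: (IH q) => //; last exact: leq_trans sq _.
  by rewrite -[LHS]mulr1 -ry mulrA -rmorphM /= -pE pm mul0r.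
case: rE => [[a rE]|[a [b [b0 rE]]]]; [left; exists a | right; exists a, b; split=> //].
  by move: rn; rewrite rE rmorphB /= pevalX pevalC.
by move: rn; rewrite rE rmorphD rmorphXn rmorphB /= pevalX !pevalC.
Qed.

(* Newton's iteration for i^2 + 1 = 0: the correction u -> u (1 + (u^2 + 1) / 2)
   squares the nilpotent defect u^2 + 1, up to a factor. *)
Lemma lift_i A (u : A) : nilpotent (u * u + 1) -> exists i : A, i * i = -1.
Proof.
case=> k; have [n] := ubnP k; elim: n k u => // n IH k u.
case: k => [|[|k]].
- by move=> _; rewrite expr0 => /eqP; rewrite oner_eq0.
- by move=> _; rewrite expr1 => /eqP; rewrite addr_eq0 => /eqP uE; exists u.
move=> kn tk; set t := u * u + 1 in tk.
pose h : A := in_alg A 2^-1.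
have hh : h + h = 1.
  by rewrite -rmorphD (_ : 2^-1 + 2^-1 = 1) ?rmorph1 //; field.
have hE : h = 1 - h by rewrite -hh addrK.
apply: (IH k.+1 (u * (1 + t * h))) => //.
have -> : u * (1 + t * h) * (u * (1 + t * h)) + 1 = t ^+ 2 * (1 - h ^+ 2 + h ^+ 2 * t).
  have uu : u * u = t - 1 by rewrite /t addrK.
  have -> : u * (1 + t * h) * (u * (1 + t * h)) = (u * u) * (1 + t * (h + h) + t ^+ 2 * h ^+
      2) by ring.
  by rewrite uu hh; ring.
by rewrite exprMn -exprM mul2n -addnn -addSnnS exprD tk !mul0r.
Qed.

End RealFactors.

(** * Powers of a nilpotent element *)

Section NilpotentPowers.
Variable R : fieldType.
Implicit Types (A B : cfalg R) (p q : {poly R}).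

(** If q = s X^j with j <= k, multiplying q(x) = 0 by x^(k-j) leaves s(0) x^k = 0; hence X divides s
    and j can be increased. *)
Lemma nilpotent_dvd A (x : A) k q :
  x ^+ k.+1 = 0 -> x ^+ k != 0 -> peval x q = 0 -> 'X^(k.+1) %| q.
Proof.
move=> xk1 xk q0; suff gen j : (j <= k.+1)%N -> 'X^j %| q by exact: gen.
elim: j => [|j IH] ltjk; first by rewrite expr0 dvd1p.
have /dvdpP[s sE] := IH (ltnW ltjk).
have sx : peval x s * x ^+ k = 0.
  have -> : k = (j + (k - j))%N by rewrite subnKC.
  rewrite exprD mulrA.
  suff -> : peval x s * x ^+ j = 0 by rewrite mul0r.
  by rewrite -q0 sE rmorphM rmorphXn /= pevalX.
have /factor_theorem[t tE] : root (s - (s.[0])%:P) 0.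
  by rewrite /root !hornerE subrr.
have sxE : peval x s * x ^+ k = s.[0] *: x ^+ k.
  rewrite -[s in LHS](subrK (s.[0])%:P) tE subr0 rmorphD rmorphM /=.
  by rewrite pevalX pevalC mulrDl -mulrA -exprS xk1 mulr0 add0r mulr_algl.
have s0 : s.[0] = 0.
  by apply/eqP; move/eqP: sxE; rewrite sx eq_sym scaler_eq0 (negPf xk) orbF.
by move: tE; rewrite s0 !subr0 => tE; rewrite sE tE -mulrA -exprS dvdp_mull.
Qed.

Section PowerMap.
Variables (A : cfalg R) (x : A) (k : nat).
Hypotheses (xk1 : x ^+ k.+1 = 0) (xk : x ^+ k != 0).

Let h (v : 'rV[R]_k.+1) := peval x (rVpoly v).
Fact power_map_lin : linear h.
Proof.
suff H (a : R) u v : h (a *: u + v) = a *: h u + h v by exact: H.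
by rewrite /h linearP rmorphD /= pevalZ.
Qed.

Fact power_map_inj v : h v = 0 -> v = 0.
Proof.
move=> hv0; have dv := nilpotent_dvd xk1 xk hv0.
rewrite -[v]rVpolyK; have [->|nz] := eqVneq (rVpoly v) 0; first exact: linear0.
have := dvdp_leq nz dv; rewrite size_polyXn => /leq_trans/(_ (size_poly _ _)).
by rewrite ltnn.
Qed.

Lemma nilpotent_le : (k < \dim {:A})%N.
Proof.
have := @inj_linear_dim _ _ _ (mk_linear power_map_lin) power_map_inj.
by rewrite dimvf /dim /= mul1n.
Qed.

Lemma nilpotent_monogenic : \dim {:A} = k.+1 -> monogenic A 'X^(k.+1).
Proof.
move=> dA; exists x; split; rewrite ?monicXn ?size_polyXn ?dA //.
  by rewrite rmorphXn /= pevalX.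
have [g gK Kg] : bijective (mk_linear power_map_lin).
  apply: inj_linear_bij; first exact: power_map_inj.
  by rewrite dA dimvf /dim /= mul1n.
by move=> a; exists (rVpoly (g a)); rewrite -[LHS]Kg.
Qed.

End PowerMap.

Lemma nilpotent_dim A (x : A) : nilpotent x -> x ^+ (\dim {:A}) = 0.
Proof.
case=> k; elim: k => [|k IH] xk; first by rewrite -[LHS]mulr1 -[1 in LHS](expr0 x) xk mulr0.
have [/IH//|nz] := eqVneq (x ^+ k) 0.
by rewrite -(subnKC (nilpotent_le xk nz)) exprD xk mul0r.
Qed.

Lemma out_span A (s : seq A) : (size s < \dim {:A})%N -> exists x, x \notin <<s>>%VS.
Proof.
move=> sA; apply: contrapT => all_in.
have: (fullv <= <<s>>)%VS.
  by apply/subvP=> x _; apply: contrapT => /negP nx; apply: all_in; exists x.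
move/dimvS/leq_trans/(_ (dim_span s)); rewrite leqNgt => /negP; exact.
Qed.

Lemma free_span_full A (s : seq A) : free s -> size s = \dim {:A} -> <<s>>%VS = fullv.
Proof.
move=> fs ss; apply/eqP; rewrite eqEdim subvf /= -ss.
by move: fs; rewrite /free => /eqP->.
Qed.

Lemma span3P A (x y z a : A) :
  a \in <<[:: z; y; x]>>%VS -> exists k : R * R * R, a = k.1.1 *: x + k.1.2 *: y + k.2 *: z.
Proof.
rewrite !span_cons span_nil addv0.
case/memv_addP=> _ /vlineP[k3 ->] [w + ->].
case/memv_addP=> _ /vlineP[k2 ->] [_ /vlineP[k1 ->] ->].
by exists (k1, k2, k3); rewrite addrC [X in X + _]addrC.
Qed.

Lemma span4P A (x y z t a : A) :
  a \in <<[:: t; z; y; x]>>%VS ->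
  exists k : R * R * R * R, a = k.1.1.1 *: x + k.1.1.2 *: y + k.1.2 *: z + k.2 *: t.
Proof.
rewrite span_cons => /memv_addP[_ /vlineP[k4 ->] [w + ->]] => /span3P[[[k1 k2] k3] ->].
by exists (k1, k2, k3, k4); rewrite addrC.
Qed.

End NilpotentPowers.

(** * Algebras determined by a multiplication table *)

Section Presentations.
Variable R : numFieldType.
Implicit Types (A B : cfalg R).

(** The table [m] is shared by both algebras in the coordinates V, so passing through V preserves
    products. *)
Lemma lift_isom (V : vectType R) A B (f : {linear V -> A}) (g : {linear V -> B})
    (m : V -> V -> V) : bijective f -> bijective g ->
  (forall u v, f u * f v = f (m u v)) -> (forall u v, g u * g v = g (m u v)) ->
  alg_isom A B.
Proof.
move=> /bij_linear_inv[f' fK f'K] [g' gK g'K] fM gM.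
exists (g \o f').
  by exists (f \o g') => x /=; rewrite ?gK ?f'K // fK g'K.
by move=> x y /=; rewrite gM -{1}[x]f'K -{1}[y]f'K fM fK.
Qed.

(** Turns scaling into multiplication inside A, so that later computations are identities in a
    commutative ring. *)
Lemma scale_algE A (a : R) (x : A) : a *: x = in_alg A a * x.
Proof. by rewrite /= mulr_algl. Qed.

Let V4 := (R^o * R^o * R^o * R^o)%type.
Let comb4 A (x y z : A) (v : V4) : A :=
  v.1.1.1%:A + v.1.1.2 *: x + v.1.2 *: y + v.2 *: z.

Fact comb4E A (x y z : A) v : comb4 x y z v =
  in_alg A v.1.1.1 + in_alg A v.1.1.2 * x + in_alg A v.1.2 * y + in_alg A v.2 * z.
Proof. by rewrite /= !mulr_algl. Qed.

Fact comb4_lin A (x y z : A) : linear (comb4 x y z).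
Proof.
suff H (a : R) (u v : V4) : comb4 x y z (a *: u + v) = a *: comb4 x y z u + comb4 x y z v by
    exact: H.
move: u v => [[[u1 u2] u3] u4] [[[v1 v2] v3] v4].
rewrite [in RHS]scale_algE [LHS]comb4E [comb4 _ _ _ _ in RHS]comb4E.
rewrite [X in _ = _ + X]comb4E.
change (in_alg A (a * u1 + v1) + in_alg A (a * u2 + v2) * x + in_alg A (a * u3 + v3) * y
  + in_alg A (a * u4 + v4) * z = in_alg A a * (in_alg A u1 + in_alg A u2 * x +
  in_alg A u3 * y + in_alg A u4 * z) +
  (in_alg A v1 + in_alg A v2 * x + in_alg A v3 * y + in_alg A v4 * z)).
by rewrite !rmorphD !rmorphM; ring.
Qed.

Fact comb4_bij A (x y z : A) : \dim {:A} = 4%N ->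
  (forall a, exists k : R * R * R * R, a = k.1.1.1%:A + k.1.1.2 *: x + k.1.2 *: y + k.2 *: z) ->
  bijective (mk_linear (comb4_lin x y z)).
Proof.
move=> dA gen; apply: surj_linear_bij; last by rewrite !dim_pair dA dimvf.
by move=> w; have [k ->] := gen w; exists k.
Qed.

Fact quad_mul A (x y z : A) al be ga :
  [/\ x * x = al *: z, x * y = be *: z & y * y = ga *: z] ->
  [/\ x * z = 0, y * z = 0 & z * z = 0] ->
  forall u v : V4, comb4 x y z u * comb4 x y z v = comb4 x y z
    (u.1.1.1 * v.1.1.1, u.1.1.1 * v.1.1.2 + u.1.1.2 * v.1.1.1,
     u.1.1.1 * v.1.2 + u.1.2 * v.1.1.1,
     u.1.1.1 * v.2 + u.2 * v.1.1.1 + al * (u.1.1.2 * v.1.1.2) +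
     be * (u.1.1.2 * v.1.2 + u.1.2 * v.1.1.2) + ga * (u.1.2 * v.1.2)).
Proof.
move=> [+ + +] [xz yz zz] [[[u1 u2] u3] u4] [[[v1 v2] v3] v4].
rewrite !scale_algE => xx xy yy.
rewrite !comb4E [_.1]/= [_.2]/= !(rmorphD, rmorphM).
set a := in_alg A.
transitivity (a u1 * a v1 + (a u1 * a v2 + a u2 * a v1) * x + (a u1 * a v3 + a u3 * a v1) * y +
  (a u1 * a v4 + a u4 * a v1) * z + a u2 * a v2 * (x * x) + (a u2 * a v3 + a u3 * a v2) * (x * y)
  + a u3 * a v3 * (y * y) + (a u2 * a v4 + a u4 * a v2) * (x * z) +
  (a u3 * a v4 + a u4 * a v3) * (y * z) + a u4 * a v4 * (z * z)); first by ring.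
by rewrite xx xy yy xz yz zz; ring.
Qed.

Lemma quad_isom A B al be ga : quad_alg A al be ga -> quad_alg B al be ga -> alg_isom A B.
Proof.
move=> [dA [x [y [z [gA [mA nA]]]]]] [dB [x' [y' [z' [gB [mB nB]]]]]].
apply: (lift_isom (comb4_bij dA gA) (comb4_bij dB gB)).
  exact: quad_mul mA nA.
exact: quad_mul mB nB.
Qed.

Let V3 := (R^o * R^o * R^o)%type.
Let comb3 A (x y : A) (v : V3) : A := v.1.1%:A + v.1.2 *: x + v.2 *: y.

Fact comb3E A (x y : A) v : comb3 x y v =
  in_alg A v.1.1 + in_alg A v.1.2 * x + in_alg A v.2 * y.
Proof. by rewrite /= !mulr_algl. Qed.

Fact comb3_lin A (x y : A) : linear (comb3 x y).
Proof.
suff H (a : R) (u v : V3) : comb3 x y (a *: u + v) = a *: comb3 x y u + comb3 x y v by exact: H.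
move: u v => [[u1 u2] u3] [[v1 v2] v3].
rewrite [in RHS]scale_algE [LHS]comb3E [comb3 _ _ _ in RHS]comb3E.
rewrite [X in _ = _ + X]comb3E.
change (in_alg A (a * u1 + v1) + in_alg A (a * u2 + v2) * x + in_alg A (a * u3 + v3) * y
  = in_alg A a * (in_alg A u1 + in_alg A u2 * x + in_alg A u3 * y) +
  (in_alg A v1 + in_alg A v2 * x + in_alg A v3 * y)).
by rewrite !rmorphD !rmorphM; ring.
Qed.

Fact comb3_bij A (x y : A) : \dim {:A} = 3%N ->
  (forall a, exists k : R * R * R, a = k.1.1%:A + k.1.2 *: x + k.2 *: y) ->
  bijective (mk_linear (comb3_lin x y)).
Proof.
move=> dA gen; apply: surj_linear_bij; last by rewrite !dim_pair dA dimvf.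
by move=> w; have [k ->] := gen w; exists k.
Qed.

Fact triv3_mul A (x y : A) : [/\ x * x = 0, x * y = 0 & y * y = 0] ->
  forall u v : V3, comb3 x y u * comb3 x y v = comb3 x y
    (u.1.1 * v.1.1, u.1.1 * v.1.2 + u.1.2 * v.1.1, u.1.1 * v.2 + u.2 * v.1.1).
Proof.
move=> [xx xy yy] [[u1 u2] u3] [[v1 v2] v3].
rewrite !comb3E !(rmorphD, rmorphM); set a := in_alg A.
transitivity (a u1 * a v1 + (a u1 * a v2 + a u2 * a v1) * x + (a u1 * a v3 + a u3 * a v1) * y +
  a u2 * a v2 * (x * x) + (a u2 * a v3 + a u3 * a v2) * (x * y)
  + a u3 * a v3 * (y * y)); first by ring.
by rewrite xx xy yy; ring.
Qed.

Lemma triv3_isom A B : triv3_alg A -> triv3_alg B -> alg_isom A B.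
Proof.
move=> [dA [x [y [gA mA]]]] [dB [x' [y' [gB mB]]]].
apply: (lift_isom (comb3_bij dA gA) (comb3_bij dB gB)).
  exact: triv3_mul mA.
exact: triv3_mul mB.
Qed.

End Presentations.

(** * Local algebras of dimension at most 4 *)

Section LocalAlgebras.
Variable R : rcfType.
Implicit Types (A B : cfalg R).

Definition split_local A := forall m : A, exists a : R, nilpotent (m - a%:A).

Lemma double_eq0 A (x : A) : x + x = 0 -> x = 0.
Proof.
by rewrite -mulr2n -scaler_nat => /eqP; rewrite scaler_eq0 pnatr_eq0 => /eqP.
Qed.

(** Subtracting a scalar makes an outside element nilpotent, and keeps it outside because 1 is in
    the span. *)
Lemma local_out A (s : seq A) : split_local A -> 1 \in s -> (size s < \dim {:A})%N ->
  exists2 x, nilpotent x & x \notin <<s>>%VS.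
Proof.
move=> lA s1 /out_span[m ms]; have [a an] := lA m; exists (m - a%:A) => //.
apply: contra ms => ms; rewrite -(subrK a%:A m) memvD // memvZ // memv_span //.
Qed.

(** Polarisation of the squaring map, using that sums of nilpotents are nilpotent. *)
Lemma square_zero_mul A (x y : A) : (forall z : A, nilpotent z -> z * z = 0) ->
  nilpotent x -> nilpotent y -> x * y = 0.
Proof.
move=> sq xn yn; apply: double_eq0.
have -> : x * y + x * y = (x + y) * (x + y) - x * x - y * y by ring.
by rewrite !sq ?subr0 //; apply: nilpotentD.
Qed.

Lemma local2 A : split_local A -> \dim {:A} = 2%N -> monogenic A 'X^2.
Proof.
move=> lA dA; have [||x xn x1] := @local_out A [:: 1] lA; rewrite ?inE ?dA //.
apply: (@nilpotent_monogenic _ _ x) => //; first by rewrite -dA nilpotent_dim.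
rewrite expr1; apply: contraNneq x1 => ->; exact: mem0v.
Qed.

Lemma local3 A : split_local A -> \dim {:A} = 3%N -> monogenic A 'X^3 \/ triv3_alg A.
Proof.
move=> lA dA; have [[x [xn x2]]|sq] := pselect (exists x : A, nilpotent x /\ x * x <> 0).
  left; apply: (@nilpotent_monogenic _ _ x) => //; first by rewrite -dA nilpotent_dim.
  by rewrite expr2; apply/eqP.
have {}sq (z : A) : nilpotent z -> z * z = 0.
  by move=> zn; apply: contrapT => z2; apply: sq; exists z.
right; split=> //.
have [||x xn x1] := @local_out A [:: 1] lA; rewrite ?inE ?dA //.
have [||y yn y1] := @local_out A [:: x; 1] lA; rewrite ?inE ?eqxx ?orbT ?dA //.
have full : <<[:: y; x; 1%R]>>%VS = fullv :> {vspace A}.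
  apply: free_span_full; rewrite ?dA // !free_cons y1 x1 nil_free andbT span_nil memv0.
  exact: oner_neq0.
exists x, y; split; last by rewrite !sq // square_zero_mul.
by move=> a; apply: span3P; rewrite full memvf.
Qed.

(** Rescaling y by the square root of |c| leaves only the sign of c. For c < 0 the form is X^2 -
    W^2, and its null vectors x + w and x - w put it in hyperbolic shape. *)
Lemma quad_normalize A c : quad_alg A 1 0 c ->
  [\/ quad_alg A 1 0 0, quad_alg A 1 0 1 | quad_alg A 0 1 0].
Proof.
move=> qA; have [dA [x [y [z [gen [[xx xy yy] [xz yz zz]]]]]]] := qA.
rewrite scale1r in xx; rewrite scale0r in xy.
have [c_lt0|c_gt0|c0] := ltgtP c 0; last by rewrite c0 in qA; constructor 1.
  constructor 3; split=> //; set r := Num.sqrt (- c).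
  have r2 : r * r = - c by rewrite -expr2 sqr_sqrtr // oppr_ge0; apply: ltW.
  have r0 : r != 0 by rewrite gt_eqF // sqrtr_gt0 oppr_gt0.
  pose w := r^-1 *: y.
  have yw : y = r *: w by rewrite scalerA divff // scale1r.
  have ww : w * w = - z.
    rewrite -scalerAl -scalerAr scalerA yy scalerA -invfM r2 -(opprK c) -[in X in _ * X](opprK c).
    by rewrite opprK mulrN mulVf ?scaleN1r // oppr_eq0 lt_eqF.
  have xw : x * w = 0 by rewrite -scalerAr xy scaler0.
  have wz : w * z = 0 by rewrite -scalerAl yz scaler0.
  (* The third vector is the product of the first two: x x - w w = 2 z. *)
  exists (x + w), (x - w), (2 *: z); split.
    move=> a; have [[[[k1 k2] k3] k4] ->] := gen a.
    exists (k1, 2^-1 * (k2 + k3 * r), 2^-1 * (k2 - k3 * r), 2^-1 * k4) => /=.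
    rewrite yw !scale_algE -!addrA; congr (_ + _).
    rewrite !rmorphM !rmorphD !rmorphN !rmorphM.
    have h2 : in_alg A 2^-1 + in_alg A 2^-1 = 1.
      by rewrite -rmorphD (_ : 2^-1 + 2^-1 = 1) ?rmorph1 //; field.
    set h := in_alg A 2^-1 in h2 *; set a1 := in_alg A.
    transitivity ((h + h) * (a1 k2 * x + a1 k3 * (a1 r * w)) + (h + h) * (a1 k4 * z)).
      by rewrite h2; ring.
    ring.
  split; split; rewrite ?scale0r ?scale1r -?scalerAr -?scalerAl.
  - have -> : (x + w) * (x + w) = x * x + (x * w + x * w) + w * w by ring.
    by rewrite xx ww xw !addr0 subrr.
  - have -> : (x + w) * (x - w) = x * x - w * w by ring.
    by rewrite xx ww opprK -mulr2n scaler_nat.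
  - have -> : (x - w) * (x - w) = x * x - (x * w + x * w) + w * w by ring.
    by rewrite xx ww xw addr0 subr0 subrr.
  - by rewrite mulrDl xz wz addr0 scaler0.
  - by rewrite mulrBl xz wz subr0 scaler0.
  - by rewrite zz !scaler0.
constructor 2; split=> //; set r := Num.sqrt c.
have r2 : r * r = c by rewrite -expr2 sqr_sqrtr // ltW.
have r0 : r != 0 by rewrite gt_eqF // sqrtr_gt0.
pose w := r^-1 *: y.
have yw : y = r *: w by rewrite scalerA divff // scale1r.
exists x, w, z; split.
  move=> a; have [[[[k1 k2] k3] k4] ->] := gen a.
  by exists (k1, k2, k3 * r, k4) => /=; rewrite yw !scalerA.
split; split; rewrite ?scale0r ?scale1r // -?scalerAr -?scalerAl ?xy ?yz ?scaler0 //.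
by rewrite scalerA yy scalerA -invfM r2 mulVf ?scale1r // gt_eqF.
Qed.

Lemma in_span3 A (x y : A) (k1 k2 k3 : R) :
  k1 *: 1 + k2 *: x + k3 *: y \in <<[:: y; x; 1%R]>>%VS.
Proof. by rewrite !memvD // memvZ // memv_span // !inE eqxx ?orbT. Qed.

(** The nilpotency orders decide: a nilpotent of order 4 generates A, and if all squares vanish the
    form is 0. Otherwise X = x * x is nonzero with x * X = 0, and a further nilpotent is corrected
    until x * y = 0, which forces y * y to be a multiple of X. *)
Lemma local4 A : split_local A -> \dim {:A} = 4%N ->
  [\/ monogenic A 'X^4, quad_alg A 0 0 0, quad_alg A 1 0 0 |
      quad_alg A 1 0 1 \/ quad_alg A 0 1 0].
Proof.
move=> lA dA; have [[x [xn x3]]|cu] := pselect (exists x : A, nilpotent x /\ x * x * x <> 0).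
  constructor 1; apply: (@nilpotent_monogenic _ _ x) => //; first by rewrite -dA nilpotent_dim.
  by rewrite !exprSr expr0 mul1r; apply/eqP.
have {}cu (z : A) : nilpotent z -> z * z * z = 0.
  by move=> zn; apply: contrapT => z2; apply: cu; exists z.
have [[x [xn x2]]|sq] := pselect (exists x : A, nilpotent x /\ x * x <> 0); last first.
  have {}sq (z : A) : nilpotent z -> z * z = 0.
    by move=> zn; apply: contrapT => z2; apply: sq; exists z.
  constructor 2; split=> //.
  have [||x xn x1] := @local_out A [:: 1] lA; rewrite ?inE ?dA //.
  have [||y yn y1] := @local_out A [:: x; 1] lA; rewrite ?inE ?eqxx ?orbT ?dA //.
  have [||z zn z1] := @local_out A [:: y; x; 1] lA; rewrite ?inE ?eqxx ?orbT ?dA //.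
  have full : <<[:: z; y; x; 1%R]>>%VS = fullv :> {vspace A}.
    apply: free_span_full; rewrite ?dA // !free_cons z1 y1 x1 nil_free andbT span_nil memv0.
    exact: oner_neq0.
  exists x, y, z; split; first by move=> a; apply: span4P; rewrite full memvf.
  by rewrite !scale0r !sq // !square_zero_mul.
suff [c /quad_normalize[q|q|q]] : exists c, quad_alg A 1 0 c.
- by constructor 3.
- by constructor 4; left.
- by constructor 4; right.
have x30 := cu x xn; set X := x * x in x2 x30.
have X0 c : c *: X = 0 -> c = 0.
  by move/eqP; rewrite scaler_eq0 => /orP[/eqP//|/eqP/x2].
have xX : x * X = 0 by rewrite mulrC.
have XX : X * X = 0 by rewrite mulrA x30 mul0r.
have Xn : nilpotent X by apply: nilpotentMl.
have x_out : x \notin <<[:: 1%R : A]>>%VS.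
  rewrite span_seq1; apply/negP=> /vlineP[c xc].
  have c0 : c = 0 by apply: (@nilpotent_scal _ A); rewrite -xc.
  by apply: x2; rewrite /X xc c0 scale0r mul0r.
have X_out : X \notin <<[:: x; 1%R]>>%VS.
  rewrite span_cons span_seq1; apply/negP=> /memv_addP[_ /vlineP[a ->] [_ /vlineP[b ->] E]].
  have b0 : b = 0.
    apply: (@nilpotent_scal _ A); have -> : b%:A = X - a *: x by rewrite E addrC addKr.
    by apply: nilpotentB => //; apply: nilpotentZ.
  have a0 : a = 0.
    by apply: X0; rewrite [in LHS]/X scalerAl -[a *: x]addr0 -{1}(scale0r (1 : A)) -{1}b0 -E
        mulrC.
  by apply: x2; rewrite -/X E a0 b0 !scale0r addr0.
have full y : y \notin <<[:: X; x; 1%R]>>%VS -> <<[:: y; X; x; 1%R]>>%VS = fullv :> {vspace A}.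
  move=> y_out; apply: free_span_full; rewrite ?dA // !free_cons y_out X_out x_out nil_free
      andbT span_nil memv0.
  exact: oner_neq0.
have [||y0 y0n y0_out] := @local_out A [:: X; x; 1] lA; rewrite ?inE ?eqxx ?orbT ?dA //.
have [y [yn y_out xy]] : exists y : A, [/\ nilpotent y, y \notin <<[:: X; x; 1%R]>>%VS & x *
    y = 0].
  have [[[[a b] c] d] /= E] : exists k : R * R * R * R,
      x * y0 = k.1.1.1 *: 1 + k.1.1.2 *: x + k.1.2 *: X + k.2 *: y0.
    by apply: span4P; rewrite full ?memvf.
  have a0 : a = 0.
    apply: (@nilpotent_scal _ A).
    have -> : a%:A = x * y0 - b *: x - c *: X - d *: y0 by rewrite E; ring.
    by do 3?apply: nilpotentB; try apply: nilpotentZ => //; apply: nilpotentMl.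
  rewrite a0 scale0r add0r in E.
  have d0 : d = 0.
    apply: contrapT => /eqP d0; move/negP: y0_out; apply.
    (* The relation reads (x - d) y0 = b x + c X. As x^3 = 0, the inverse of x - d is -(1/d) (1 +
       x/d + X/d^2), which gives these coefficients. *)
    suff -> : y0 = 0 *: 1 + (- b / d) *: x + (- b / d ^+ 2 - c / d) *: X by apply: in_span3.
    apply: (scalerI (expf_neq0 3 d0)).
    have -> : d ^+ 3 *: y0 = - ((b * d ^+ 2) *: x + (b * d + c * d ^+ 2) *: X).
      move: E; rewrite !scale_algE !(rmorphD, rmorphM, rmorphXn); set al := in_alg A => E.
      have -> : al d ^+ 3 * y0 = X * x * y0 - (x * y0 - al d * y0) * (X + al d * x + al d ^+ 2).
        by rewrite /X; ring.
      rewrite x30 E; transitivity (- (al b * x * (al d ^+ 2) + (al b * al d + al c * al d ^+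
          2) * X
        + (al b + al c * al d) * (x * X) + al c * (X * X))); first by rewrite /X; ring.
      by rewrite xX XX; ring.
    by rewrite scale0r add0r scalerDr !scalerA opprD -!scaleNr; congr (_ *: _ + _ *: _); field.
  rewrite d0 scale0r addr0 in E.
  (* Multiplying by x gives y0 X = b X, so b is an eigenvalue of a nilpotent operator. *)
  have b0 : b = 0.
    have E1 : y0 * X = b *: X.
      have -> : y0 * X = x * (x * y0) by rewrite /X; ring.
      by rewrite E mulrDr -!scalerAr xX scaler0 addr0.
    have E4 k : y0 ^+ k * X = b ^+ k *: X.
      elim: k => [|k IH]; first by rewrite !expr0 mul1r scale1r.
      by rewrite exprSr -mulrA E1 -scalerAr IH scalerA -exprS.
    have y4 : y0 ^+ 4 = 0 by rewrite -dA nilpotent_dim.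
    have := E4 4%N; rewrite y4 mul0r => /esym/X0/eqP.
    by rewrite expf_eq0 => /eqP.
  rewrite b0 scale0r add0r in E.
  (* What remains is x y0 = c X = x (c x). *)
  exists (y0 - c *: x); split.
  - by apply: nilpotentB => //; apply: nilpotentZ.
  - apply: contra y0_out => yin; rewrite -(subrK (c *: x) y0) memvD // memvZ //.
    by rewrite memv_span // !inE eqxx ?orbT.
  - by rewrite mulrBr E -scalerAr subrr.
have [[[[a b] c] d] /= E] : exists k : R * R * R * R,
    y * y = k.1.1.1 *: 1 + k.1.1.2 *: x + k.1.2 *: X + k.2 *: y.
  by apply: span4P; rewrite full ?memvf.
have a0 : a = 0.
  apply: (@nilpotent_scal _ A).
  have -> : a%:A = y * y - b *: x - c *: X - d *: y by rewrite E; ring.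
  by do 3?apply: nilpotentB; try apply: nilpotentZ => //; apply: nilpotentMl.
rewrite a0 scale0r add0r in E.
have b0 : b = 0.
  have : x * (y * y) = 0 by rewrite mulrA xy mul0r.
  by rewrite E !mulrDr -!scalerAr xX xy !scaler0 !addr0 => /X0.
rewrite b0 scale0r add0r in E.
have Xy : X * y = 0 by rewrite -mulrA xy mulr0.
(* As X y = 0, the relation y^3 = 0 reads d y^2 = 0. If d were nonzero, y^2 would vanish and y would
   be a multiple of X. *)
have d0 : d = 0.
  apply: contrapT => /eqP d0; have := cu y yn.
  rewrite {1}E mulrDl -!scalerAl Xy scaler0 add0r => /eqP.
  rewrite scaler_eq0 (negPf d0) => /= /eqP yy0.
  move/negP: y_out; apply.
  suff -> : y = 0 *: 1 + 0 *: x + (- c / d) *: X by apply: in_span3.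
  apply: (scalerI d0); rewrite !scale0r !add0r scalerA mulrCA divff // mulr1 scaleNr.
  by apply/eqP; rewrite -addr_eq0 addrC -E yy0.
rewrite d0 scale0r addr0 in E.
exists c; split=> //; exists x, y, X; split; last first.
  by split; split; rewrite ?scale0r ?scale1r // mulrC.
move=> u; have [[[[k1 k2] k3] k4] uE] : exists k : R * R * R * R,
    u = k.1.1.1 *: 1 + k.1.1.2 *: x + k.1.2 *: X + k.2 *: y.
  by apply: span4P; rewrite full ?memvf.
by exists (k1, k2, k4, k3); rewrite uE /= addrAC.
Qed.

End LocalAlgebras.

(** * Algebras containing a square root of -1 *)

Section ComplexAlgebras.
Variables (R : rcfType) (A : cfalg R) (i : A).
Hypothesis ii : i * i = -1.

(** Multiplying by the conjugate leaves the norm a^2 + b^2, a sum of real squares. *)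
Lemma cplx_indep (a b : R) : a%:A + b *: i = 0 -> a = 0 /\ b = 0.
Proof.
move=> E; have : (a ^+ 2 + b ^+ 2)%:A = 0 :> A.
  rewrite -[LHS]/(in_alg A _) rmorphD !rmorphXn.
  transitivity ((in_alg A a + in_alg A b * i) * (in_alg A a - in_alg A b * i)); last first.
    by rewrite -scale_algE [in_alg A a + _]E mul0r.
  transitivity (in_alg A a ^+ 2 - in_alg A b ^+ 2 * (i * i)); last by ring.
  by rewrite ii; ring.
move/scal_inj/eqP; rewrite paddr_eq0 ?sqr_ge0 // !sqrf_eq0.
by case/andP=> /eqP-> /eqP->.
Qed.

Lemma cplx_nilpotent (a b : R) : nilpotent (a%:A + b *: i) -> a%:A + b *: i = 0.
Proof.
move=> n; have : nilpotent ((a ^+ 2 + b ^+ 2)%:A : A).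
  have -> : (a ^+ 2 + b ^+ 2)%:A = (a%:A - b *: i) * (a%:A + b *: i) :> A.
    rewrite !scale_algE mulr1 rmorphD !rmorphXn.
    transitivity (in_alg A a ^+ 2 - in_alg A b ^+ 2 * (i * i)); last by ring.
    by rewrite ii; ring.
  exact: nilpotentMl.
move/nilpotent_scal/eqP; rewrite paddr_eq0 ?sqr_ge0 // !sqrf_eq0.
by case/andP=> /eqP-> /eqP->; rewrite !scale0r addr0.
Qed.

Lemma cplx_spanP a : a \in <<[:: i; 1%R]>>%VS -> exists k : R * R, a = k.1%:A + k.2 *: i.
Proof.
rewrite span_cons span_seq1 => /memv_addP[_ /vlineP[b ->] [_ /vlineP[c ->] ->]].
by exists (c, b); rewrite addrC.
Qed.

Lemma mem_cplx_span (a b : R) : a%:A + b *: i \in <<[:: i; 1%R]>>%VS.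
Proof. by rewrite memvD // memvZ // memv_span // !inE eqxx ?orbT. Qed.

Lemma cplx_free2 : free [:: i; 1].
Proof.
rewrite !free_cons nil_free andbT span_nil memv0 oner_neq0 andbT span_seq1.
apply/negP=> /vlineP[c ic]; have [|_ /eqP] := @cplx_indep (- c) 1.
  by rewrite scale1r scaleNr ic addNr.
by rewrite oner_eq0.
Qed.

(** A relation i y = a + b i + c y means (i - c) y = a + b i. Since (c - i) (c + i) = c^2 + 1, the
    factor i - c is invertible in C and y would lie in C. *)
Lemma cplx_free4 y : y \notin <<[:: i; 1%R]>>%VS -> free [:: i * y; y; i; 1].
Proof.
move=> y_out; rewrite free_cons [free (y :: _)]free_cons y_out cplx_free2 !andbT.
apply/negP=> /span3P[[[a b] c] /= E]; move/negP: y_out; apply.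
have nz : 1 + c ^+ 2 != 0 by rewrite gt_eqF // ltr_pwDl ?ltr01 // sqr_ge0.
suff -> : y = ((b - a * c) / (1 + c ^+ 2))%:A + (- (a + b * c) / (1 + c ^+ 2)) *: i.
  exact: mem_cplx_span.
apply: (scalerI nz); rewrite scalerDr !scalerA !(mulrCA (1 + c ^+ 2)) !divff // !mulr1.
move: E; rewrite !scale_algE !mulr1 => E.
rewrite !(rmorphB, rmorphD, rmorphN, rmorphM, rmorphXn, rmorph1); set al := in_alg A in E *.
transitivity (- (i * i) * y + al c ^+ 2 * y); first by rewrite ii; ring.
transitivity (- (i + al c) * (i * y - al c * y)); first by ring.
rewrite E; transitivity (- (al a * al c) - (al a + al b * al c) * i - al b * (i * i)).
  by ring.
by rewrite ii; ring.
Qed.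

Lemma free_le (s : seq A) : free s -> (size s <= \dim {:A})%N.
Proof. by rewrite /free => /eqP <-; rewrite dimvS ?subvf. Qed.

Lemma cplx2 : \dim {:A} = 2%N -> monogenic A ('X^2 + 1).
Proof.
move=> dA; exists i; split.
- by rewrite monicE lead_coefDl ?lead_coefXn // size_polyXn size_poly1.
- by rewrite size_polyDl size_polyXn ?size_poly1 // dA.
- by rewrite rmorphD rmorphXn /= pevalX rmorph1 expr2 ii addNr.
move=> a; have [k ->] : exists k : R * R, a = k.1%:A + k.2 *: i.
  by apply: cplx_spanP; rewrite free_span_full ?memvf ?dA ?cplx_free2.
by exists (k.1%:P + k.2 *: 'X); rewrite rmorphD /= pevalC pevalZ pevalX.
Qed.

Lemma csqrt (a b : R) : exists c d : R, c * c - d * d = a /\ c * d + d * c = b.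
Proof.
have := sqr_sqrtc (a +i* b)%C; rewrite expr2; case: (sqrtc _) => c d; simpc => -[ca cb].
by exists c, d.
Qed.

(** A is a plane over C = R[i], so an element outside C satisfies a monic quadratic equation over C.
    Completing the square gives z^2 = w^2 with w in C; connectedness makes z - w and z + w
    nilpotent, so w, half their difference, is 0. *)
Lemma cplx4 : connected A -> \dim {:A} = 4%N -> monogenic A (('X^2 + 1) ^+ 2).
Proof.
move=> cA dA; have [y0 y0_out] : exists y : A, y \notin <<[:: i; 1%R]>>%VS.
  by apply: out_span; rewrite dA.
have full y : y \notin <<[:: i; 1%R]>>%VS -> <<[:: (i * y)%R; y; i; 1%R]>>%VS = fullv :>
    {vspace A}.
  by move=> y_out; rewrite free_span_full ?cplx_free4 // dA.
have [y [y_out yy]] : exists y : A, y \notin <<[:: i; 1%R]>>%VS /\ y * y = 0.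
  have [[[[a b] c] d] /= E] : exists k : R * R * R * R,
      y0 * y0 = k.1.1.1 *: 1 + k.1.1.2 *: i + k.1.2 *: y0 + k.2 *: (i * y0).
    by apply: span4P; rewrite full ?memvf.
  pose z := y0 - ((c / 2)%:A + (d / 2) *: i).
  have z_out : z \notin <<[:: i; 1%R]>>%VS.
    apply: contra y0_out => zin; rewrite -(subrK ((c / 2)%:A + (d / 2) *: i) y0).
    by rewrite memvD // mem_cplx_span.
  exists z; split=> //.
  (* w is a square root in C of (a + b i) + ((c + d i) / 2)^2. *)
  have [w1 [w2 [E1 E2]]] := csqrt (a + (c / 2) ^+ 2 - (d / 2) ^+ 2) (b + c * d / 2).
  pose w := w1%:A + w2 *: i : A.
  have zz : z * z = w * w.
    move: E; rewrite /z /w !scale_algE !mulr1 => E.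
    have ww : (in_alg A w1 + in_alg A w2 * i) * (in_alg A w1 + in_alg A w2 * i) =
        in_alg A (a + (c / 2) ^+ 2 - (d / 2) ^+ 2) + in_alg A (b + c * d / 2) * i.
      rewrite -E1 -E2 !(rmorphB, rmorphD, rmorphM).
      transitivity (in_alg A w1 * in_alg A w1 + in_alg A w2 * in_alg A w2 * (i * i) +
        (in_alg A w1 * in_alg A w2 + in_alg A w2 * in_alg A w1) * i); first by ring.
      by rewrite ii; ring.
    have c2 : in_alg A c = in_alg A (c / 2) + in_alg A (c / 2).
      by rewrite -rmorphD; congr (in_alg A _); field.
    have d2 : in_alg A d = in_alg A (d / 2) + in_alg A (d / 2).
      by rewrite -rmorphD; congr (in_alg A _); field.
    rewrite ww; have -> : in_alg A (b + c * d / 2) = in_alg A b + (in_alg A (c / 2) * in_alg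
        A (d / 2) *+ 2).
      by rewrite -rmorphM -rmorphMn -rmorphD; congr (in_alg A _); field.
    transitivity (y0 * y0 - (in_alg A (c / 2) + in_alg A (c / 2)) * y0 -
      (in_alg A (d / 2) + in_alg A (d / 2)) * (i * y0) + in_alg A (c / 2) ^+ 2 +
      in_alg A (c / 2) * in_alg A (d / 2) *+ 2 * i + in_alg A (d / 2) ^+ 2 * (i * i)).
      by ring.
    by rewrite E ii -c2 -d2 !(rmorphB, rmorphD, rmorphXn); ring.
  have wN : - w = (- w1)%:A + (- w2) *: i by rewrite opprD !scaleNr.
  have fac : (z - w) * (z + w) = 0.
    have -> : (z - w) * (z + w) = z * z - w * w by ring.
    by rewrite zz subrr.
  (* If z - w were invertible, the other factor z + w would be 0 and z would lie in C. *)
  have n1 : nilpotent (z - w).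
    have [//|[u uE]] := fitting (z - w) cA.
    case/negP: z_out; rewrite (_ : z = - w); first by rewrite wN mem_cplx_span.
    apply/eqP; rewrite -addr_eq0; apply/eqP.
    by rewrite -[LHS]mul1r -uE mulrAC fac mul0r.
  have n2 : nilpotent (z + w).
    have [//|[u uE]] := fitting (z + w) cA.
    case/negP: z_out; rewrite (_ : z = w); first by rewrite mem_cplx_span.
    apply/eqP; rewrite -subr_eq0; apply/eqP.
    by rewrite -[LHS]mulr1 -uE mulrA fac mul0r.
  suff w0 : w = 0 by rewrite zz w0 mul0r.
  apply: cplx_nilpotent; rewrite -/w.
  have -> : w = 2^-1 *: ((z + w) - (z - w)).
    have -> : (z + w) - (z - w) = w *+ 2 by ring.
    by rewrite -scaler_nat scalerA mulVf ?pnatr_eq0 // scale1r.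
  by apply/nilpotentZ/nilpotentB.
have mE : (i + y) * (i + y) + 1 = i * y *+ 2.
  by transitivity (i * i + i * y *+ 2 + y * y + 1); [ring | rewrite ii yy; ring].
(* For m = i + y one has m^2 + 1 = 2 i y, so -(1/2) m (m^2 + 1) = y: both y and i are polynomials in
   m. *)
pose Y : {poly R} := - (2^-1)%:P * ('X * ('X^2 + 1)).
have YE : peval (i + y) Y = y.
  rewrite !rmorphM rmorphN rmorphD rmorph1 rmorphXn /= pevalX pevalC expr2 mE.
  have h2 : in_alg A 2^-1 + in_alg A 2^-1 = 1.
    by rewrite -rmorphD (_ : 2^-1 + 2^-1 = 1) ?rmorph1 //; field.
  rewrite scale_algE mulr1.
  transitivity (- (in_alg A 2^-1 + in_alg A 2^-1) * ((i * i) * y + i * (y * y))).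
    by ring.
  by rewrite ii yy h2; ring.
have mX : ('X^2 + 1 : {poly R}) \is monic.
  by rewrite monicE lead_coefDl ?lead_coefXn // size_polyXn size_poly1.
exists (i + y); split.
- by rewrite monic_exp.
- by rewrite expr2 size_monicM ?monic_neq0 // size_polyDl size_polyXn ?size_poly1 // dA.
- rewrite rmorphXn rmorphD rmorph1 rmorphXn /= pevalX [(i + y) ^+ 2]expr2 mE.
  have -> : (i * y *+ 2) ^+ 2 = i * i * (y * y) *+ 4 by ring.
  by rewrite yy mulr0 mul0rn.
move=> a; have [k ->] : exists k : R * R * R * R,
    a = k.1.1.1 *: 1 + k.1.1.2 *: i + k.1.2 *: y + k.2 *: (i * y).
  by apply: span4P; rewrite full ?memvf.
exists (k.1.1.1%:P + k.1.1.2 *: ('X - Y) + k.1.2 *: Y + k.2 *: (('X - Y) * Y)).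
clearbody Y.
by rewrite !rmorphD /= !pevalZ rmorphM rmorphB /= pevalC YE pevalX !addrK rmorphB /= pevalX
    YE addrK.
Qed.

End ComplexAlgebras.

(** * The corner of an idempotent *)

Section Corner.
Variables (R : fieldType) (A : cfalg R) (e : A).
Hypotheses (ee : e * e = e) (e0 : e != 0).

Fact corner_lin : linear (fun x : A => x - e * x).
Proof.
suff H (a : R) (x y : A) : a *: x + y - e * (a *: x + y) = a *: (x - e * x) + (y - e * y) by
    exact: H.
by rewrite mulrDr -scalerAr scalerBr opprD addrACA.
Qed.

Definition corner_space : {vspace A} := lker (linfun (mk_linear corner_lin)).
Local Notation U := corner_space.

Fact corner_memP x : reflect (e * x = x) (x \in U).
Proof. by rewrite memv_ker lfunE /= subr_eq0 eq_sym; apply: eqP. Qed.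

Fact corner_memM x y : x \in U -> x * y \in U.
Proof. by move/corner_memP=> ex; apply/corner_memP; rewrite mulrA ex. Qed.

Fact corner_mem_e : e \in U.
Proof. exact/corner_memP. Qed.

Let cact (u w : subvs_of U) : subvs_of U := vsproj U (vsval u * vsval w).
Fact cactE u w : vsval (cact u w) = vsval u * vsval w.
Proof. by rewrite vsprojK // corner_memM // subvsP. Qed.
Fact cact_linl w : linear (cact^~ w).
Proof.
suff H (a : R) x y : cact (a *: x + y) w = a *: cact x w + cact y w by exact: H.
by apply: subvs_inj; rewrite linearP /= !cactE linearP /= mulrDl -scalerAl.
Qed.
Fact cact_linr u : linear (cact u).
Proof.
suff H (a : R) x y : cact u (a *: x + y) = a *: cact u x + cact u y by exact: H.
by apply: subvs_inj; rewrite linearP /= !cactE linearP /= mulrDr -scalerAr.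
Qed.
Fact cact_comm u v w : cact u (cact v w) = cact v (cact u w).
Proof. by apply: subvs_inj; rewrite !cactE mulrCA. Qed.
Fact cact_faithful u : (forall w, cact u w = 0) -> u = 0.
Proof.
move=> /(_ (vsproj U e))/(congr1 vsval); rewrite cactE vsprojK ?corner_mem_e //.
by rewrite mulrC (corner_memP _ (subvsP u)) => uE; apply: subvs_inj.
Qed.
Fact cact_closed u v : exists x, forall w, cact x w = cact u (cact v w).
Proof. by exists (cact u v) => w; apply: subvs_inj; rewrite !cactE mulrA. Qed.
Fact cact_unit : exists x, forall w, cact x w = w.
Proof.
exists (vsproj U e) => w; apply: subvs_inj.
by rewrite cactE vsprojK ?corner_mem_e // (corner_memP _ (subvsP w)).
Qed.
Fact cact_dim : (0 < \dim {:subvs_of U})%N.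
Proof.
rewrite lt0n dimv_eq0; apply: contra_neqN e0 => /eqP U0.
have := memvf (vsproj U e); rewrite U0 memv0 => /eqP/(congr1 vsval).
by rewrite vsprojK ?corner_mem_e.
Qed.

(** The ideal e A has unit e rather than 1, so its algebra structure is rebuilt from its faithful
    action on itself. *)
Definition corner : cfalg R := act_alg
  (FaithfulAction cact_linl cact_linr cact_comm cact_faithful cact_closed cact_unit cact_dim).

Definition corner_val (x : corner) : A := vsval (x : subvs_of U).
Definition corner_proj (a : A) : corner := vsproj U (e * a).

Lemma corner_projK a : corner_val (corner_proj a) = e * a.
Proof. by rewrite /corner_val vsprojK // corner_memM // corner_mem_e. Qed.

Lemma corner_val_inj : injective corner_val.
Proof. exact: subvs_inj. Qed.

Lemma corner_valE x : e * corner_val x = corner_val x.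
Proof. exact: (corner_memP _ (subvsP (x : subvs_of U))). Qed.

(** The product of a corner is known only through its action, so it is evaluated on the unit e. *)
Lemma corner_valM x y : corner_val (x * y) = corner_val x * corner_val y.
Proof.
have := congr1 vsval (act_algM x y (vsproj U e)).
rewrite /= !cactE !vsprojK ?corner_mem_e // => E.
by rewrite -[LHS]corner_valE mulrC [LHS]E mulrA mulrC -[X in _ = X * _]corner_valE mulrA.
Qed.

Lemma corner_valP (a : R) x y : corner_val (a *: x + y) = a *: corner_val x + corner_val y.
Proof. exact: linearP. Qed.

End Corner.

Lemma idempotent_split (R : fieldType) (A : cfalg R) (e : A) :
  e * e = e -> e <> 0 -> e <> 1 ->
  exists A1 A2 : cfalg R, alg_isom A (prod_alg A1 A2).
Proof.
move=> ee /eqP e0 /eqP e1; pose f := 1 - e.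
have ff : f * f = f.
  by rewrite /f mulrBl mul1r mulrBr mulr1 ee subrr subr0.
have f0 : f != 0 by rewrite subr_eq0 eq_sym.
have ef : e * f = 0 by rewrite /f mulrBr mulr1 ee subrr.
pose g (a : A) : prod_alg (corner ee e0) (corner ff f0) :=
  (corner_proj ee e0 a, corner_proj ff f0 a).
exists (corner ee e0), (corner ff f0).
have g_lin : linear g.
  suff H (a : R) x y : g (a *: x + y) = a *: g x + g y by exact: H.
  by congr pair; apply: corner_val_inj; rewrite corner_valP !corner_projK mulrDr -scalerAr.
exists (mk_linear g_lin).
  exists (fun u => corner_val u.1 + corner_val u.2) => [a|[u v]] /=.
    by rewrite !corner_projK -mulrDl addrC subrK mul1r.
  have eu : f * corner_val u = 0 by rewrite -corner_valE mulrA (mulrC f) ef mul0r.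
  have fv : e * corner_val v = 0 by rewrite -corner_valE mulrA ef mul0r.
  congr pair; apply: corner_val_inj; rewrite corner_projK mulrDr corner_valE.
    by rewrite fv addr0.
  by rewrite eu add0r.
move=> x y; congr pair; apply: corner_val_inj; rewrite corner_valM !corner_projK.
  by rewrite mulrACA ee.
by rewrite mulrACA ff.
Qed.

(** * Classification *)

Section Classification.
Variable R : rcfType.
Implicit Types (A B : cfalg R) (L : lieAlgType R).
Local Notation aff := (aff_real R).
Local Notation affC := (aff_complex R).

Lemma dim_alg_gt0 A : (0 < \dim {:A})%N.
Proof.
rewrite lt0n dimv_eq0; apply/eqP=> A0; have := memvf (1 : A).
by rewrite A0 memv0 oner_eq0.
Qed.

Lemma model_isom L A (P : cfalg R -> Prop) :
  (exists2 B, lie_isom L (coadj B) & P B) -> P A ->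
  (forall B, P A -> P B -> alg_isom A B) -> lie_isom (coadj A) L.
Proof.
case=> B LB PB PA iso; apply: lie_isom_trans (lie_isom_sym LB).
exact: coadj_isom (iso B PA PB).
Qed.

Lemma monogenic_model L A p :
  (exists2 B, lie_isom L (coadj B) & monogenic B p) -> monogenic A p ->
  lie_isom (coadj A) L.
Proof. by move=> LB Ap; apply: model_isom LB Ap _ => B; apply: monogenic_isom. Qed.

Lemma quad_model_isom L A a b c :
  (exists2 B, lie_isom L (coadj B) & quad_alg B a b c) -> quad_alg A a b c ->
  lie_isom (coadj A) L.
Proof.
by move=> LB Ap; apply: (@model_isom _ _ (fun B => quad_alg B a b c)) => // B; apply: quad_isom.
Qed.

(** If no m - a is nilpotent, [residue] makes some (m - a)^2 + b^2 nilpotent; then u = (m - a) / b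
    has u^2 + 1 nilpotent, and [lift_i] corrects u to a root of -1. *)
Lemma connected_cases A : connected A -> split_local A \/ exists i : A, i * i = -1.
Proof.
move=> cA; have [lA|nl] := pselect (split_local A); [by left | right].
have [m mn] : exists m : A, forall a, ~ nilpotent (m - a%:A).
  apply: contrapT => nm; apply: nl => m; apply: contrapT => na; apply: nm.
  by exists m => a an; apply: na; exists a.
have [[a /mn//]|[a [b [b0 bn]]]] := residue m cA.
apply: (@lift_i _ _ (b^-1 *: (m - a%:A))).
have -> : b^-1 *: (m - a%:A) * (b^-1 *: (m - a%:A)) + 1 =
    (b^-1 ^+ 2) *: ((m - a%:A) ^+ 2 + (b ^+ 2)%:A).
  by rewrite -scalerAl -scalerAr scalerA -!expr2 scalerDr scalerA -exprMn mulVf // expr1n scale1r.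
exact: nilpotentZ.
Qed.

(** The factors are ordered by dimension and the larger one comes first in the sum, as is usual in
    the lists to be matched. *)
Lemma connected_or_split A : connected A \/ exists A1 A2,
  [/\ (\dim {:A1} <= \dim {:A2})%N, \dim {:A} = (\dim {:A1} + \dim {:A2})%N &
      lie_isom (coadj A) (coadj A2 \oplus coadj A1)].
Proof.
have [cA|nc] := pselect (connected A); [by left | right].
have [e [ee e0 e1]] : exists e : A, [/\ e * e = e, e <> 0 & e <> 1].
  apply: contrapT => ne; apply: nc => e ee.
  have [->|/eqP e0] := eqVneq e 0; first by left.
  have [->|/eqP e1] := eqVneq e 1; first by right.
  by case: ne; exists e.
have [A1 [A2 isoA]] := idempotent_split ee e0 e1.
have dA : \dim {:A} = (\dim {:A1} + \dim {:A2})%N.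
  by case: isoA => f /bij_linear_dim-> _; rewrite dim_pair.
have iso12 : lie_isom (coadj A) (coadj A1 \oplus coadj A2).
  exact: lie_isom_trans (coadj_isom isoA) (lie_isom_sym (coadj_prod A1 A2)).
have [le12|/ltnW le21] := leqP (\dim {:A1}) (\dim {:A2}).
  by exists A1, A2; split=> //; apply: lie_isom_trans iso12 (dsumC _ _).
by exists A2, A1; split=> //; rewrite dA addnC.
Qed.

Lemma classify1 A : \dim {:A} = 1%N -> lie_isom (coadj A) aff.
Proof. by move/dim1_monogenic/(monogenic_model (aff_real_model R)). Qed.

(** An element y outside C brings i y with it, so a third dimension entails a fourth. *)
Lemma cplx_dim3 A (i : A) : i * i = -1 -> \dim {:A} <> 3%N.
Proof.
move=> ii dA; have [|y y_out] := @out_span _ A [:: i; 1]; first by rewrite dA.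
by have := free_le (cplx_free4 ii y_out); rewrite dA.
Qed.

Lemma dsum_isom3 L L1 L2 L1' L2' : lie_isom L (L1 \oplus L2) ->
  lie_isom L1 L1' -> lie_isom L2 L2' -> lie_isom L (L1' \oplus L2').
Proof. by move=> LL L11 L22; apply: lie_isom_trans LL (dsum_isom L11 L22). Qed.

Lemma classify2 A : \dim {:A} = 2%N ->
  [\/ lie_isom (coadj A) (aff \oplus aff), lie_isom (coadj A) (D0 R 2) |
      lie_isom (coadj A) affC].
Proof.
move=> dA; have [cA|[A1 [A2 [le12 d12 iso]]]] := connected_or_split A.
  have [lA|[i ii]] := connected_cases cA.
    by constructor 2; apply: monogenic_model (D0_model R 1) (local2 lA dA).
  by constructor 3; apply: monogenic_model (aff_complex_model R) (cplx2 ii dA).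
have := dim_alg_gt0 A1; have := dim_alg_gt0 A2 => d2 d1.
by constructor 1; apply: dsum_isom3 iso _ _; apply: classify1; lia.
Qed.

Lemma classify3 A : \dim {:A} = 3%N ->
  [\/ lie_isom (coadj A) (D0 R 3), lie_isom (coadj A) (Gn1 R 3),
      lie_isom (coadj A) (aff \oplus aff \oplus aff) |
      lie_isom (coadj A) (D0 R 2 \oplus aff) \/ lie_isom (coadj A) (affC \oplus aff)].
Proof.
move=> dA; have [cA|[A1 [A2 [le12 d12 iso]]]] := connected_or_split A.
  have [lA|[i /cplx_dim3//]] := connected_cases cA.
  have [Am|At] := local3 lA dA.
    by constructor 1; apply: monogenic_model (D0_model R 2) Am.
  by constructor 2; apply: model_isom (G31_model R) At _ => B; apply: triv3_isom.
have := dim_alg_gt0 A1; have := dim_alg_gt0 A2 => d2 d1.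
have iso1 : lie_isom (coadj A1) aff by apply: classify1; lia.
have [|iso2|iso2|iso2] := @classify2 A2; first by lia.
- by constructor 3; apply: dsum_isom3 iso iso2 iso1.
- by constructor 4; left; apply: dsum_isom3 iso iso2 iso1.
- by constructor 4; right; apply: dsum_isom3 iso iso2 iso1.
Qed.

Definition dim6_list : seq (lieAlgType R) :=
  [:: aff; D0 R 2; affC; D0 R 3; Gn1 R 3;
      aff \oplus aff; D0 R 2 \oplus aff; affC \oplus aff;
      aff \oplus aff \oplus aff].

Definition cyclic_list : seq (lieAlgType R) :=
  [:: D01 R; D0 R 4; D0 R 3 \oplus aff; D0 R 2 \oplus D0 R 2;
      D0 R 2 \oplus affC; D0 R 2 \oplus aff \oplus aff; affC \oplus affC;
      affC \oplus aff \oplus aff; aff \oplus aff \oplus aff \oplus aff].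

Definition noncyclic_list : seq (lieAlgType R) :=
  [:: Gn1 R 4; h42 R; h43 R; G44' R; Gn1 R 3 \oplus aff].

Definition dim8_list := cyclic_list ++ noncyclic_list.

Lemma classify4 A : \dim {:A} = 4%N ->
  exists2 i, (i < 14)%N & lie_isom (coadj A) (nth aff dim8_list i).
Proof.
move=> dA; have [cA|[A1 [A2 [le12 d12 iso]]]] := connected_or_split A.
  have [lA|[i ii]] := connected_cases cA; last first.
    by exists 0%N => //; apply: monogenic_model (D01_model R) (cplx4 ii cA dA).
  case: (local4 lA dA) => [Am|q|q|[q|q]].
  - by exists 1%N => //; apply: monogenic_model (D0_model R 3) Am.
  - by exists 9%N => //; apply: quad_model_isom (G41_model R) q.
  - by exists 10%N => //; apply: quad_model_isom (h42_model R) q.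
  - by exists 11%N => //; apply: quad_model_isom (h43_model R) q.
  - by exists 12%N => //; apply: quad_model_isom (G44'_model R) q.
have := dim_alg_gt0 A1; have := dim_alg_gt0 A2 => d2 d1.
have [dA1|dA1] : \dim {:A1} = 1%N \/ \dim {:A1} = 2%N by lia.
  have iso1 := classify1 dA1.
  have [|iso2|iso2|iso2|[iso2|iso2]] := @classify3 A2; first by lia.
  - by exists 2%N => //; apply: dsum_isom3 iso iso2 iso1.
  - by exists 13%N => //; apply: dsum_isom3 iso iso2 iso1.
  - by exists 8%N => //; apply: dsum_isom3 iso iso2 iso1.
  - by exists 5%N => //; apply: dsum_isom3 iso iso2 iso1.
  - by exists 7%N => //; apply: dsum_isom3 iso iso2 iso1.
have dA2 : \dim {:A2} = 2%N by lia.
have flip L1 L2 : lie_isom (coadj A) (L1 \oplus L2) -> lie_isom (coadj A) (L2 \oplus L1).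
  by move=> LL; apply: lie_isom_trans LL (dsumC _ _).
have [i1|i1|i1] := classify2 dA1; have [i2|i2|i2] := classify2 dA2;
  have {}iso := dsum_isom3 iso i2 i1.
- by exists 8%N => //; apply: lie_isom_trans iso (dsumA _ _ _).
- by exists 5%N => //; apply: lie_isom_trans iso (dsumA _ _ _).
- by exists 7%N => //; apply: lie_isom_trans iso (dsumA _ _ _).
- by exists 5%N => //; apply: lie_isom_trans (flip _ _ iso) (dsumA _ _ _).
- by exists 3%N.
- by exists 4%N => //; apply: flip.
- by exists 7%N => //; apply: lie_isom_trans (flip _ _ iso) (dsumA _ _ _).
- by exists 4%N.
- by exists 6%N.
Qed.

Lemma classify_dim6 L : (0 < \dim {:L} <= 6)%N -> two_solvable L -> frobenius L ->
  exists2 i, (i < 9)%N & lie_isom L (nth aff dim6_list i).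
Proof.
case/andP=> L0 L6 sL fL; have [A iso] := frobenius_coadj sL fL L0.
have := lie_isom_dim iso; rewrite dim_coadj => dL.
(* The dimension of L is twice that of A, so only 2, 4 and 6 occur. *)
have [dA|dA|dA] : [\/ \dim {:A} = 1%N, \dim {:A} = 2%N | \dim {:A} = 3%N].
  move: L0 L6; rewrite dL; case: (\dim {:A}) => [|[|[|[|n]]]] // _ _;
    by [constructor 1 | constructor 2 | constructor 3].
- by exists 0%N => //; apply: lie_isom_trans iso (classify1 dA).
- have [i1|i1|i1] := classify2 dA; have {}iso := lie_isom_trans iso i1.
  + by exists 5%N.
  + by exists 1%N.
  + by exists 2%N.
- have [i1|i1|i1|[i1|i1]] := classify3 dA; have {}iso := lie_isom_trans iso i1.
  + by exists 3%N.
  + by exists 4%N.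
  + by exists 8%N.
  + by exists 6%N.
  + by exists 7%N.
Qed.

Lemma classify_dim8 L : \dim {:L} = 8%N -> two_solvable L -> frobenius L ->
  exists2 i, (i < 14)%N & lie_isom L (nth aff dim8_list i).
Proof.
move=> L8 sL fL; have [|A iso] := frobenius_coadj sL fL; first by rewrite L8.
have := lie_isom_dim iso; rewrite dim_coadj L8 => dA.
have [|i i14 isoi] := @classify4 A; first by lia.
by exists i => //; apply: lie_isom_trans iso isoi.
Qed.

End Classification.

(** * Isomorphism invariants *)

Section Invariants.
Variable R : fieldType.
Implicit Types A B : cfalg R.

Definition has_i A := exists i : A, i * i = -1.
(** A product satisfies [has_i] only if every factor does; here y may vanish in some factors, so a
    single complex factor is detected. *)
Definition has_cube_i A := exists y : A, y <> 0 /\ y * y * y = - y.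
Definition has_square_zero A := exists x : A, x <> 0 /\ x * x = 0.
Definition has_idempotent A := exists e : A, [/\ e * e = e, e <> 0 & e <> 1].
(** In dimension 4 nilpotence amounts to x^4 = 0. *)
Definition has_nil_cube A := exists x : A, x * x * x * x = 0 /\ x * x * x <> 0.
Definition has_nil_square A := exists x : A, x * x * x * x = 0 /\ x * x <> 0.
(** In a [quad_alg]: two isotropic vectors that are not orthogonal. *)
Definition has_hyperbolic A := exists x y : A, [/\ x * x = 0, y * y = 0 & x * y <> 0].
(** In a [quad_alg]: two orthogonal vectors with the same nonzero square. The vanishing cubes make x
    and y nilpotent. *)
Definition has_definite A := exists x y : A,
  [/\ x * x * x = 0, y * y * y = 0, x * y = 0, x * x = y * y & x * x <> 0].
(** An idempotent cuts a square-zero element into two nonzero pieces: nilpotents occur in two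
    factors at once. *)
Definition has_split_nil A := exists e x : A,
  [/\ e * e = e, x * x = 0, e * x <> 0 & e * x <> x].
Definition has_nil_plane A := exists x y : A,
  [/\ x * x = 0, y * y = 0, x <> 0 & forall c : R, y <> c *: x].

Lemma invariants_isom A B : alg_isom A B ->
  [/\ [/\ has_i A -> has_i B, has_cube_i A -> has_cube_i B,
          has_square_zero A -> has_square_zero B & has_idempotent A -> has_idempotent B],
      [/\ has_nil_cube A -> has_nil_cube B, has_nil_square A -> has_nil_square B &
          has_hyperbolic A -> has_hyperbolic B] &
      [/\ has_definite A -> has_definite B, has_split_nil A -> has_split_nil B &
          has_nil_plane A -> has_nil_plane B]].
Proof.
case=> f fbij fM; have f0 : f 0 = 0 := linear0 f.
have f1 := alg_isom1 fbij fM; have fI := bij_inj fbij.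
have nz x : x <> 0 -> f x <> 0 by move=> x0 fx0; apply: x0; apply: fI; rewrite f0.
have ne x y : x <> y -> f x <> f y by move=> xy /fI.
split; split.
- by case=> i ii; exists (f i); rewrite -fM ii linearN f1.
- by case=> y [y0 yyy]; exists (f y); split; [exact: nz | rewrite -!fM yyy linearN].
- by case=> x [x0 xx]; exists (f x); split; [exact: nz | rewrite -fM xx].
- by case=> e [ee e0 e1]; exists (f e); split; [rewrite -fM ee | exact: nz | rewrite -f1;
    exact: ne].
- by case=> x [x4 x3]; exists (f x); rewrite -!fM; split; [rewrite x4 | exact: nz].
- by case=> x [x4 x3]; exists (f x); rewrite -!fM; split; [rewrite x4 | exact: nz].
- by case=> x [y [xx yy xy]]; exists (f x), (f y); rewrite -!fM; split; [rewrite xx | rewrite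
    yy | exact: nz].
- case=> x [y [xx yy xy E n]]; exists (f x), (f y); rewrite -!fM.
  by split; [rewrite xx | rewrite yy | rewrite xy | rewrite E | exact: nz].
- case=> x [y [xx yy n1 n2]]; exists (f x), (f y); rewrite -!fM.
  by split; [rewrite xx | rewrite yy | exact: nz | exact: ne].
- case=> x [y [xx yy n1 n2]]; exists (f x), (f y); rewrite -!fM.
  split; [by rewrite xx | by rewrite yy | exact: nz | move=> c].
  by rewrite -linearZ; apply: ne.
Qed.

Lemma prod_has_i A B : has_i (prod_alg A B) -> has_i A /\ has_i B.
Proof. by case=> -[a b] [aa bb]; split; [exists a | exists b]. Qed.

Lemma prod_has_cube_i A B : has_cube_i (prod_alg A B) -> has_cube_i A \/ has_cube_i B.
Proof.
case=> -[a b] [ab0 [aa bb]]; have [a0|/eqP a0] := eqVneq a 0; [right | left].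
  by exists b; split=> // b0; apply: ab0; rewrite a0 b0.
by exists a.
Qed.

Lemma prod_has_square_zero A B :
  has_square_zero (prod_alg A B) -> has_square_zero A \/ has_square_zero B.
Proof.
case=> -[a b] [ab0 [aa bb]]; have [a0|/eqP a0] := eqVneq a 0; [right | left].
  by exists b; split=> // b0; apply: ab0; rewrite a0 b0.
by exists a.
Qed.

Lemma prod_has_nil_square A B :
  has_nil_square (prod_alg A B) -> has_nil_square A \/ has_nil_square B.
Proof.
case=> -[a b] [[a4 b4] ab2]; have [a0|/eqP a0] := eqVneq (a * a) 0; [right | left].
  by exists b; split=> // b0; apply: ab2; rewrite -[LHS]/(a * a, b * b) a0 b0.
by exists a.
Qed.

Lemma prod_has_split_nil A B : ~ has_square_zero B ->
  has_split_nil (prod_alg A B) -> has_split_nil A.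
Proof.
move=> rB [[e e'] [[x x'] [[ee _] [xx xx'] n1 n2]]].
have x'0 : x' = 0 by apply: contrapT => x'0; apply: rB; exists x'.
exists e, x; split=> // E; [apply: n1 | apply: n2];
  by rewrite -[LHS]/(e * x, e' * x') E x'0 mulr0.
Qed.

Lemma prod_has_nil_plane A B : ~ has_square_zero B ->
  has_nil_plane (prod_alg A B) -> has_nil_plane A.
Proof.
move=> rB [[x x'] [[y y'] [[xx xx'] [yy yy'] n1 n2]]].
have x'0 : x' = 0 by apply: contrapT => x'0; apply: rB; exists x'.
have y'0 : y' = 0 by apply: contrapT => y'0; apply: rB; exists y'.
exists x, y; split=> // [x0|c E]; first by apply: n1; rewrite x0 x'0.
by apply: (n2 c); rewrite E y'0 x'0 -[RHS]/(c *: x, c *: 0) scaler0.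
Qed.

Lemma prod_idempotent A B : has_idempotent (prod_alg A B).
Proof.
have n1 C : (1 : C : cfalg R) <> 0 by apply/eqP; apply: oner_neq0.
exists (1, 0); split; [by congr pair; rewrite ?mulr1 ?mulr0 | by case=> /n1 | ].
by case=> /esym/n1.
Qed.

Lemma connected_split_nil A : connected A -> ~ has_split_nil A.
Proof.
move=> cA [e [x [ee _ n1 n2]]]; case: (cA e ee) => E.
  by apply: n1; rewrite E mul0r.
by apply: n2; rewrite E mul1r.
Qed.

Lemma connected_idempotent A : connected A -> ~ has_idempotent A.
Proof. by move=> cA [e [ee e0 e1]]; case: (cA e ee). Qed.

End Invariants.

(** * Invariants of the building blocks *)

Section BaseInvariants.
Variable R : rcfType.
Implicit Types A B : cfalg R.

(** If e - a is nilpotent then so is the scalar a (a - 1), whence a is 0 or 1; thus e or 1 - e is a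
    nilpotent idempotent, which is 0. *)
Lemma local_connected A : split_local A -> connected A.
Proof.
move=> lA e ee; have [a en] := lA e.
have zero (f : A) : f * f = f -> nilpotent f -> f = 0.
  move=> ff [k fk]; have fE n : f ^+ n.+1 = f.
    by elim: n => [|n IH]; rewrite ?expr1 // exprS IH.
  by rewrite -(fE k) exprS fk mulr0.
have : nilpotent ((a * (a - 1))%:A : A).
  have -> : (a * (a - 1))%:A = - (e - a%:A) * (a%:A + e - 1) :> A.
    rewrite !scale_algE !mulr1 !(rmorphM, rmorphB, rmorph1).
    transitivity (in_alg A a * (in_alg A a - 1) - (e * e - e)); last by ring.
    by rewrite ee subrr subr0.
  by rewrite mulrC; apply/nilpotentMl/nilpotentN.
move/nilpotent_scal/eqP; rewrite mulf_eq0 subr_eq0 => /orP[] /eqP aE.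
  by left; apply: zero => //; move: en; rewrite aE scale0r subr0.
right; apply/eqP; rewrite eq_sym -subr_eq0; apply/eqP/zero.
  by rewrite mulrBl mul1r mulrBr mulr1 ee subrr subr0.
by move/nilpotentN: en; rewrite aE scale1r opprB.
Qed.

Lemma local_no_i A : split_local A -> ~ has_i A.
Proof.
move=> lA [i ii]; have [a an] := lA i.
have : nilpotent ((a ^+ 2 + 1)%:A : A).
  have -> : (a ^+ 2 + 1)%:A = - (a%:A + i) * (i - a%:A) :> A.
    rewrite !scale_algE !mulr1 rmorphD rmorphXn rmorph1.
    by transitivity (in_alg A a ^+ 2 - i * i); [rewrite ii opprK | ring].
  exact: nilpotentMl.
move/nilpotent_scal/eqP; rewrite paddr_eq0 ?sqr_ge0 ?ler01 //.
by rewrite oner_eq0 andbF.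
Qed.

(** If y - a is nilpotent then a (a^2 + 1) = 0, so a = 0 and y is nilpotent; iterating y = - y^3
    writes y through arbitrarily high powers of itself. *)
Lemma local_no_cube_i A : split_local A -> ~ has_cube_i A.
Proof.
move=> lA [y [y0 yyy]]; have [a an] := lA y.
have : nilpotent ((a * (a ^+ 2 + 1))%:A : A).
  have -> : (a * (a ^+ 2 + 1))%:A = - (a%:A ^+ 2 + a%:A * y + y * y + 1) * (y - a%:A) :> A.
    rewrite !scale_algE !mulr1 rmorphM rmorphD rmorphXn rmorph1.
    by transitivity (in_alg A a * (in_alg A a ^+ 2 + 1) - (y * y * y + y)); [rewrite yyy
        addNr subr0 | ring].
  exact: nilpotentMl.
move/nilpotent_scal/eqP; rewrite mulf_eq0 paddr_eq0 ?sqr_ge0 ?ler01 //.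
rewrite oner_eq0 andbF orbF => /eqP aE; move: an; rewrite aE scale0r subr0.
case=> k yk; apply: y0; have yE n : y = (- 1) ^+ n * y ^+ n * y ^+ n * y.
  elim: n => [|n IH]; first by rewrite !expr0 !mul1r.
  transitivity (- ((-1) ^+ n * y ^+ n * y ^+ n * (- y))); first by rewrite mulrN opprK -IH.
  by rewrite -yyy !exprS; ring.
by rewrite (yE k) yk !(mulr0, mul0r).
Qed.

Lemma monogenic_local A n : monogenic A 'X^n -> split_local A.
Proof.
case=> m [_ _ mn gm] a; have [q ->] := gm a.
exists q.[0].
have /factor_theorem[t tE] : root (q - (q.[0])%:P) 0 by rewrite /root !hornerE subrr.
have -> : peval m q - q.[0]%:A = peval m t * m.
  by rewrite -(pevalC m) -rmorphB tE subr0 rmorphM /= pevalX.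
by apply: nilpotentMl; exists n; move: mn; rewrite rmorphXn /= pevalX.
Qed.

Lemma monogenic_pow A n : monogenic A 'X^(n.+1) ->
  exists m : A, m ^+ n.+1 = 0 /\ m ^+ n <> 0.
Proof.
case=> m [pM sA mn gm]; exists m; split; first by move: mn; rewrite rmorphXn /= pevalX.
move=> mn0; have := @monogenic_dvd _ A _ m 'X^n pM sA mn gm.
rewrite rmorphXn /= pevalX => /(_ mn0)/dvdp_leq.
by rewrite -size_poly_eq0 !size_polyXn ltnn => /(_ isT).
Qed.

Lemma monogenic_square_zero A n : monogenic A 'X^(n.+2) -> has_square_zero A.
Proof.
case/monogenic_pow=> m [m0 m1]; exists (m ^+ n.+1); split=> //.
by rewrite -exprD addSnnS exprD m0 mulr0.
Qed.

Lemma pow4 A (x : A) : x * x * x * x = x ^+ 4.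
Proof. by rewrite !exprS expr0 mulr1 !mulrA. Qed.

Lemma no_nil_square A : (\dim {:A} <= 2)%N -> ~ has_nil_square A.
Proof.
move=> dA [x [x4 xx]]; apply: xx; have n : nilpotent x by exists 4; rewrite -pow4.
by rewrite -expr2 -(subnKC dA) exprD nilpotent_dim // mul0r.
Qed.

Lemma dim1_reduced A : \dim {:A} = 1%N -> ~ has_square_zero A.
Proof.
move=> dA [x [x0 xx]]; apply: x0; rewrite -[x]expr1 -dA; apply: nilpotent_dim.
by exists 2; rewrite expr2.
Qed.

Lemma dim1_local A : \dim {:A} = 1%N -> split_local A.
Proof.
by move=> dA m; have [a ->] := dim1_scalar dA m; exists a; rewrite subrr; exists 1%N; rewrite
    expr1.
Qed.

Lemma dim2_nil_plane A : \dim {:A} = 2%N -> split_local A -> ~ has_nil_plane A.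
Proof.
move=> dA lA [x [y [xx yy x0 xy]]].
have xn : nilpotent x by exists 2; rewrite expr2.
have yn : nilpotent y by exists 2; rewrite expr2.
have x_out : x \notin <<[:: 1%R : A]>>%VS.
  rewrite span_seq1; apply/negP=> /vlineP[c xc]; apply: x0.
  by rewrite xc (@nilpotent_scal _ A c) ?scale0r // -xc.
have : y \in <<[:: x; 1%R]>>%VS.
  rewrite free_span_full ?memvf ?dA // !free_cons x_out nil_free span_nil memv0.
  by rewrite oner_neq0.
rewrite span_cons span_seq1 => /memv_addP[_ /vlineP[a ->] [_ /vlineP[b ->] E]].
apply: (xy a); rewrite E; suff -> : b = 0 by rewrite scale0r addr0.
apply: (@nilpotent_scal _ A); rewrite (_ : b%:A = y - a *: x); last by rewrite E addrC addKr.
by apply/nilpotentB => //; apply: nilpotentZ.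
Qed.

Lemma monogenic_cplx A : monogenic A ('X^2 + 1) -> exists i : A,
  i * i = -1 /\ (forall a, exists k : R * R, a = k.1%:A + k.2 *: i).
Proof.
move=> Ap; have dA : \dim {:A} = 2%N.
  by rewrite (monogenic_dim Ap) size_polyDl size_polyXn ?size_poly1.
case: Ap => m [_ _ m2 _]; exists m.
have mm : m * m = -1.
  by apply/eqP; rewrite -addr_eq0 -m2 rmorphD rmorph1 rmorphXn /= pevalX expr2.
split=> // a; apply: cplx_spanP.
by rewrite free_span_full ?memvf ?dA // cplx_free2.
Qed.

Lemma cplx_reduced A : monogenic A ('X^2 + 1) -> ~ has_square_zero A.
Proof.
move=> /monogenic_cplx[i [ii gen]] [x [x0 xx]]; apply: x0.
have [k xE] := gen x; rewrite xE; apply: cplx_nilpotent => //.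
by rewrite -xE; exists 2; rewrite expr2.
Qed.

Lemma cplx_has_i A : monogenic A ('X^2 + 1) -> has_i A.
Proof. by move=> /monogenic_cplx[i [ii _]]; exists i. Qed.

Lemma has_i_cube A : has_i A -> has_cube_i A.
Proof.
case=> i ii; exists i; split=> [i0|]; last by rewrite ii mulN1r.
by move/eqP: ii; rewrite i0 mul0r eq_sym oppr_eq0 oner_eq0.
Qed.

(** For a generator m the element m^2 + 1 has square 0 but is nonzero, since its polynomial has
    degree less than 4; Newton's iteration started at m gives the root of -1. *)
Lemma D01_invariants A : monogenic A (('X^2 + 1) ^+ 2) -> has_i A /\ has_square_zero A.
Proof.
case=> m [pM sA m2 gm]; pose n := m * m + 1.
have nE : peval m ('X^2 + 1) = n by rewrite rmorphD rmorph1 rmorphXn /= pevalX expr2.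
have nn : n * n = 0 by rewrite -expr2 -nE -rmorphXn.
split; first by apply: (@lift_i _ _ m); exists 2; rewrite expr2.
exists n; split=> // n0; rewrite n0 in nE.
have := dvdp_leq _ (monogenic_dvd pM sA m2 gm nE).
have s3 : size ('X^2 + 1 : {poly R}) = 3%N by rewrite size_polyDl size_polyXn ?size_poly1.
have nz : ('X^2 + 1 : {poly R}) != 0 by rewrite -size_poly_eq0 s3.
by rewrite expr2 size_mul // s3 => /(_ nz).
Qed.

Section Quad.
Variables (A : cfalg R) (x y z : A) (al be ga : R).
Hypothesis dA : \dim {:A} = 4%N.
Hypothesis gen : forall a, exists k : R * R * R * R,
  a = k.1.1.1%:A + k.1.1.2 *: x + k.1.2 *: y + k.2 *: z.
Hypotheses (mA : [/\ x * x = al *: z, x * y = be *: z & y * y = ga *: z])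
  (nA : [/\ x * z = 0, y * z = 0 & z * z = 0]).

Let nil (k : R * R * R) : A := k.1.1 *: x + k.1.2 *: y + k.2 *: z.

Fact quad_z_neq0 : z <> 0.
Proof.
move=> z0; have /bij_inj inj := comb4_bij dA gen.
have := inj (0, 0, 0, 1) (0, 0, 0, 0); rewrite /= z0 !scaler0 => /(_ erefl)[] /eqP.
by rewrite oner_eq0.
Qed.

Fact quad_scale_z (c : R) : c *: z = 0 -> c = 0.
Proof.
by move/eqP; rewrite scaler_eq0 => /orP[/eqP//|/eqP/quad_z_neq0].
Qed.

Fact quad_nil_mul k l : nil k * nil l =
  (al * (k.1.1 * l.1.1) + be * (k.1.1 * l.1.2 + k.1.2 * l.1.1) + ga * (k.1.2 * l.1.2)) *: z.
Proof.
have := quad_mul mA nA (0, k.1.1, k.1.2, k.2) (0, l.1.1, l.1.2, l.2).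
by rewrite /= !mul0r !mulr0 !add0r !scale0r !add0r => ->.
Qed.

Fact quad_nil_z k : nil k * z = 0.
Proof. by have := quad_nil_mul k (0, 0, 1); rewrite /nil /= !scale0r !add0r scale1r !mulr0
    !addr0 !mulr0 !addr0 scale0r. Qed.

Fact quad_nil_cube k : nil k * nil k * nil k = 0.
Proof. by rewrite quad_nil_mul -scalerAl (mulrC z) quad_nil_z scaler0. Qed.

Fact quad_nil_nilpotent k : nilpotent (nil k).
Proof. by exists 3%N; rewrite !exprS expr0 mulr1 mulrA quad_nil_cube. Qed.

Fact quad_decomp a : exists c k, a = c%:A + nil k.
Proof.
have [k ->] := gen a; exists k.1.1.1, (k.1.1.2, k.1.2, k.2).
by rewrite /nil /= !addrA.
Qed.

Fact quad_nilP a : nilpotent a -> exists k, a = nil k.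
Proof.
move=> an; have [c [k aE]] := quad_decomp a; exists k.
have : nilpotent (c%:A : A).
  have -> : c%:A = a - nil k by rewrite aE addrK.
  by apply: nilpotentB => //; apply: quad_nil_nilpotent.
by move=> /nilpotent_scal c0; rewrite aE c0 scale0r add0r.
Qed.

Fact quad_local : split_local A.
Proof.
move=> a; have [c [k ->]] := quad_decomp a.
by exists c; rewrite addrC addKr; apply: quad_nil_nilpotent.
Qed.

Fact quad_no_nil_cube : ~ has_nil_cube A.
Proof.
case=> u [u4 u3]; have [|k uE] := @quad_nilP u; first by exists 4; rewrite -pow4.
by apply: u3; rewrite uE quad_nil_cube.
Qed.

End Quad.

Lemma quad_connected A al be ga : quad_alg A al be ga -> 
  [/\ ~ has_i A, ~ has_idempotent A & ~ has_nil_cube A].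
Proof.
move=> [dA [x [y [z [gen [mA nA]]]]]].
have lA := quad_local gen mA nA; split; first exact: local_no_i.
  exact/connected_idempotent/local_connected.
exact: quad_no_nil_cube gen mA nA.
Qed.

Lemma G41_invariants A : quad_alg A 0 0 0 -> ~ has_nil_square A.
Proof.
move=> [dA [x [y [z [gen [mA nA]]]]]] [u [u4 uu]].
have [|k uE] := @quad_nilP _ _ _ _ _ _ _ gen mA nA u; first by exists 4; rewrite -pow4.
by apply: uu; rewrite uE (quad_nil_mul mA nA) !mul0r !addr0 scale0r.
Qed.

(** The form is X^2: an isotropic nilpotent has no x-coordinate and is orthogonal to every
    nilpotent, while orthogonality of u and v makes one of u^2, v^2 vanish. *)
Lemma h42_invariants A : quad_alg A 1 0 0 ->
  [/\ has_nil_square A, ~ has_hyperbolic A & ~ has_definite A].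
Proof.
move=> [dA [x [y [z [gen [mA nA]]]]]].
have z0 := quad_scale_z dA gen.
have mul k l := quad_nil_mul mA nA k l.
split.
- exists x; case: mA nA => xx _ _ [xz _ _].
  by rewrite xx scale1r (mulrC z) xz mul0r; split=> //; apply: quad_z_neq0 gen.
- case=> u [v [uu vv uv]].
  have [|k uE] := @quad_nilP _ _ _ _ _ _ _ gen mA nA u; first by exists 2; rewrite expr2.
  have [|l vE] := @quad_nilP _ _ _ _ _ _ _ gen mA nA v; first by exists 2; rewrite expr2.
  apply: uv; move: uu; rewrite uE vE !mul !mul0r !mul1r !addr0 => /z0/eqP.
  by rewrite mulf_eq0 orbb => /eqP->; rewrite mul0r scale0r.
case=> u [v [u3 v3 uv uuvv uu]].
have [|k uE] := @quad_nilP _ _ _ _ _ _ _ gen mA nA u; first by exists 3; rewrite !exprS expr0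
    mulr1 mulrA.
have [|l vE] := @quad_nilP _ _ _ _ _ _ _ gen mA nA v; first by exists 3; rewrite !exprS expr0
    mulr1 mulrA.
move: uv uuvv uu; rewrite uE vE !mul !mul0r !mul1r !addr0 => /z0/eqP.
by rewrite mulf_eq0 => /orP[] /eqP ->; rewrite !mulr0 ?mul0r scale0r // => ->.
Qed.

(** A sum of two real squares vanishes only when both coordinates do, so an isotropic nilpotent is a
    multiple of z; x and y witness definiteness. *)
Lemma h43_invariants A : quad_alg A 1 0 1 ->
  [/\ has_nil_square A, ~ has_hyperbolic A & has_definite A].
Proof.
move=> [dA [x [y [z [gen [mA nA]]]]]].
have z0 := quad_scale_z dA gen; have zn0 := quad_z_neq0 dA gen.
have mul k l := quad_nil_mul mA nA k l.
split.
- exists x; case: mA nA => xx _ _ [xz _ _].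
  by rewrite xx scale1r (mulrC z) xz mul0r.
- case=> u [v [uu vv uv]].
  have [|k uE] := @quad_nilP _ _ _ _ _ _ _ gen mA nA u; first by exists 2; rewrite expr2.
  have [|l vE] := @quad_nilP _ _ _ _ _ _ _ gen mA nA v; first by exists 2; rewrite expr2.
  apply: uv; move: uu; rewrite uE vE !mul !mul0r !mul1r !addr0 => /z0/eqP.
  rewrite -!expr2 paddr_eq0 ?sqr_ge0 // !sqrf_eq0 => /andP[/eqP-> /eqP->].
  by rewrite !mul0r addr0 scale0r.
exists x, y; case: mA nA => xx xy yy [xz yz _].
by rewrite xx yy xy scale1r scale0r !(mulrC z) xz yz.
Qed.

Lemma G44'_invariants A : quad_alg A 0 1 0 -> has_nil_square A /\ has_hyperbolic A.
Proof.
move=> [dA [x [y [z [gen [mA nA]]]]]]; have z0 := quad_scale_z dA gen.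
case: mA nA => xx xy yy [xz yz zz].
rewrite scale0r in xx; rewrite scale0r in yy; rewrite scale1r in xy.
have zn0 := quad_z_neq0 dA gen.
split; last by exists x, y; rewrite xx yy xy.
exists (x + y).
have E : (x + y) * (x + y) = 2 *: z.
  rewrite (_ : _ * _ = x * x + y * y + (x * y) *+ 2); last by ring.
  by rewrite xx yy xy !add0r scaler_nat.
split; last by rewrite E => /z0/eqP; rewrite pnatr_eq0.
have zxy : z * (x + y) = 0 by rewrite mulrDr !(mulrC z) xz yz addr0.
by rewrite E -scalerAl zxy scaler0 mul0r.
Qed.

Lemma triv3_nil A : triv3_alg A -> exists x y : A,
  [/\ forall a : A, exists c k l, a = c%:A + (k *: x + l *: y),
      forall k l k' l', (k *: x + l *: y) * (k' *: x + l' *: y) = 0,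
      x <> 0 & forall c, y <> c *: x].
Proof.
case=> dA [x [y [gen [xx xy yy]]]]; exists x, y; split.
- by move=> a; have [[[c k] l] ->] := gen a; exists c, k, l; rewrite addrA.
- move=> k l k' l'; rewrite mulrDl !mulrDr -!scalerAl -!scalerAr xx (mulrC y) xy yy.
  by rewrite !scaler0 !addr0.
- move=> x0; have /bij_inj inj := comb3_bij dA gen.
  have := inj (0, 1, 0) (0, 0, 0); rewrite /= x0 !scaler0 => /(_ erefl)[] /eqP.
  by rewrite oner_eq0.
move=> c yc; have /bij_inj inj := comb3_bij dA gen.
have := inj (0, - c, 1) (0, 0, 0).
rewrite /= yc !scale0r !add0r scale1r scaleNr addNr => /(_ erefl)[] _ /eqP.
by rewrite oner_eq0.
Qed.

Lemma triv3_invariants A : triv3_alg A ->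
  [/\ split_local A, has_nil_plane A & ~ has_nil_square A].
Proof.
case/triv3_nil=> x [y [gen mul x0 xy]].
have nil k l : nilpotent (k *: x + l *: y) by exists 2; rewrite expr2 mul.
have xx : x * x = 0 by have := mul 1 0 1 0; rewrite scale1r scale0r addr0.
have yy : y * y = 0 by have := mul 0 1 0 1; rewrite scale1r scale0r add0r.
split.
- by move=> a; have [c [k [l ->]]] := gen a; exists c; rewrite addrC addKr.
- by exists x, y.
case=> u [u4 uu]; have un : nilpotent u by exists 4; rewrite -pow4.
have [c [k [l uE]]] := gen u; apply: uu.
have c0 : c = 0.
  apply: (@nilpotent_scal _ A).
  have -> : c%:A = u - (k *: x + l *: y) by rewrite {1}uE addrK.
  exact: nilpotentB.
by rewrite uE c0 scale0r add0r mul.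
Qed.

End BaseInvariants.

(** * Pairwise non-isomorphism in dimension 8 *)

Section NonIsomorphism.
Variable R : rcfType.
Implicit Types A B : cfalg R.
Local Notation aff := (aff_real R).
Local Notation affC := (aff_complex R).

(** The index is the position in [dim8_list]. The entries are the leaves of a decision tree: each
    also records the tests that fail, so any two contradict each other by propositional logic. *)
Definition signature (i : nat) A : Prop :=
  match i with
  | 0 => has_i A /\ has_square_zero A
  | 6 => has_i A /\ ~ has_square_zero A
  | 1 => [/\ ~ has_i A, ~ has_idempotent A & has_nil_cube A]
  | 9 => [/\ ~ has_i A, ~ has_idempotent A, ~ has_nil_cube A & ~ has_nil_square A]
  | 10 => [/\ ~ has_i A, ~ has_idempotent A & ~ has_nil_cube A] /\
          [/\ has_nil_square A, ~ has_hyperbolic A & ~ has_definite A]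
  | 11 => [/\ ~ has_i A, ~ has_idempotent A & ~ has_nil_cube A] /\
          [/\ has_nil_square A, ~ has_hyperbolic A & has_definite A]
  | 12 => [/\ ~ has_i A, ~ has_idempotent A & ~ has_nil_cube A] /\
          (has_nil_square A /\ has_hyperbolic A)
  | 4 => [/\ ~ has_i A, has_idempotent A, has_cube_i A & has_square_zero A]
  | 7 => [/\ ~ has_i A, has_idempotent A, has_cube_i A & ~ has_square_zero A]
  | 8 => [/\ ~ has_i A, has_idempotent A, ~ has_cube_i A & ~ has_square_zero A]
  | 2 => [/\ ~ has_i A, has_idempotent A, ~ has_cube_i A & has_square_zero A] /\
         has_nil_square A
  | 3 => [/\ ~ has_i A, has_idempotent A, ~ has_cube_i A & has_square_zero A] /\
         (~ has_nil_square A /\ has_split_nil A)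
  | 5 => [/\ ~ has_i A, has_idempotent A, ~ has_cube_i A & has_square_zero A] /\
         [/\ ~ has_nil_square A, ~ has_split_nil A & ~ has_nil_plane A]
  | 13 => [/\ ~ has_i A, has_idempotent A, ~ has_cube_i A & has_square_zero A] /\
         [/\ ~ has_nil_square A, ~ has_split_nil A & has_nil_plane A]
  | _ => False
  end.

Lemma signature_isom i A B : alg_isom A B -> signature i A -> signature i B.
Proof.
move=> AB; have [[a1 a2 a3 a4] [a5 a6 a7] [a8 a9 a10]] := invariants_isom AB.
have [[b1 b2 b3 b4] [b5 b6 b7] [b8 b9 b10]] := invariants_isom (alg_isom_sym AB).
by do 14?[case: i => [|i] /=; first by clear AB; dtauto].
Qed.

Lemma signature_inj i j A : signature i A -> signature j A -> i = j.
Proof.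
case: i => [|[|[|[|[|[|[|[|[|[|[|[|[|[|i]]]]]]]]]]]]]];
  case: j => [|[|[|[|[|[|[|[|[|[|[|[|[|[|j]]]]]]]]]]]]]] //=; dtauto.
Qed.

Lemma prod_model L1 L2 A1 A2 : lie_isom L1 (coadj A1) -> lie_isom L2 (coadj A2) ->
  lie_isom (L1 \oplus L2) (coadj (prod_alg A1 A2)).
Proof. by move=> i1 i2; apply: lie_isom_trans (dsum_isom i1 i2) (coadj_prod A1 A2). Qed.

Lemma dim8_model i : (i < 14)%N -> exists A,
  [/\ lie_isom (nth aff (dim8_list R) i) (coadj A), \dim {:A} = 4%N & signature i A].
Proof.
have [A1 iso1 p1] := aff_real_model R.
have d1 : \dim {:A1} = 1%N by rewrite (monogenic_dim p1) size_polyX.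
have [D isoD pD] := D0_model R 1.
have dD : \dim {:D} = 2%N by rewrite (monogenic_dim pD) size_polyXn.
have [X3 iso3 p3] := D0_model R 2.
have d3 : \dim {:X3} = 3%N by rewrite (monogenic_dim p3) size_polyXn.
have [C isoC pC] := aff_complex_model R.
have dC : \dim {:C} = 2%N by rewrite (monogenic_dim pC) size_polyDl size_polyXn ?size_poly1.
have l1 := dim1_local d1; have lD := monogenic_local pD; have l3 := monogenic_local p3.
have n1 := local_no_i l1; have nD := local_no_i lD; have n3 := local_no_i l3.
have c1 := local_no_cube_i l1; have cD := local_no_cube_i lD; have c3 := local_no_cube_i l3.
have r1 := dim1_reduced d1; have rC := cplx_reduced pC.
have s1 : ~ has_nil_square A1 by apply: no_nil_square; rewrite d1.
have sD : ~ has_nil_square D by apply: no_nil_square; rewrite dD.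
have embl A B : has_square_zero A -> has_square_zero (prod_alg A B).
  case=> x [x0 xx]; exists (x, 0); split; first by case.
  by rewrite -[LHS]/(x * x, 0 * 0) xx mul0r.
case: i => [|[|[|[|[|[|[|[|[|[|[|[|[|[|//]]]]]]]]]]]]]] _.
- have [A iso pA] := D01_model R; exists A; split=> //; last exact: D01_invariants.
  rewrite (monogenic_dim pA).
  have s2 : size ('X^2 + 1 : {poly R}) = 3%N by rewrite size_polyDl size_polyXn ?size_poly1.
  by rewrite expr2 size_mul -?size_poly_eq0 s2.
- have [A iso pA] := D0_model R 3; have lA := monogenic_local pA; exists A; split=> //.
    by rewrite (monogenic_dim pA) size_polyXn.
  split; [exact: local_no_i | exact/connected_idempotent/local_connected | ].
  have [m [m4 m3]] := monogenic_pow pA; exists m; rewrite pow4; split=> //.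
  by move=> m30; apply: m3; rewrite !exprS expr0 mulr1 mulrA.
- exists (prod_alg X3 A1); split; [exact: prod_model | by rewrite dim_pair d3 d1 | ].
  split; last first.
    have [m [m3 m2]] := monogenic_pow p3; exists (m, 0); split.
      by rewrite -[LHS]/(m * m * m * m, 0 * 0 * 0 * 0) !mul0r pow4 exprS m3 mulr0.
    by case=> mm _; apply: m2; rewrite expr2.
  split.
  + by case/prod_has_i.
  + exact: prod_idempotent.
  + by case/prod_has_cube_i.
  + by apply: embl; apply: monogenic_square_zero p3.
- exists (prod_alg D D); split; [exact: prod_model | by rewrite dim_pair dD | ].
  split; [split | split].
  + by case/prod_has_i.
  + exact: prod_idempotent.
  + by case/prod_has_cube_i.
  + by apply: embl; apply: monogenic_square_zero pD.
  + by case/prod_has_nil_square.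
  have [m [m0 mm]] := monogenic_square_zero pD.
  (* The diagonal nilpotent is cut by (1, 0) into its two components. *)
  exists (1, 0), (m, m); split; first by congr pair; rewrite ?mulr1 ?mulr0.
  + by rewrite -[LHS]/(m * m, m * m) mm.
  + by case; rewrite mul1r.
  by case=> _; rewrite mul0r => /esym.
- exists (prod_alg D C); split; [exact: prod_model | by rewrite dim_pair dD dC | ].
  split.
  + by case/prod_has_i.
  + exact: prod_idempotent.
  + have [y [y0 yyy]] := has_i_cube (cplx_has_i pC); exists (0, y); split; first by case.
    by rewrite -[LHS]/(0 * 0 * 0, y * y * y) yyy !mul0r -[RHS]/(- 0, - y) oppr0.
  + by apply: embl; apply: monogenic_square_zero pD.
- exists (prod_alg (prod_alg D A1) A1); split.
  + by do 2?apply: prod_model.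
  + by rewrite !dim_pair dD d1.
  split; [split | split].
  + by case/prod_has_i=> _.
  + exact: prod_idempotent.
  + by case/prod_has_cube_i=> // /prod_has_cube_i[].
  + by apply: (embl); apply: (embl); apply: monogenic_square_zero pD.
  + by case/prod_has_nil_square=> // /prod_has_nil_square[].
  + by move/(prod_has_split_nil r1)/(prod_has_split_nil r1);
      apply/connected_split_nil/local_connected.
  + by move/(prod_has_nil_plane r1)/(prod_has_nil_plane r1); apply: dim2_nil_plane.
- exists (prod_alg C C); split; [exact: prod_model | by rewrite dim_pair dC | ].
  split; last by case/prod_has_square_zero.
  have [i ii] := cplx_has_i pC; exists (i, i).
  by rewrite -[LHS]/(i * i, i * i) ii.
- exists (prod_alg (prod_alg C A1) A1); split.
  + by do 2?apply: prod_model.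
  + by rewrite !dim_pair dC d1.
  split.
  + by case/prod_has_i.
  + exact: prod_idempotent.
  + have [y [y0 yyy]] := has_i_cube (cplx_has_i pC); exists (y, 0, 0); split; first by case.
    by rewrite -[LHS]/(y * y * y, 0 * 0 * 0, 0 * 0 * 0) yyy !mul0r -[RHS]/(- y, - 0, - 0) oppr0.
  + by case/prod_has_square_zero=> // /prod_has_square_zero[].
- exists (prod_alg (prod_alg (prod_alg A1 A1) A1) A1); split.
  + by do 3?apply: prod_model.
  + by rewrite !dim_pair d1.
  split.
  + by case/prod_has_i.
  + exact: prod_idempotent.
  + by do 3?case/prod_has_cube_i=> //.
  + by do 3?case/prod_has_square_zero=> //.
- have [A iso qA] := G41_model R; exists A; split=> //; first by case: qA.
  by have [q1 q2 q3] := quad_connected qA; split=> //; apply: G41_invariants.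
- have [A iso qA] := h42_model R; exists A; split=> //; first by case: qA.
  by split; [apply: quad_connected qA | apply: h42_invariants].
- have [A iso qA] := h43_model R; exists A; split=> //; first by case: qA.
  by split; [apply: quad_connected qA | apply: h43_invariants].
- have [A iso qA] := G44'_model R; exists A; split=> //; first by case: qA.
  by split; [apply: quad_connected qA | apply: G44'_invariants].
have [A iso tA] := G31_model R; have [lA pA sA] := triv3_invariants tA.
exists (prod_alg A A1); split; first exact: prod_model.
  by rewrite dim_pair d1 (proj1 tA).
split; [split | split].
- by case/prod_has_i=> _.
- exact: prod_idempotent.
- by case/prod_has_cube_i=> //; apply: local_no_cube_i.
- by apply: embl; case: pA => x [y [xx _ x0 _]]; exists x.
- by case/prod_has_nil_square.
- by move/(prod_has_split_nil r1); apply/connected_split_nil/local_connected.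
case: pA => x [y [xx yy x0 xy]]; exists (x, 0), (y, 0); split.
- by rewrite -[LHS]/(x * x, 0 * 0) xx mul0r.
- by rewrite -[LHS]/(y * y, 0 * 0) yy mul0r.
- by case.
- by move=> c [] /xy.
Qed.

Lemma dim8_noniso i j : (i < j < 14)%N ->
  ~ lie_isom (nth aff (dim8_list R) i) (nth aff (dim8_list R) j).
Proof.
case/andP=> ij j14 iso; have [A [isoA _ sA]] := dim8_model (ltn_trans ij j14).
have [B [isoB _ sB]] := dim8_model j14.
have /coadj_inj AB : lie_isom (coadj A) (coadj B).
  exact: lie_isom_trans (lie_isom_sym isoA) (lie_isom_trans iso isoB).
by move: ij; rewrite (signature_inj (signature_isom AB sA) sB) ltnn.
Qed.

End NonIsomorphism.

(** * Algebras with one generator and nonderogatory matrices *)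

Section Cyclic.
Variable R : rcfType.
Implicit Types (A B : cfalg R) (p q : {poly R}).
Local Notation aff := (aff_real R).
Local Notation affC := (aff_complex R).

Lemma peval_comp A (m : A) p q : peval m (p \Po q) = peval (peval m q) p.
Proof.
elim/poly_ind: p => [|p c IH]; first by rewrite comp_poly0 !rmorph0.
by rewrite comp_poly_MXaddC !rmorphD !rmorphM /= IH !pevalC pevalX.
Qed.

(** The generator is replaced by an affine function of itself, which moves the roots of the modulus;
    this separates the moduli of isomorphic factors. *)
Lemma monogenic_affine A p q (a b : R) : a != 0 -> q \is monic -> size q = size p ->
  (forall m : A, peval m p = 0 -> peval (a *: m + b%:A) q = 0) ->
  monogenic A p -> monogenic A q.
Proof.
move=> a0 qM sq pq [m [pM sp m0 gm]]; exists (a *: m + b%:A).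
split=> [//| | |x]; first by rewrite sq.
  exact: pq.
have [r ->] := gm x; exists (r \Po (a^-1 *: ('X - b%:P))).
rewrite peval_comp; congr (peval _ r).
by rewrite pevalZ rmorphB /= pevalX pevalC addrK scalerA mulVf // scale1r.
Qed.

Lemma monogenic_root A (c : R) : \dim {:A} = 1%N -> monogenic A ('X - c%:P).
Proof.
move=> dA; exists c%:A; split; rewrite ?monicXsubC ?size_XsubC ?dA //.
  by rewrite rmorphB /= pevalX pevalC subrr.
by move=> a; have [d ->] := dim1_scalar dA a; exists d%:P; rewrite pevalC.
Qed.

(** Repeated factors need coprime moduli: copies of R take roots among 0, 1, -1, 2, the second D_0^2
    is shifted to (X - 1)^2, and the second C is generated by 2 i, hence X^2 + 4. *)
Lemma cyclic_monogenic i : (i < 9)%N -> exists A p,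
  [/\ lie_isom (nth aff (cyclic_list R) i) (coadj A), monogenic A p & \dim {:A} = 4%N].
Proof.
have [A1 iso1 p1] := aff_real_model R.
have d1 : \dim {:A1} = 1%N by rewrite (monogenic_dim p1) size_polyX.
have rt c : monogenic A1 ('X - c%:P) by apply: monogenic_root.
have [D isoD pD] := D0_model R 1.
have dD : \dim {:D} = 2%N by rewrite (monogenic_dim pD) size_polyXn.
have [X3 iso3 p3] := D0_model R 2.
have d3 : \dim {:X3} = 3%N by rewrite (monogenic_dim p3) size_polyXn.
have [C isoC pC] := aff_complex_model R.
have dC : \dim {:C} = 2%N by rewrite (monogenic_dim pC) size_polyDl size_polyXn ?size_poly1.
have cX (c : R) : c != 0 -> coprimep 'X ('X - c%:P).
  by move=> c0; rewrite coprimep_XsubC rootX.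
case: i => [|[|[|[|[|[|[|[|[|//]]]]]]]]] _.
- have [A iso pA] := D01_model R; exists A, (('X^2 + 1) ^+ 2); split=> //.
  rewrite (monogenic_dim pA).
  have s2 : size ('X^2 + 1 : {poly R}) = 3%N by rewrite size_polyDl size_polyXn ?size_poly1.
  by rewrite expr2 size_mul -?size_poly_eq0 s2.
- have [A iso pA] := D0_model R 3; exists A, 'X^4; split=> //.
  by rewrite (monogenic_dim pA) size_polyXn.
- exists (prod_alg X3 A1), ('X^3 * ('X - 1%:P)); split; first exact: prod_model.
    by apply: monogenic_prod => //; rewrite coprimep_expl // cX ?oner_neq0.
  by rewrite dim_pair d3 d1.
- exists (prod_alg D D), ('X^2 * ('X - 1%:P) ^+ 2); split; first exact: prod_model.
    apply: monogenic_prod => //; last by rewrite coprimep_expl // coprimep_expr // cX ?oner_neq0.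
    apply: (monogenic_affine (p := 'X^2) (a := 1) (b := 1)) pD.
    - exact: oner_neq0.
    - by rewrite monic_exp // monicXsubC.
    - by rewrite size_exp_XsubC size_polyXn.
    by move=> m; rewrite !rmorphXn rmorphB /= !pevalX pevalC !scale1r addrK.
  by rewrite dim_pair dD.
- exists (prod_alg D C), ('X^2 * ('X^2 + 1)); split; first exact: prod_model.
    apply: monogenic_prod => //; rewrite coprimep_expl // coprimep_sym coprimepX.
    by rewrite /root !hornerE /= expr0n add0r oner_neq0.
  by rewrite dim_pair dD dC.
- exists (prod_alg (prod_alg D A1) A1), ('X^2 * ('X - 1%:P) * ('X - (-1)%:P)); split.
  + by do 2?apply: prod_model.
  + apply: monogenic_prod => //.
      by apply: monogenic_prod => //; rewrite coprimep_expl // cX ?oner_neq0.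
    rewrite coprimep_XsubC /root !hornerE.
    by apply/eqP; lra.
  + by rewrite !dim_pair dD d1.
- exists (prod_alg C C), (('X^2 + 1) * ('X^2 + 4%:P)); split; first exact: prod_model.
    apply: monogenic_prod => //.
      apply: (monogenic_affine (p := 'X^2 + 1) (a := 2) (b := 0)) pC.
      - by rewrite pnatr_eq0.
      - by rewrite monicE lead_coefDl ?lead_coefXn // size_polyXn (leq_ltn_trans
          (size_polyC_leq1 _)).
      - by rewrite !size_polyDl ?size_polyXn ?size_poly1 // (leq_ltn_trans (size_polyC_leq1 _)).
      move=> m; have -> : peval m ('X^2 + 1) = m ^+ 2 + 1.
        by rewrite rmorphD rmorph1 rmorphXn /= pevalX.
      move=> m2; rewrite scale0r addr0 rmorphD rmorphXn /= pevalX pevalC.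
      have -> : (2 *: m) ^+ 2 + 4%:A = 4 *: (m ^+ 2 + 1).
        by rewrite exprZn scalerDr (_ : 2 ^+ 2 = 4 :> R) //; ring.
      by rewrite m2 scaler0.
    (* The two moduli differ by the unit 3. *)
    apply/Bezout_eq1_coprimepP; exists (- (3^-1)%:P, (3^-1)%:P) => /=.
    rewrite (_ : _ + _ = (3^-1)%:P * (4%:P - 1)); last by ring.
    by rewrite -polyCB -polyCM; congr (_%:P); field.
  by rewrite dim_pair dC.
- exists (prod_alg (prod_alg C A1) A1), (('X^2 + 1) * ('X - 0%:P) * ('X - 1%:P)); split.
  + by do 2?apply: prod_model.
  + apply: monogenic_prod => //.
      apply: monogenic_prod => //; rewrite coprimep_XsubC.
      by rewrite /root !hornerE; apply/eqP; lra.
    by rewrite coprimep_XsubC /root !hornerE; apply/eqP; lra.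
  + by rewrite !dim_pair dC d1.
exists (prod_alg (prod_alg (prod_alg A1 A1) A1) A1),
  (('X - 0%:P) * ('X - 1%:P) * ('X - (-1)%:P) * ('X - 2%:P)); split.
- by do 3?apply: prod_model.
- by do 3?[apply: monogenic_prod => //; last by rewrite coprimep_XsubC /root !hornerE;
    apply/eqP; lra].
- by rewrite !dim_pair d1.
Qed.

Lemma cyclic_companion i : (i < 9)%N ->
  exists2 M : 'M[R]_4, nonderogatory M & lie_isom (nth aff (cyclic_list R) i) (polysd M).
Proof.
move=> /cyclic_monogenic[A [p [iso pA dA]]].
have sp : size p = 5%N by case: pA => m [_ ->]; rewrite dA.
have [M nM isoM] := monogenic_companion pA sp.
by exists M => //; apply: lie_isom_trans iso isoM.
Qed.

(** Modulo the derived algebra, M comes from some a in A. On the derived algebra a acts as M, hence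
    q(a) acts as q(M); every b in A acts as some q(M), so b = q(a) by faithfulness. *)
Lemma polysd_generates A n (M : 'M[R]_n.+1) :
  lie_isom (coadj A) (polysd M) -> exists a : A, generates a.
Proof.
case=> chi chibij chiM; have [phi chiK phiK] := bij_linear_inv chibij.
pose Mx (u : coadj A) : 'M[R]_n.+1 := vsval (chi u).1.
pose y f : 'cV[R]_n.+1 := (chi (0, f)).2.
have bracket a f : (a, 0) = (a, 0) :> coadj A /\
    lie ((a, 0) : coadj A) ((0, f) : coadj A) = (0, dual_act a f) :> coadj A.
  split=> //; apply: coadj_ext => //; apply/lfunP=> c.
  by rewrite coadj_lieE /= !dual_evalE subr0.
have der f : (chi (0, f)).1 = 0.
  have -> : (0, f) = lie ((1, 0) : coadj A) ((0, f) : coadj A).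
    rewrite (bracket 1 f).2; apply: coadj_ext => //; apply/lfunP=> c.
    by rewrite /= dual_actE mul1r.
  by rewrite chiM.
have yact a f : y (dual_act a f) = Mx (a, 0) *m y f.
  rewrite /y -(bracket a f).2 chiM /=.
  by rewrite /Mx der linear0 mul0mx subr0.
have yinj f g : y f = y g -> f = g.
  move=> fg; have : chi (0, f) = chi (0, g).
    by rewrite [chi (0, f)]surjective_pairing [chi (0, g)]surjective_pairing !der; congr pair.
  by move/(congr1 phi); rewrite !chiK => -[].
have MB : M \in (polyalg M : {vspace _}).
  by apply/memv_agenv_horner; exists 'X; rewrite horner_mx_X.
have [a MaE] : exists a, Mx (a, 0) = M.
  (* The part f of the preimage is irrelevant: (0, f) is a bracket, so its image has no matrix
     component. *)
  case E : (phi (vsproj (polyalg M) M, 0)) => [a f]; exists a.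
  have : chi ((a, 0) : coadj A) + chi (0, f) = (vsproj (polyalg M) M, 0).
    rewrite -linearD -[RHS]phiK E; congr (chi _); apply: coadj_ext; first exact: addr0.
    exact: add0r.
  move/(congr1 fst) => /=; rewrite der addr0 => E1.
  by rewrite /Mx E1 vsprojK.
have yev q f : y (dual_act (peval a q) f) = horner_mx M q *m y f.
  have yD c u v : y (c *: u + v) = c *: y u + y v.
    have -> : y (c *: u + v) = (c *: chi (0, u) + chi (0, v)).2.
      rewrite /y -linearP; congr (chi _).2; apply: coadj_ext => //=.
      by rewrite scaler0 addr0.
    by [].
  elim/poly_ind: q f => [|q c IH] f.
    rewrite rmorph0 rmorph0 mul0mx dual_act0l.
    by rewrite /y (_ : (0, 0) = 0 :> coadj A) ?linear0.
  have -> : peval a (q * 'X + c%:P) = c *: 1 + a * peval a q.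
    by rewrite rmorphD rmorphM /= pevalX pevalC addrC mulrC.
  have -> : dual_act (c *: 1 + a * peval a q) f = c *: f + dual_act (peval a q) (dual_act a f).
    by rewrite dual_actl dual_actA mulrC; congr (c *: _ + _); apply/lfunP=> x; rewrite
        dual_actE mul1r.
  rewrite yD IH yact MaE rmorphD rmorphM /= horner_mx_X horner_mx_C mulmxDl addrC.
  by rewrite mul_scalar_mx -[horner_mx M q * M]/(_ *m _) mulmxA.
exists a => b.
have /memv_agenv_horner[q qE] : Mx (b, 0) \in (polyalg M : {vspace _}) by apply: subvsP.
exists q; apply/eqP; rewrite -subr_eq0; apply/eqP/dual_sep => f.
have : dual_act b f = dual_act (peval a q) f by apply: yinj; rewrite yact yev qE.
move/(congr1 (fun h : dual A => h 1)); rewrite !dual_actE !mulr1 => E.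
by rewrite linearB /= E subrr.
Qed.

(** Remainders modulo p form a space of dimension deg p that evaluates onto A. *)
Lemma generates_dim A (m : A) p : generates m -> p != 0 -> peval m p = 0 ->
  (\dim {:A} < size p)%N.
Proof.
move=> gm p0 mp; set n := (size p).-1.
have sp : size p = n.+1 by rewrite prednK // size_poly_gt0.
pose h (v : 'rV[R]_n) := peval m (rVpoly v).
have h_lin : linear h.
  suff H (a : R) u v : h (a *: u + v) = a *: h u + h v by exact: H.
  by rewrite /h linearP rmorphD /= pevalZ.
have hS : limg (linfun (mk_linear h_lin)) = fullv.
  apply/eqP; rewrite eqEsubv subvf; apply/subvP=> x _; have [q ->] := gm x.
  have -> : peval m q = h (poly_rV (q %% p)).
    rewrite /h poly_rV_K; last by rewrite -ltnS -sp ltn_modp.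
    by rewrite {1}(divp_eq q p) rmorphD rmorphM /= mp mulr0 add0r.
  by rewrite -[h _](lfunE (mk_linear h_lin)) memv_img ?memvf.
have := limg_ker_dim (linfun (mk_linear h_lin)) fullv; rewrite hS capfv.
rewrite [RHS]dimvf /= /dim /= mul1n sp ltnS => <-.
exact: leq_addl.
Qed.

(** Every element is a scalar c plus a nilpotent of cube 0, so it is a root of (X - c)^3, of degree
    3 < 4. *)
Lemma quad_not_generated A al be ga (m : A) : quad_alg A al be ga -> ~ generates m.
Proof.
move=> [dA [x [y [z [gen [mA nA]]]]]] gm.
have [c [k mE]] := quad_decomp gen m.
have p0 : ('X - c%:P) ^+ 3 != 0 by rewrite expf_neq0 // polyXsubC_eq0.
have := generates_dim gm p0; rewrite dA size_exp_XsubC ltnn => h.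
suff /h : peval m (('X - c%:P) ^+ 3) = 0 by [].
rewrite rmorphXn rmorphB /= pevalX pevalC mE addrC addKr.
by rewrite !exprS expr0 mulr1 mulrA (quad_nil_cube mA nA).
Qed.

(** With scalar parts c and d in the two factors, (X - c)^2 (X - d) annihilates m and has degree 3 <
    4. *)
Lemma triv3_not_generated A B (m : prod_alg A B) :
  triv3_alg A -> \dim {:B} = 1%N -> ~ generates m.
Proof.
move=> tA dB gm; have dA := proj1 tA.
have [x [y [gen mul _ _]]] := triv3_nil tA.
have [c [k [l m1E]]] := gen m.1; have [d m2E] := dim1_scalar dB m.2.
have hE r : peval m r = (peval m.1 r, peval m.2 r) :> prod_alg A B.
  elim/poly_ind: r => [|r e IH]; first by rewrite !rmorph0.
  by rewrite !rmorphD !rmorphM /= IH !pevalX !pevalC; case: (m).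
have p0 : ('X - c%:P) ^+ 2 * ('X - d%:P) != 0 by rewrite mulf_neq0 ?expf_neq0 ?polyXsubC_eq0.
have := generates_dim gm p0; rewrite dim_pair dA dB size_mul ?expf_neq0 ?polyXsubC_eq0 //.
rewrite size_exp_XsubC size_XsubC /= => h; suff /h : peval m (('X - c%:P) ^+ 2 * ('X - d%:P))
    = 0 by [].
have E (D : cfalg R) (u : D) e : peval u ('X - e%:P) = u - e%:A.
  by rewrite rmorphB /= pevalX pevalC.
rewrite hE rmorphM [peval m.2 _]rmorphM rmorphXn /= !E m2E subrr mulr0.
by rewrite m1E [_ - c%:A]addrC addKr expr2 mul mul0r.
Qed.

Lemma noncyclic_not_polysd i (M : 'M[R]_4) : (i < 5)%N ->
  ~ lie_isom (nth aff (noncyclic_list R) i) (polysd M).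
Proof.
have sub L A : lie_isom L (coadj A) -> lie_isom L (polysd M) -> exists m : A, generates m.
  move=> LA LM; apply: (@polysd_generates _ _ M).
  exact: lie_isom_trans (lie_isom_sym LA) LM.
have quad L al be ga : (exists2 A, lie_isom L (coadj A) & quad_alg A al be ga) ->
    ~ lie_isom L (polysd M).
  case=> A LA qA LM; have [m] := sub _ _ LA LM; exact: quad_not_generated qA.
case: i => [|[|[|[|[|//]]]]] _.
- exact: quad (G41_model R).
- exact: quad (h42_model R).
- exact: quad (h43_model R).
- exact: quad (G44'_model R).
have [A1 iso1 p1] := aff_real_model R.
have d1 : \dim {:A1} = 1%N by rewrite (monogenic_dim p1) size_polyX.
have [A isoA tA] := G31_model R.
move/(sub _ _ (prod_model isoA iso1)) => [m]; exact: triv3_not_generated.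
Qed.

End Cyclic.

Theorem theorem6 (R : realType) :
  let aff := aff_real R in
  let affC := aff_complex R in
  let low : seq (lieAlgType R) :=
    [:: aff; D0 R 2; affC; D0 R 3; Gn1 R 3;
        aff \oplus aff; D0 R 2 \oplus aff; affC \oplus aff;
        aff \oplus aff \oplus aff] in
  let cyclic8 : seq (lieAlgType R) :=
    [:: D01 R; D0 R 4; D0 R 3 \oplus aff; D0 R 2 \oplus D0 R 2;
        D0 R 2 \oplus affC; D0 R 2 \oplus aff \oplus aff; affC \oplus affC;
        affC \oplus aff \oplus aff; aff \oplus aff \oplus aff \oplus aff] in
  let noncyclic8 : seq (lieAlgType R) :=
    [:: Gn1 R 4; h42 R; h43 R; G44' R; Gn1 R 3 \oplus aff] in
  let all8 := cyclic8 ++ noncyclic8 in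
  let at_ (s : seq (lieAlgType R)) i := @nth (lieAlgType R) aff s i in
  (forall L : lieAlgType R,
     (0 < \dim {:L} <= 6)%N -> two_solvable L -> frobenius L ->
     exists2 i, (i < 9)%N & lie_isom L (at_ low i))
  /\
  [/\ forall i, (i < 14)%N ->
        [/\ \dim {:at_ all8 i} = 8%N, two_solvable (at_ all8 i)
          & frobenius (at_ all8 i)],
      forall i j, (i < j < 14)%N -> ~ lie_isom (at_ all8 i) (at_ all8 j),
      forall L : lieAlgType R,
        \dim {:L} = 8%N -> two_solvable L -> frobenius L ->
        exists2 i, (i < 14)%N & lie_isom L (at_ all8 i),
      forall i, (i < 9)%N -> exists2 M : 'M[R]_4,
        nonderogatory M & lie_isom (at_ cyclic8 i) (polysd M)
    & forall i (M : 'M[R]_4), (i < 5)%N ->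
        nonderogatory M -> ~ lie_isom (at_ noncyclic8 i) (polysd M)].
Proof.
move=> aff affC low cyclic8 noncyclic8 all8 at_; split.
  exact: (@classify_dim6 R).
split.
- move=> i i14; have [A [iso dA _]] := @dim8_model R i i14.
  have iso' := lie_isom_sym iso; split.
  + by rewrite (lie_isom_dim iso) dim_coadj dA.
  + exact: lie_isom_two_solvable iso' (@coadj_two_solvable _ A).
  + exact: lie_isom_frobenius iso' (@coadj_frobenius _ A).
- exact: (@dim8_noniso R).
- exact: (@classify_dim8 R).
- exact: (@cyclic_companion R).
- by move=> i M i5 _; apply: (@noncyclic_not_polysd R).
Qed.
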